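(* For each $k>0$, there exists a constant $K=K(k)>1$ such that the following holds. Let $\Omega\subset \mathbb R^2$ be an open set and let $\mathcal P_{\Omega}=\{D_i\}_{i\in \mathbb N}$ be a packing inside $\Omega$ such that for each $i\in \mathbb N$ the curve $\partial D_i$ is smooth and has curvature bounded below by $k/\operatorname{length}(\partial D_i)$. Then the residual set $\mathcal S$ of $\mathcal P_{\Omega}$ satisfies $$\dim_{\mathscr H} (\mathcal S\cap U) >K>1$$ for every open set $U\subset\mathbb R^2$ with $\mathcal S \cap U \neq \emptyset$. In particular, $\dim_{\mathscr H} (\mathcal S) >K>1$.
   Context: A Jordan region is the open bounded region enclosed by a Jordan curve in $\mathbb R^2$. A packing inside an open set $\Omega\subset\mathbb R^2$ is a countably infinite collection $\mathcal P_\Omega=\{D_i\}_{i\in\mathbb N}$ of open Jordan regions with $D_i\subset\Omega$ for all $i$ and $D_i\cap D_j=\emptyset$ for $i\ne j$ (closures may intersect). Its residual set is $\mathcal S=\Omega\setminus\bigcup_{i\in\mathbb N}D_i$. A smooth Jordan curve means a $C^2$-smooth one: it has a parametrization $\gamma:\mathbb R/\mathbb Z\to C$ that is twice continuously differentiable with $\dot\gamma\neq0$ everywhere. With $\gamma$ chosen of constant speed $|\dot\gamma|=\operatorname{length}(C)$, the (unsigned) curvature is $\kappa(t)=\operatorname{length}(C)^{-2}|\ddot\gamma(t)|$. $\dim_{\mathscr H}$ denotes Hausdorff dimension.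
   Formalization: The final ''in particular'' claim is stated for a nonempty residual set S; it fails when S is empty, for example when Ω is a disjoint union of countably many open discs and the packing consists of exactly those discs. *)

(* Defs.v *)
From HB Require Import structures.
From mathcomp Require Import all_boot all_order all_algebra.
From mathcomp Require Import all_classical all_reals all_analysis.

Set Implicit Arguments.
Unset Strict Implicit.
Unset Printing Implicit Defensive.

Import Order.TTheory GRing.Theory Num.Theory.
Import numFieldNormedType.Exports.

Local Open Scope ring_scope.
Local Open Scope classical_set_scope.

(* The library norm on 'rV[R]_2 is the sup norm: it induces the right topology
   and bounded sets, but lengths and diameters need the Euclidean norm. *)
Definition enorm (R : realType) (v : 'rV[R]_2) : R :=
  Num.sqrt (\sum_(i < 2) v ord0 i ^+ 2).

Definition boundary (T : topologicalType) (A : set T) : set T :=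
  closure A `\` interior A.

(* A map R/Z -> R^2 is encoded as a 1-periodic map on R; the equivalence says
   both that g is 1-periodic and that it is injective modulo Z. *)
Definition jordan_parametrization (R : realType) (g : R -> 'rV[R]_2)
    (C : set 'rV[R]_2) : Prop :=
  [/\ continuous g,
      (forall s t : R, g s = g t <-> s - t \is a Num.int) &
      range g = C].

Definition jordan_curve (R : realType) (C : set 'rV[R]_2) : Prop :=
  exists g : R -> 'rV[R]_2, jordan_parametrization g C.

(* The region enclosed by C is the bounded connected component of its
   complement (unique by the Jordan curve theorem). *)
Definition jordan_region (R : realType) (D : set 'rV[R]_2) : Prop :=
  exists C : set 'rV[R]_2, jordan_curve C /\
  exists x : 'rV[R]_2,
    [/\ ~ C x, D = connected_component (~` C) x & bounded_set D].

Definition is_C2 (R : realType) (g : R -> 'rV[R]_2) : Prop :=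
  [/\ forall t : R, derivable g t 1,
      forall t : R, derivable g^`() t 1 &
      continuous g^`(2)].

Definition smooth_parametrization (R : realType) (g : R -> 'rV[R]_2)
    (C : set 'rV[R]_2) : Prop :=
  [/\ jordan_parametrization g C,
      is_C2 g &
      forall t : R, g^`()%classic t != 0].

Definition smooth_jordan_curve (R : realType) (C : set 'rV[R]_2) : Prop :=
  exists g : R -> 'rV[R]_2, smooth_parametrization g C.

Definition speed (R : realType) (g : R -> 'rV[R]_2) (t : R) : R :=
  enorm (g^`()%classic t).

(* The length of the curve traced by g over one period; it depends only on the
   curve, not on its smooth parametrization g. *)
Definition curve_length (R : realType) (g : R -> 'rV[R]_2) : R :=
  \int[@lebesgue_measure R]_(t in `[0, 1]) speed g t.

Definition has_constant_speed (R : realType) (g : R -> 'rV[R]_2) : Prop :=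
  forall t : R, speed g t = curve_length g.

(* This is the curvature only when g has constant speed. *)
Definition curvature (R : realType) (g : R -> 'rV[R]_2) (t : R) : R :=
  (curve_length g) ^- 2 * enorm (g^`(2)%classic t).

(* C has curvature bounded below by k / length(C). *)
Definition curvature_ge_div_length (R : realType) (C : set 'rV[R]_2)
    (k : R) : Prop :=
  exists g : R -> 'rV[R]_2,
    [/\ smooth_parametrization g C,
        has_constant_speed g &
        forall t : R, k / curve_length g <= curvature g t].

Definition is_packing (R : realType) (Omega : set 'rV[R]_2)
    (D : nat -> set 'rV[R]_2) : Prop :=
  [/\ forall i, jordan_region (D i),
      forall i, D i `<=` Omega &
      forall i j, i <> j -> D i `&` D j = set0].

Definition residual_set (R : realType) (Omega : set 'rV[R]_2)
    (D : nat -> set 'rV[R]_2) : set 'rV[R]_2 :=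
  Omega `\` \bigcup_i D i.

Local Open Scope ereal_scope.

(* diam set0 = -oo, and poweR -oo s = 0 for s > 0, so that empty sets do not
   contribute to the sums below. *)
Definition diam (R : realType) (E : set 'rV[R]_2) : \bar R :=
  ereal_sup [set (enorm (x - y))%:E | x in E & y in E].

Definition hausdorff_premeasure (R : realType) (s delta : R)
    (A : set 'rV[R]_2) : \bar R :=
  ereal_inf [set \sum_(i <oo) (poweR (diam (E i)) s) |
    E in [set E : nat -> set 'rV[R]_2 |
      A `<=` \bigcup_i E i /\ forall i, diam (E i) <= delta%:E]].

Definition hausdorff_measure (R : realType) (s : R) (A : set 'rV[R]_2) :
    \bar R :=
  ereal_sup [set hausdorff_premeasure s delta A |
    delta in [set delta : R | (0 < delta)%R]].

(* Restricting to s > 0 does not change the infimum, and avoids fixing a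
   convention for 0 ^ 0. *)
Definition hausdorff_dim (R : realType) (A : set 'rV[R]_2) : \bar R :=
  ereal_inf [set s%:E | s in
    [set s : R | (0 < s)%R /\ hausdorff_measure s A = 0]].

(* Main.v *)
(* The curvature bound makes each region of the packing convex and uniformly
   strictly convex relative to its size: the midpoint of two points x, y of D is
   the centre of a ball of radius a |x - y|^2 / length contained in D.
   Convexity comes from a curtain of short normal segments along the boundary
   curve, which no region can cross, together with the second order behaviour of
   the curve at a point where a segment or parabola first touches it.

   Strict convexity prevents two disjoint regions from touching along more than
   a point. Hence, at scale t, most boundary points of a region of size at least
   4 t have near them a ball of radius comparable to t that must be covered by
   regions smaller than t or by the sets of a given cover of the residual set.
   Counting areas, the total t * l(D) of the regions of size between 4 t and M t
   is at most 1/8 of the total for sizes between t and M t, plus a constant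
   times the area of the smaller regions and the contribution of the cover.
   Multiplying by t^(1/n - 1), summing over dyadic scales and choosing n large
   leaves l(D)^(1+1/n) <= C sum_j e_j^(1+1/n), where the e_j are the sizes of
   the sets of the cover: the residual set has dimension at least 1 + 1/n. *)

Require Import Defs.
From HB Require Import structures.
From mathcomp Require Import all_boot all_order all_algebra.
From mathcomp Require Import all_classical all_reals all_analysis.
From mathcomp Require Import zify ring lra.

Set Implicit Arguments.
Unset Strict Implicit.
Unset Printing Implicit Defensive.

Import Order.TTheory GRing.Theory Num.Theory.
Import numFieldNormedType.Exports.

Local Open Scope ring_scope.
Local Open Scope classical_set_scope.

(** The exponent comes from comparing windows. A body counts at about [n] dyadic scales on either
    side of the one-scale inequality, while [t^(1/n)] changes only by the factor 2 across these
    scales. The left side thus keeps about half of [n] times its term, against one eighth of [n] on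
    the right, and the remaining error does not grow with [n]; any factor below 1/2 would do in
    place of 1/8. All these constants depend on [a], hence on [k], only.

    A geometric obstacle is orientation: no hypothesis tells on which side of its boundary curve a
    region lies. The curvature bound keeps [g2] from vanishing; it points inwards at an extreme
    point of the region, and the side cannot change along the connected curve. As [g] is only twice
    differentiable, the curtain uses the fixed direction [g2 t0]: a field of varying normals need
    not be differentiable.

    The counting starts from one body whose neighbourhood lies in the given open set. Near a
    residual point there is either such a body or a square free of bodies; in the latter the cover
    alone must fill an area. *)

Definition cx (R : realType) (z : 'rV[R]_2) : R := z ord0 ord0.
Definition cy (R : realType) (z : 'rV[R]_2) : R := z ord0 (lift ord0 ord0).

Definition vec (R : realType) (a b : R) : 'rV[R]_2 :=
  \row_j (if j == ord0 then a else b).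

(** * Coordinates, sup norm and Euclidean norm in the plane *)

Section plane.
Context {R : realType}.
Implicit Types (z w : 'rV[R]_2) (a b c : R).

Lemma ord2P (P : 'I_2 -> Prop) : P ord0 -> P (lift ord0 ord0) -> forall i, P i.
Proof.
move=> h0 h1 i; case: (unliftP ord0 i) => [j ->|-> //].
by rewrite (ord1 j).
Qed.

Lemma vecP z w : cx z = cx w -> cy z = cy w -> z = w.
Proof.
move=> hx hy; apply/matrixP => i j; rewrite (ord1 i).
by elim/ord2P: j.
Qed.

Lemma cxE a b : cx (vec a b) = a. Proof. by rewrite /cx mxE. Qed.
Lemma cyE a b : cy (vec a b) = b. Proof. by rewrite /cy mxE. Qed.
Lemma cxD z w : cx (z + w) = cx z + cx w. Proof. by rewrite /cx mxE. Qed.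
Lemma cyD z w : cy (z + w) = cy z + cy w. Proof. by rewrite /cy mxE. Qed.
Lemma cxN z : cx (- z) = - cx z. Proof. by rewrite /cx mxE. Qed.
Lemma cyN z : cy (- z) = - cy z. Proof. by rewrite /cy mxE. Qed.
Lemma cxZ a z : cx (a *: z) = a * cx z. Proof. by rewrite /cx mxE. Qed.
Lemma cyZ a z : cy (a *: z) = a * cy z. Proof. by rewrite /cy mxE. Qed.
Lemma cx0 : cx (0 : 'rV[R]_2) = 0. Proof. by rewrite /cx mxE. Qed.
Lemma cy0 : cy (0 : 'rV[R]_2) = 0. Proof. by rewrite /cy mxE. Qed.

Definition cE := (cxE, cyE, cxD, cyD, cxN, cyN, cxZ, cyZ, cx0, cy0).

Lemma norm_max z : `|z| = Num.max `|cx z| `|cy z|.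
Proof.
rewrite {1}/Num.Def.normr /= mx_normrE.
apply/eqP; rewrite eq_le; apply/andP; split.
- apply: bigmax_le => [|[i j] _]; first by rewrite le_max normr_ge0.
  rewrite (ord1 i) /=; elim/ord2P: j; rewrite le_max lexx ?orbT //.
- rewrite ge_max; apply/andP; split.
    exact: (@le_bigmax _ _ _ 0 (fun ij => `|z ij.1 ij.2|) (ord0, ord0)).
  exact: (@le_bigmax _ _ _ 0 (fun ij => `|z ij.1 ij.2|)
    (ord0, lift ord0 ord0)).
Qed.

Lemma norm_le z c : (`|z| <= c) = (`|cx z| <= c) && (`|cy z| <= c).
Proof. by rewrite norm_max ge_max. Qed.

Lemma norm_lt z c : (`|z| < c) = (`|cx z| < c) && (`|cy z| < c).
Proof. by rewrite norm_max gt_max. Qed.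

Lemma normx_le z : `|cx z| <= `|z|.
Proof. by rewrite norm_max le_max lexx. Qed.
Lemma normy_le z : `|cy z| <= `|z|.
Proof. by rewrite norm_max le_max lexx orbT. Qed.

Lemma enorm_sqr z : enorm z = Num.sqrt (cx z ^+ 2 + cy z ^+ 2).
Proof. by rewrite /enorm !big_ord_recl big_ord0 addr0. Qed.

Lemma norm_le_enorm z : `|z| <= enorm z.
Proof.
rewrite norm_le enorm_sqr -!sqrtr_sqr !ler_wsqrtr //.
  by rewrite lerDr sqr_ge0.
by rewrite lerDl sqr_ge0.
Qed.

Lemma closureP (A : set 'rV[R]_2) z :
  closure A z <-> forall e, 0 < e -> exists2 w, A w & `|w - z| < e.
Proof.
split=> [clz e e0|h B /nbhs_ballP[e /= e0 be]].
  have [w [Aw]] := clz _ (nbhsx_ballx z e e0).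
  by rewrite -ball_normE /= distrC; exists w.
have [w Aw wz] := h _ e0; exists w; split => //; apply: be.
by rewrite -ball_normE /= distrC.
Qed.

Lemma openP (A : set 'rV[R]_2) z : open A -> A z ->
  exists2 e, 0 < e & forall w, `|w - z| < e -> A w.
Proof.
rewrite openE => oA /oA /nbhs_ballP[e /= e0 be]; exists e => // w wz.
by apply: be; rewrite -ball_normE /= distrC.
Qed.

Lemma openPn (A : set 'rV[R]_2) :
  (forall z, A z -> exists2 e, 0 < e & forall w, `|w - z| < e -> A w) -> open A.
Proof.
move=> h; rewrite openE => z /h[e e0 be]; apply/nbhs_ballP; exists e => //= w.
by rewrite -ball_normE /= distrC => /be.
Qed.

End plane.

(** * Grid points as a substitute for area *)

Section counting.
Context {R : realType}.
Implicit Types (d r x h : R).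

Lemma card_ord_itv (B a b : nat) (P : pred 'I_B) :
  (forall i, P i -> (a <= i < b)%N) -> (#|P| <= b - a)%N.
Proof.
move=> h; rewrite cardE -(size_map val) -(size_iota a (b - a)).
apply: uniq_leq_size; first by rewrite map_inj_uniq ?enum_uniq //; exact: val_inj.
move=> _ /mapP[i + ->]; rewrite mem_enum => /h /andP[ai ib].
by rewrite mem_iota ai /= subnKC // (leq_trans ai) // ltnW.
Qed.

Lemma card_ord_le (B : nat) (P : pred 'I_B) d r : 0 < d -> 0 <= r ->
  (forall i j, P i -> P j -> d * (i%:R - j%:R) <= r) ->
  #|P|%:R <= r / d + 1.
Proof.
move=> d0 r0 h; have [i0 Pi0|P0] := pickP P; last first.
  by rewrite (eq_card0 P0) addr_ge0 // divr_ge0 // ltW.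
have [m Pm hm] : exists2 m : 'I_B, P m & forall i : 'I_B, P i -> (m <= i)%N.
  by case: (arg_minnP (fun i : 'I_B => val i) Pi0) => m Pm hm; exists m.
have rd0 : 0 <= r / d by rewrite divr_ge0 // ltW.
apply: (@le_trans _ _ (Num.truncn (r / d)).+1%:R); last first.
  by rewrite -natr1 lerD2r truncn_le.
rewrite ler_nat; apply: leq_trans (@card_ord_itv _ m (m + (Num.truncn (r / d)).+1) P _) _.
  move=> i Pi; rewrite hm //= addnS ltnS -leq_subLR.
  rewrite truncn_ge_nat // natrB ?hm // ler_pdivlMr // mulrC; exact: h.
by rewrite addKn.
Qed.

Lemma card_ord_ball (B : nat) d x r : 0 < d -> d <= r -> r <= x ->
  x + r <= d * B%:R ->
  r / d <= #|[pred i : 'I_B | `|d * i%:R - x| < r]|%:R.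
Proof.
move=> d0 dr rx xB.
have r0 : 0 < r by exact: lt_le_trans dr.
have exM : exists M : nat, x - r < d * M%:R by exists B; lra.
have exN : exists N : nat, r <= d * N%:R by exists B; lra.
have [M HM minM] := ex_minnP exM; have [N HN minN] := ex_minnP exN.
have lej j : (j < N)%N -> d * j%:R < r.
  by move=> jN; rewrite ltNge; apply/negP => /minN; rewrite leqNgt jN.
have dM : d * M%:R <= x - r + d.
  case: M HM minM => [|M] HM minM; first by rewrite mulr0; lra.
  rewrite -natr1 mulrDr mulr1 lerD2r leNgt; apply/negP => /minM.
  by rewrite ltnn.
have ltB (j : 'I_N) : (M + j < B)%N.
  rewrite -(ltr_nat R) -(ltr_pM2l d0) natrD mulrDr.
  by have := lej _ (ltn_ord j); lra.
apply: (@le_trans _ _ N%:R); first by rewrite ler_pdivrMr // mulrC.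
rewrite ler_nat -{1}(card_ord N).
pose f (j : 'I_N) : 'I_B := Ordinal (ltB j).
have finj : injective f.
  by move=> i j /(congr1 val) /= /addnI /val_inj.
rewrite -(card_imset _ finj); apply: subset_leq_card.
apply/fintype.subsetP => _ /imsetP[j _ ->]; rewrite inE /= natrD mulrDr ltr_norml.
by have := lej _ (ltn_ord j); have : 0 <= d * j%:R by [rewrite mulr_ge0 // ltW]; lra.
Qed.

Lemma card_ord_lt (B : nat) d r : 0 < d -> r <= d * B%:R ->
  r / d <= #|[pred i : 'I_B | d * i%:R < r]|%:R.
Proof.
move=> d0 rB; have exN : exists N : nat, r <= d * N%:R by exists B.
have [N HN minN] := ex_minnP exN.
have NB : (N <= B)%N by exact: minN.
apply: (@le_trans _ _ N%:R); first by rewrite ler_pdivrMr // mulrC.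
rewrite ler_nat -{1}(card_ord N).
have finj : injective (widen_ord NB) by move=> i j /(congr1 val) /= /val_inj.
rewrite -(card_imset _ finj); apply: subset_leq_card.
apply/fintype.subsetP => _ /imsetP[j _ ->]; rewrite inE /=.
by rewrite ltNge; apply/negP => /minN; rewrite leqNgt ltn_ord.
Qed.

Lemma in_asboolP (T : finType) (A : T -> Prop) (t : T) :
  reflect (A t) (t \in [pred u | `[< A u >]]).
Proof. by rewrite inE; exact: asboolP. Qed.

Definition gridpt (o : 'rV[R]_2) h (Q : nat) (ab : 'I_Q * 'I_Q) : 'rV[R]_2 :=
  o + vec (h * ab.1%:R) (h * ab.2%:R).

(** Up to the factor [h ^+ 2] this is the area of [A] inside the window of the grid. The area
    estimates involve finitely many sets of size at least [h], so counting replaces Lebesgue measure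
    and makes sense for arbitrary sets [A]. *)
Definition cnt (o : 'rV[R]_2) h (Q : nat) (A : set 'rV[R]_2) : R :=
  #|[pred ab : 'I_Q * 'I_Q | `[< A (gridpt o h ab) >]]|%:R.

Lemma cntE o h Q A :
  cnt o h Q A = \sum_(ab : 'I_Q * 'I_Q) (`[< A (gridpt o h ab) >] : nat)%:R.
Proof.
rewrite /cnt -sum1_card natr_sum big_mkcond /=.
by apply: eq_bigr => ab _; rewrite inE; case: ifP.
Qed.

Lemma cnt_le o h Q (A : set 'rV[R]_2) r : 0 < h -> 0 <= r ->
  (forall u v, A u -> A v -> `|u - v| <= r) ->
  cnt o h Q A <= (r / h + 1) ^+ 2.
Proof.
move=> h0 r0 hA; rewrite /cnt; set P := [pred _ | _].
pose P1 := [pred a : 'I_Q | [exists b, P (a, b)]].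
pose P2 := [pred b : 'I_Q | [exists a, P (a, b)]].
apply: (@le_trans _ _ (#|P1| * #|P2|)%:R).
  rewrite ler_nat -cardX; apply: subset_leq_card.
  apply/fintype.subsetP => -[a b] Pab; rewrite !inE /=.
  by apply/andP; split; apply/existsP; [exists b|exists a].
rewrite natrM expr2 ler_pM ?ler0n //; apply: card_ord_le => // i j.
- move=> /existsP[b] /= /asboolP Ai /existsP[b'] /= /asboolP Aj.
  have := le_trans (normx_le _) (hA _ _ Ai Aj).
  rewrite /gridpt !cE /= => H; apply: le_trans (ler_norm _) _.
  by apply: le_trans H; rewrite le_eqVlt; apply/orP; left; apply/eqP; congr (`|_|); ring.
- move=> /existsP[b] /= /asboolP Ai /existsP[b'] /= /asboolP Aj.
  have := le_trans (normy_le _) (hA _ _ Ai Aj).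
  rewrite /gridpt !cE /= => H; apply: le_trans (ler_norm _) _.
  by apply: le_trans H; rewrite le_eqVlt; apply/orP; left; apply/eqP; congr (`|_|); ring.
Qed.

Lemma cnt_ge o h Q (q : 'rV[R]_2) r : 0 < h -> h <= r ->
  cx o + r <= cx q -> cx q + r <= cx o + h * Q%:R ->
  cy o + r <= cy q -> cy q + r <= cy o + h * Q%:R ->
  (r / h) ^+ 2 <= cnt o h Q [set y | `|y - q| < r].
Proof.
move=> h0 hr x1 x2 y1 y2; rewrite /cnt; set P := [pred _ | _].
pose P1 := [pred a : 'I_Q | `|h * a%:R - (cx q - cx o)| < r].
pose P2 := [pred a : 'I_Q | `|h * a%:R - (cy q - cy o)| < r].
have rh0 : 0 <= r / h by apply: divr_ge0; lra.
apply: (@le_trans _ _ (#|P1| * #|P2|)%:R); last first.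
  rewrite ler_nat -cardX; apply: subset_leq_card.
  apply/fintype.subsetP => -[a b] /andP[h1 h2]; apply/in_asboolP.
  move: h1 h2; rewrite /= !inE => h1 h2; rewrite norm_lt /gridpt !cE /=.
  rewrite (_ : cx o + h * a%:R - cx q = h * a%:R - (cx q - cx o)); last by ring.
  rewrite (_ : cy o + h * b%:R - cy q = h * b%:R - (cy q - cy o)); last by ring.
  by rewrite h1 h2.
rewrite natrM expr2 ler_pM //; apply: card_ord_ball => //; lra.
Qed.

Lemma cnt_cover o h Q (I : finType) (P : pred I) (A : set 'rV[R]_2)
    (B : I -> set 'rV[R]_2) :
  (forall y, A y -> exists2 i, P i & B i y) ->
  cnt o h Q A <= \sum_(i | P i) cnt o h Q (B i).
Proof.
move=> AB; rewrite cntE.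
under [leRHS]eq_bigr do rewrite cntE.
rewrite exchange_big /=; apply: ler_sum => ab _.
case: asboolP => [Aab|_]; last by rewrite sumr_ge0.
have [i Pi Bi] := AB _ Aab; rewrite (bigD1 i) //=.
by rewrite asboolT // lerDl sumr_ge0.
Qed.

Lemma cntU o h Q (A B : set 'rV[R]_2) :
  cnt o h Q (A `|` B) <= cnt o h Q A + cnt o h Q B.
Proof.
have := @cnt_cover o h Q bool xpredT (A `|` B) (fun b => if b then A else B).
rewrite big_bool /=; apply.
by move=> y [Ay|By]; [exists true|exists false].
Qed.

Lemma cnt_mult o h Q (I : finType) (P : pred I) (A : I -> set 'rV[R]_2)
    (B : set 'rV[R]_2) (N : R) :
  0 <= N ->
  (forall i, P i -> A i `<=` B) ->
  (forall y, #|[pred i | P i && `[< A i y >]]|%:R <= N) ->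
  \sum_(i | P i) cnt o h Q (A i) <= N * cnt o h Q B.
Proof.
move=> N0 AB hN.
under eq_bigr do rewrite cntE.
rewrite exchange_big /= cntE mulr_sumr; apply: ler_sum => ab _.
have -> : \sum_(i | P i) (`[< A i (gridpt o h ab) >] : nat)%:R =
    #|[pred i | P i && `[< A i (gridpt o h ab) >]]|%:R :> R.
  rewrite -sum1_card natr_sum big_mkcond [RHS]big_mkcond /=.
  by apply: eq_bigr => i _; rewrite inE; case: (P i); case: asboolP.
case: asboolP => [_|nB]; first by rewrite mulr1.
rewrite mulr0 eq_card0 // => i; rewrite inE; apply/negP => /andP[Pi /asboolP Ai].
exact/nB/(AB _ Pi).
Qed.

End counting.

(** * Bodies: convex sets with quantitative strict convexity *)

Definition convexs (R : realType) (A : set 'rV[R]_2) : Prop :=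
  forall (x y : 'rV[R]_2) (t : R), A x -> A y -> 0 <= t <= 1 ->
  A (x + t *: (y - x)).

(* Distances are in the sup norm, and l is a size comparable to the diameter. *)
Record body (R : realType) (a l : R) (D : set 'rV[R]_2) : Prop := Body {
  body_gt0 : 0 < l;
  body_open : open D;
  body_convex : convexs D;
  body_diam : forall x y, D x -> D y -> `|x - y| <= l;
  body_mid : forall x y w, D x -> D y -> `|w| < a * `|x - y| ^+ 2 / l ->
    D (2^-1 *: (x + y) + w);
  body_ball : exists2 z, D z & forall y, `|y - z| < a * l -> D y
}.

Section bodies.
Context {R : realType}.
Implicit Types (a l r e : R) (D : set 'rV[R]_2) (x y z p q w : 'rV[R]_2).

Lemma le_normB3 x y z : `|x - z| <= `|x - y| + `|y - z|.
Proof. by rewrite (le_trans _ (ler_normD _ _)) // addrA subrK. Qed.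

Lemma convexs_mid D x y : convexs D -> D x -> D y -> D (2^-1 *: (x + y)).
Proof.
move=> cD Dx Dy; rewrite (_ : _ *: _ = x + 2^-1 *: (y - x)).
  by apply: cD => //; lra.
by apply: vecP; rewrite !cE; field.
Qed.

Lemma closure_diam a l D x y : body a l D -> closure D x -> closure D y ->
  `|x - y| <= l.
Proof.
move=> bD /closureP cx /closureP cy; apply/ler_addgt0Pr => e e0.
have [u Du ux] := cx _ (divr_gt0 e0 (ltr0n _ 2)).
have [v Dv vy] := cy _ (divr_gt0 e0 (ltr0n _ 2)).
have := body_diam bD Du Dv; have := le_normB3 x u y; have := le_normB3 u v y.
by rewrite (distrC x u); lra.
Qed.

Lemma closure_mid a l D x y w : 0 < a -> body a l D ->
  closure D x -> closure D y ->
  `|w| < a * `|x - y| ^+ 2 / l -> D (2^-1 *: (x + y) + w).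
Proof.
move=> a0 bD /closureP cx /closureP cy hw; have l0 := body_gt0 bD.
set A := `|x - y| in hw; have A0 : 0 <= A by exact: normr_ge0.
set b := a / l; have b0 : 0 < b by exact: divr_gt0.
have {}hw : `|w| < b * A ^+ 2 by rewrite /b mulrAC.
(* Replacing [x] and [y] by points of [D] within [e] displaces the midpoint by at most [e] and
   lowers the bound by at most [4 * b * A * e]. This [e] makes the two losses use up only half of
   the slack. *)
pose e := (b * A ^+ 2 - `|w|) / (2 * (1 + 4 * b * A)).
have d0 : 0 < 2 * (1 + 4 * b * A) by have := mulr_ge0 (ltW b0) A0; lra.
have e0 : 0 < e by rewrite divr_gt0 // subr_gt0.
have he : e * (1 + 4 * b * A) < b * A ^+ 2 - `|w|.
  have -> : e * (1 + 4 * b * A) = (b * A ^+ 2 - `|w|) / 2.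
    by rewrite /e; field; lra.
  by have : 0 < b * A ^+ 2 - `|w| by [rewrite subr_gt0]; lra.
have [u Du ux] := cx _ e0; have [v Dv vy] := cy _ e0.
have huv : A - 2 * e <= `|u - v|.
  have := le_normB3 x u y; have := le_normB3 u v y.
  by rewrite (distrC x u) -/A; lra.
have huv2 : A ^+ 2 - 4 * e * A <= `|u - v| ^+ 2.
  have n0 := normr_ge0 (u - v); set n := `|u - v| in huv n0 *.
  have [h|h] := leP 0 (A - 2 * e); nra.
rewrite (_ : _ + w = 2^-1 *: (u + v) + (w + 2^-1 *: (x - u) + 2^-1 *: (y - v))).
  apply: (body_mid bD) => //.
  apply: (@le_lt_trans _ _ (`|w| + e)).
    apply: le_trans (ler_normD _ _) _; apply: le_trans (lerD (ler_normD _ _) (lexx _)) _.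
    rewrite !normrZ gtr0_norm // (distrC x) (distrC y); lra.
  rewrite mulrAC -/b; apply: (@lt_le_trans _ _ (b * (A ^+ 2 - 4 * e * A))); first lra.
  by rewrite ler_pM2l.
by apply: vecP; rewrite !cE; field.
Qed.

(* Otherwise the midpoint of x' and y' lies in both sets. *)
Lemma body_sep a l D D' e x y x' y' : 0 < a -> body a l D -> convexs D' ->
  D `&` D' = set0 -> closure D x -> closure D y -> D' x' -> D' y' ->
  `|x' - x| < e -> `|y' - y| < e -> a * `|x - y| ^+ 2 / l <= e.
Proof.
move=> a0 bD cD' dis cx cy Dx Dy hx hy; rewrite leNgt; apply/negP => h.
suff : (D `&` D') (2^-1 *: (x' + y')) by rewrite dis.
split; last exact: convexs_mid.
rewrite (_ : _ *: _ = 2^-1 *: (x + y) + (2^-1 *: (x' - x) + 2^-1 *: (y' - y))).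
  apply: closure_mid bD _ _ _ => //; apply: le_lt_trans h.
  apply: le_trans (ler_normD _ _) _; rewrite !normrZ gtr0_norm //; lra.
by apply: vecP; rewrite !cE; field.
Qed.

(** The ball about [q] is the image of the inscribed ball about [z] under the homothety centred at
    [p] with ratio [- m]. A point of [D] in it would have its preimage in [D] as well, with [p]
    between the two, so convexity would put [p] in [D]. *)
Lemma body_exterior a l D p r : 0 < a -> body a l D -> closure D p -> ~ D p ->
  0 < r -> exists2 q, `|q - p| <= r / a & forall y, `|y - q| < r -> ~ D y.
Proof.
move=> a0 bD cp nDp r0; have l0 := body_gt0 bD.
have [z Dz hz] := body_ball bD.
pose m := r / (a * l); have m0 : 0 < m by rewrite divr_gt0 // mulr_gt0.
exists (p + m *: (p - z)).
  rewrite (_ : p + _ - p = m *: (p - z)); last by apply: vecP; rewrite !cE; ring.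
  rewrite normrZ gtr0_norm // /m; have := closure_diam bD cp (subset_closure Dz).
  move=> h; apply: (@le_trans _ _ (r / (a * l) * l)); first by rewrite ler_pM2l.
  by rewrite le_eqVlt; apply/orP; left; apply/eqP; field; lra.
move=> y hy Dy; apply: nDp.
have m1 : 0 < 1 + m by lra.
pose u := z + m^-1 *: (p + m *: (p - z) - y).
have Du : D u.
  apply: hz; rewrite /u (_ : z + _ - z = m^-1 *: (p + m *: (p - z) - y)); last first.
    by apply: vecP; rewrite !cE; ring.
  rewrite normrZ gtr0_norm ?invr_gt0 // distrC mulrC ltr_pdivrMr //.
  by rewrite (_ : a * l * m = r) // /m; field; lra.
have -> : p = y + (m / (1 + m)) *: (u - y).
  by apply: vecP; rewrite /u !cE; field; lra.
apply: (body_convex bD) => //; apply/andP; split.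
  by rewrite divr_ge0 // ltW.
by rewrite ler_pdivrMr //; lra.
Qed.

Lemma exit_point D x w l : open D -> D x -> (forall y, D y -> `|x - y| <= l) ->
  w != 0 -> exists2 v, 0 < v &
    [/\ ~ D (x + v *: w), closure D (x + v *: w) &
        forall s, 0 <= s < v -> D (x + s *: w)].
Proof.
move=> oD Dx bD w0.
have nw : 0 < `|w| by rewrite normr_gt0.
pose B := [set v : R | 0 <= v /\ ~ D (x + v *: w)].
have B0 : B !=set0.
  have l0 : 0 <= l by exact: le_trans (normr_ge0 _) (bD _ Dx).
  exists ((l + 1) / `|w|); split; first by rewrite divr_ge0 //; lra.
  move=> /bD; rewrite opprD addrA subrr sub0r normrN normrZ.
  rewrite ger0_norm; last by rewrite divr_ge0 //; lra.
  by rewrite divfK ?normr_eq0 //; lra.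
have lB : has_inf B by split => //; exists 0 => v [].
pose v := inf B; have v0 : 0 <= v by apply: lb_le_inf => // u [].
have inD s : 0 <= s < v -> D (x + s *: w).
  case/andP=> s0 sv; apply: contrapT => nD.
  by have := ge_inf lB.2 (conj s0 nD : B s); rewrite leNgt sv.
have near s e : 0 < e -> `|s - v| < e / `|w| ->
    `|x + s *: w - (x + v *: w)| < e.
  move=> e0; rewrite (_ : x + _ - _ = (s - v) *: w).
    by rewrite normrZ ltr_pdivlMr.
  by apply: vecP; rewrite !cE; ring.
have nDv : ~ D (x + v *: w).
  move=> /(openP oD)[e e0 he].
  have [u [u0 nDu] uv] := inf_adherent (divr_gt0 e0 nw) lB.
  apply: (nDu); apply: he; apply: near => //; rewrite ger0_norm.
    by rewrite ltrBlDl.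
  by rewrite subr_ge0; exact: (ge_inf lB.2 (conj u0 nDu : B u)).
have vgt0 : 0 < v.
  rewrite lt_neqAle v0 andbT; apply/negP => /eqP v00.
  by apply: nDv; rewrite -v00 scale0r addr0.
exists v => //; split => //; apply/closureP => e e0.
pose d := e / `|w|; have d0 : 0 < d by exact: divr_gt0.
exists (x + (Num.max 0 (v - d / 2)) *: w).
  by apply: inD; rewrite le_max lexx /= gt_max vgt0; lra.
apply: near => //; rewrite -/d ltr_norml.
have [h|h] := leP 0 (v - d / 2); lra.
Qed.

Lemma body_boundary_above a l D z s : body a l D ->
  (forall y, `|y - z| < a * l -> D y) -> `|s - cx z| < a * l ->
  exists p, [/\ closure D p, ~ D p & cx p = s].
Proof.
move=> bD hz hs; have Dx : D (vec s (cy z)).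
  apply: hz; rewrite norm_lt !cE hs subrr normr0.
  exact: le_lt_trans hs.
have w0 : vec 0 1 != 0 :> 'rV[R]_2.
  by apply/eqP => /(congr1 (@cy R)); rewrite !cE; lra.
have [v _ [h1 h2 _]] := exit_point (body_open bD) Dx
  (fun y Dy => body_diam bD Dx Dy) w0.
by exists (vec s (cy z) + v *: vec 0 1); split => //; rewrite !cE mulr0 addr0.
Qed.

(** [packing] counts disjoint balls of radius [a * e] in a square of side [2 * (r + 2) * e] by means
    of a grid of step [a * e]; the square contains at most this many grid points. *)
Definition neighbours a r : R := (2 * (r + 2) / a + 1) ^+ 2.

(** A large body may have its inscribed ball far from [y0]. Shrinking that ball towards a point [x]
    of the body near [y0], by the factor [e / l i], gives by convexity a ball of radius [a * e]
    inside the body and within [(r + 2) * e] of [y0]. *)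
Lemma packing (I : finType) (P : pred I) (D : I -> set 'rV[R]_2) (l : I -> R)
    a r e y0 : 0 < a <= 1 -> 0 < e -> 0 <= r ->
  (forall i, P i -> body a (l i) (D i)) ->
  (forall i j, P i -> P j -> i != j -> D i `&` D j = set0) ->
  (forall i, P i -> e <= l i) ->
  (forall i, P i -> exists2 x, D i x & `|x - y0| <= r * e) ->
  #|P|%:R <= neighbours a r.
Proof.
move=> /andP[a0 a1] e0 r0 bD dis el near.
have ae0 : 0 < a * e by exact: mulr_gt0.
have ae1 : a * e <= e by rewrite ger_pMl.
have re0 : 0 <= r * e by rewrite mulr_ge0 // ltW.
have /choice[c hc] : forall i, exists c, P i ->
    `|c - y0| <= (r + 1) * e /\ forall y, `|y - c| < a * e -> D i y.
  move=> i; have [Pi|nPi] := boolP (P i); last by exists 0.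
  have [x Dx hx] := near _ Pi; have [z Dz hz] := body_ball (bD _ Pi).
  have l0 := body_gt0 (bD _ Pi); pose m := e / l i.
  have m0 : 0 < m by exact: divr_gt0.
  have m1 : m <= 1 by rewrite ler_pdivrMr // mul1r; exact: el.
  exists (x + m *: (z - x)) => _; split.
    apply: le_trans (le_normB3 _ x _) _.
    rewrite (_ : x + _ - x = m *: (z - x)); last by apply: vecP; rewrite !cE; ring.
    rewrite normrZ gtr0_norm //.
    suff : m * `|z - x| <= e by lra.
    apply: (@le_trans _ _ (m * l i)); last by rewrite divfK // gt_eqF.
    by rewrite ler_pM2l //; exact: body_diam (bD _ Pi) _ _ Dz Dx.
  move=> y hy; rewrite (_ : y = x + m *: (z + m^-1 *: (y - (x + m *: (z - x))) - x)).
    apply: (body_convex (bD _ Pi)) => //; last by rewrite (ltW m0).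
    apply: hz; rewrite (_ : z + _ - z = m^-1 *: (y - (x + m *: (z - x)))).
      rewrite normrZ gtr0_norm ?invr_gt0 // mulrC ltr_pdivrMr //.
      by rewrite (_ : _ * m = a * e) // /m; field; lra.
    by apply: vecP; rewrite !cE; ring.
  by apply: vecP; rewrite !cE; field; lra.
pose h := a * e; pose o := y0 - vec ((r + 2) * e) ((r + 2) * e).
have [Q hQ] : exists Q : nat, 2 * (r + 2) * e <= h * Q%:R.
  exists (Num.truncn (2 * (r + 2) * e / h)).+1.
  have := truncnS_gt (2 * (r + 2) * e / h).
  by rewrite ltr_pdivrMr // [_ * h]mulrC => /ltW.
have le1 i : P i -> 1 <= cnt o h Q [set y | `|y - c i| < a * e].
  move=> Pi; have [h1 _] := hc _ Pi.
  have hx := le_trans (normx_le _) h1; have hy := le_trans (normy_le _) h1.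
  move: hx hy; rewrite !cE !ler_norml => /andP[x1 x2] /andP[y1 y2].
  apply: (@le_trans _ _ ((a * e / h) ^+ 2)).
    by rewrite divff ?expr1n // gt_eqF.
  by apply: cnt_ge => //; rewrite /o ?cE; nra.
apply: (@le_trans _ _ (\sum_(i | P i) cnt o h Q [set y | `|y - c i| < a * e])).
  by rewrite -sum1_card natr_sum; apply: ler_sum => i Pi; exact: le1.
pose B := [set y | `|y - y0| <= (r + 2) * e].
apply: (@le_trans _ _ (1 * cnt o h Q B)).
  apply: cnt_mult => // [i Pi y /= hy|y].
    have [h1 _] := hc _ Pi; rewrite /B /=.
    by have := le_normB3 y (c i) y0; lra.
  rewrite -[1]/(1%:R) ler_nat; apply/card_le1P => i.
  rewrite inE => /andP[Pi /asboolP yi] j; rewrite !inE.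
  apply/andP/eqP => [[Pj /asboolP yj]|->]; last by split => //; exact/asboolP.
  apply/eqP/negPn/negP => ij.
  have : (D j `&` D i) y by split; [exact: (hc _ Pj).2|exact: (hc _ Pi).2].
  by rewrite dis.
rewrite mul1r /neighbours.
apply: le_trans (@cnt_le _ _ _ _ _ (2 * (r + 2) * e) _ _ _) _ => //.
- by rewrite !mulr_ge0 // ?ltW //; lra.
- move=> u v; rewrite /B /= => hu hv; have := le_normB3 u y0 v.
  by rewrite (distrC y0); lra.
rewrite le_eqVlt; apply/orP; left; apply/eqP; congr (_ ^+ 2).
by rewrite /h; field; lra.
Qed.

End bodies.

(** * Cardinal bounds by covers and by fibres *)

Section finite_cards.
Context {R : realType}.

Lemma card_leU (T : finType) (P A B : pred T) :
  (forall t, P t -> A t || B t) -> (#|P| <= #|A| + #|B|)%N.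
Proof.
move=> h; rewrite -cardUI; apply: (@leq_trans #|[predU A & B]|); last exact: leq_addr.
by apply: subset_leq_card; apply/fintype.subsetP => t /h.
Qed.

Lemma card_cover (T I : finType) (P : pred T) (Q : pred I) (A : I -> pred T) :
  (forall t, P t -> exists2 i, Q i & A i t) ->
  (#|P| <= \sum_(i | Q i) #|A i|)%N.
Proof.
move=> h; rewrite -sum1_card.
under [leqRHS]eq_bigr do rewrite -sum1_card big_mkcond.
rewrite exchange_big big_mkcond /=; apply: leq_sum => t _.
case: ifP => // /h[i Qi Ai]; rewrite (bigD1 i) //= (_ : t \in A i); last exact: Ai.
exact: leq_addr.
Qed.

Lemma card_pairs (I K : finType) (Q : pred I) (A : I -> pred K) :
  #|[pred ik : I * K | Q ik.1 && A ik.1 ik.2]| = (\sum_(i | Q i) #|A i|)%N.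
Proof.
rewrite -sum1_card; under [RHS]eq_bigr do rewrite -sum1_card.
by rewrite (pair_big_dep Q (fun i k => A i k)).
Qed.

Lemma card_pairs_le (I K : finType) (Q : pred I) (P : pred (I * K)) (c N : R) :
  0 <= c -> (forall i k, P (i, k) -> Q i) ->
  (forall i, Q i -> #|[pred k | P (i, k)]|%:R <= c) ->
  #|Q|%:R <= N -> #|P|%:R <= N * c.
Proof.
move=> c0 PQ hc hN; apply: (@le_trans _ _ (\sum_(i | Q i) c)); last first.
  by rewrite sumr_const -mulr_natl ler_wpM2r.
have -> : #|P| = #|[pred ik : I * K | Q ik.1 && P (ik.1, ik.2)]|.
  apply: eq_card => -[i k]; rewrite !inE /= unfold_in.
  by apply/idP/andP => [h|[]//]; split => //; exact: PQ h.
rewrite (card_pairs Q (fun i k => P (i, k))) natr_sum; apply: ler_sum => i Qi.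
exact: hc.
Qed.

End finite_cards.

(** * The inequality at one scale *)

Definition nb (R : realType) (A : set 'rV[R]_2) (r : R) : set 'rV[R]_2 :=
  [set y | exists2 x, A x & `|x - y| < r].

Section scale.
Context {R : realType} (a : R) (I J : finType) (D : I -> set 'rV[R]_2)
  (l : I -> R) (E : J -> set 'rV[R]_2) (e : J -> R) (V : set 'rV[R]_2).

(* Around a visible D i, the sets of the cover of size at least l i are of no
   help, so that the parts left free by larger bodies are covered by small sets. *)
Definition visible : pred I := fun i => `[< nb (D i) (2 * l i) `<=` V /\
  forall j y, l i <= e j -> E j y -> ~ nb (D i) (2 * l i) y >].

(** A body of size [l] receives at least [a * l / (spacing * t) = 32 * N * l / t] candidates, with
    [N = neighbours a 12]. Contacts with other bodies destroy at most [4 * N / t] times the total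
    size, which is one eighth of that rate. The radius 12 covers every use of [packing] at one
    scale. *)
Definition spacing : R := a / (32 * neighbours a 12).
(** By [body_sep] with a size [L >= t], two contacts within [closeness * t] are at distance at most
    [sqrt (closeness * t * L / a) <= spacing * L / 2]. *)
Definition closeness : R := a * spacing ^+ 2 / 4.
(** [body_exterior] finds a ball of radius [gap * t] outside the body at distance at most
    [gap * t / a = closeness * t / 3] from the boundary point, so the ball stays within
    [closeness * t] of that point. *)
Definition gap : R := closeness * a / 3.

Hypothesis a01 : 0 < a <= 1.
Hypothesis bD : forall i, body a (l i) (D i).
Hypothesis disD : forall i j, i != j -> D i `&` D j = set0.
Hypothesis e_gt0 : forall j, 0 < e j.
Hypothesis E_diam : forall j x y, E j x -> E j y -> `|x - y| <= e j.
Hypothesis coverV : forall y, V y -> (exists i, D i y) \/ (exists j, E j y).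
Hypothesis bndV : exists B, forall y, V y -> `|y| <= B.

Let a0 : 0 < a. Proof. by case/andP: a01. Qed.
Let a1 : a <= 1. Proof. by case/andP: a01. Qed.
Let l0 i : 0 < l i. Proof. exact: body_gt0 (bD i). Qed.

Let N0 := neighbours a 12.
Let s := spacing.
Let c := closeness.

Let N0_ge1 : 1 <= N0.
Proof.
rewrite /N0 /neighbours; apply: exprn_ege1; rewrite lerDr divr_ge0 ?ltW //; lra.
Qed.

Let s_gt0 : 0 < s.
Proof. by rewrite /s /spacing divr_gt0 // mulr_gt0 //; have := N0_ge1; rewrite /N0;
  lra. Qed.

Let s_le : s <= 1 / 32.
Proof.
rewrite /s /spacing -/N0 ler_pdivrMr; last by have := N0_ge1; lra.
by have := N0_ge1; have := a1; lra.
Qed.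

Let c_gt0 : 0 < c.
Proof. by rewrite /c /closeness -/s divr_gt0 // mulr_gt0 // exprn_gt0. Qed.

Let c_le : c <= s / 128.
Proof.
rewrite /c /closeness -/s; have h := s_le; have h0 := s_gt0.
have : s ^+ 2 <= s / 32 by rewrite expr2; nra.
have : 0 <= s ^+ 2 by exact: sqr_ge0.
have := a0; have := a1; nra.
Qed.

(** The neighbourhood of the small body lies inside that of [D i], hence inside [V]. Visibility can
    fail only through a cover set of size between [l m] and [l i], because larger ones stay away
    from the neighbourhood of [D i]. *)
Lemma visible_small i m : visible i -> 4 * l m <= l i ->
  (exists x y, [/\ D m x, closure (D i) y & `|x - y| < l i / 4]) ->
  visible m \/ exists j y, [/\ l m <= e j, e j < l i, E j y & nb (D m) (2 * l m) y].
Proof.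
move=> /asboolP[iV iE] lm [x [y [Dx cy xy]]].
have sub : nb (D m) (2 * l m) `<=` nb (D i) (2 * l i).
  move=> z [w Dw wz]; have /closureP/(_ (l i / 4)) := cy.
  case=> [|u Du uy]; first by have := l0 i; lra.
  exists u => //; have := le_normB3 u y z; have := le_normB3 y x z.
  have := le_normB3 x w z; have := body_diam (bD m) Dx Dw.
  by rewrite (distrC y x); have := l0 i; lra.
have [h|h] := pselect (exists j y, [/\ l m <= e j, e j < l i, E j y &
  nb (D m) (2 * l m) y]); [by right|left].
apply/asboolP; split=> [z /sub /iV //|j z lej Ejz nz].
have [ej|ej] := ltP (e j) (l i); first by apply: h; exists j, z.
exact: iE ej Ejz (sub _ nz).
Qed.

Section one_scale.
Variables (t M : R).
Hypothesis t0 : 0 < t.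

Let W : pred I := fun i => [&& visible i, 4 * t <= l i & l i <= M * t].
Let W' : pred I := fun i => [&& visible i, t <= l i & l i <= M * t].

Let st0 : 0 < s * t. Proof. exact: mulr_gt0. Qed.

Section candidates.
Variables (B : nat) (z : I -> 'rV[R]_2) (p : I -> 'I_B -> 'rV[R]_2).

Let cand : pred (I * 'I_B) :=
  fun ik => W ik.1 && (s * t * ik.2%:R < a * l ik.1).

Hypothesis hB : forall i, a * l i <= s * t * B%:R.
Hypothesis p_cl : forall i k, cand (i, k) -> closure (D i) (p i k).
Hypothesis p_out : forall i k, cand (i, k) -> ~ D i (p i k).
Hypothesis p_x : forall i k, cand (i, k) -> cx (p i k) = cx (z i) + s * t * k%:R.

Let W_t i k : cand (i, k) -> [/\ visible i, 4 * t <= l i & l i <= M * t].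
Proof. by case/andP => /and3P[]. Qed.

Let cand_dist i k k' : cand (i, k) -> cand (i, k') ->
  s * t * (k%:R - k'%:R) <= `|p i k - p i k'|.
Proof.
move=> h h'; apply: le_trans (le_trans (ler_norm _) (normx_le _)).
by rewrite !cE !p_x // opprD addrACA subrr add0r mulrBr.
Qed.

Let cand_count i (P : pred 'I_B) r : 0 <= r ->
  (forall k, P k -> cand (i, k)) ->
  (forall k k', P k -> P k' -> `|p i k - p i k'| <= r) ->
  #|P|%:R <= r / (s * t) + 1.
Proof.
move=> r0 hP hr; apply: card_ord_le => // k k' Pk Pk'.
by apply: le_trans (hr _ _ Pk Pk'); apply: cand_dist; exact: hP.
Qed.

Lemma candidates_ge :
  \sum_(i | W i) a * l i / (s * t) <= #|cand|%:R.
Proof.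
rewrite (_ : #|cand| =
    (\sum_(i | W i) #|[pred k : 'I_B | (s * t * k%:R < a * l i)%R]|)%N).
  by rewrite natr_sum; apply: ler_sum => i _; exact: card_ord_lt.
by rewrite -card_pairs; apply: eq_card => ik.
Qed.

(** A cover set is allowed to account for a point of a free ball from distance [4 * e j], and the
    ball is within [c * t <= e j] of the candidate; hence [5 * e j] from [p]. *)
Let badE j : pred (I * 'I_B) := fun ik => cand ik &&
  `[< [/\ t <= e j, e j < l ik.1 &
          exists2 x, E j x & `|x - p ik.1 ik.2| < 5 * e j] >].

Let touch m : pred (I * 'I_B) := fun ik => cand ik &&
  `[< m != ik.1 /\ exists2 x, D m x & `|x - p ik.1 ik.2| < c * t >].

(** At most [N0] bodies of size at least [e j] come near [E j]. In each, two affected candidates are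
    within [5 + 1 + 5] times [e j], and a twelfth [e j] absorbs the [+ 1] of [cand_count]. *)
Lemma badE_card j : t <= e j -> #|badE j|%:R <= N0 * (12 * e j / (s * t)).
Proof.
move=> te; have ej := e_gt0 j.
have c0 : 0 <= 12 * e j / (s * t) by rewrite divr_ge0 // ?ltW //; lra.
have [[y0 Ey0]|nE] := pselect (exists y, E j y); last first.
  rewrite (_ : #|badE j| = 0)%N; first by rewrite mulr_ge0 //; have := N0_ge1; lra.
  apply: eq_card0 => ik; apply/negbTE/negP => /andP[_ /asboolP[_ _ [x Ex _]]].
  by apply: nE; exists x.
apply: (@card_pairs_le _ _ _ [pred i | `[< e j <= l i /\
    exists2 x, D i x & `|x - y0| <= 12 * e j >]]) => //.
- move=> i k /andP[ck /asboolP[_ eli [x Ex xp]]]; apply/asboolP.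
  split; first exact: ltW.
  have /closureP/(_ _ ej)[u Du up] := p_cl ck.
  exists u => //; have := le_normB3 u (p i k) y0; have := le_normB3 (p i k) x y0.
  by rewrite (distrC (p i k) x); have := E_diam Ex Ey0; move: xp; rewrite /=; lra.
- move=> i _; apply: (@le_trans _ _ (11 * e j / (s * t) + 1)).
    apply: (@cand_count i) => [|k /andP[]//|k k']; first lra.
    move=> /andP[_ /asboolP[_ _ [x Ex /= xp]]] /andP[_ /asboolP[_ _ [x' Ex' /= xp']]].
    have := le_normB3 (p i k) x (p i k'); have := le_normB3 x x' (p i k').
    by rewrite (distrC (p i k) x); have := E_diam Ex Ex'; lra.
  rewrite -lerBrDl -mulrBl ler_pdivlMr // mul1r.
  have : s * t <= e j by apply: (@le_trans _ _ t) => //; rewrite ger_pMl //;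
    have := s_le; lra.
  by lra.
- apply: (@packing _ _ _ D l a 12 (e j) y0) => //; try lra.
  + by move=> i j' _ _; exact: disD.
  + by move=> i /asboolP[].
  + by move=> i /asboolP[].
Qed.

(** Strict convexity of either body confines the contact: [body_sep], applied in the body of size
    [L], puts the contact points within [s / 2 * L] of one another. The choice [L = l m] is what
    allows a contact to be charged to a smaller partner. *)
Lemma touch_count i m L : t <= L -> L = l i \/ L = l m ->
  #|[pred k | touch m (i, k)]|%:R <= 2 * (L / t).
Proof.
move=> tL hL; have s1 := s_le; have c1 := c_le; have s0 := s_gt0; have c0 := c_gt0.
have L0 : 0 < L by exact: lt_le_trans tL.
suff H : #|[pred k | touch m (i, k)]|%:R <= s * L / (s * t) + 1.
  apply: le_trans H _; rewrite (_ : s * L / (s * t) = L / t).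
    by rewrite mulr_natl mulr2n lerD2l ler_pdivlMr // mul1r.
  by field; rewrite (gt_eqF t0) (gt_eqF s0).
have sep x y : a * `|x - y| ^+ 2 / L <= c * t -> `|x - y| <= s / 2 * L.
  set n := `|_| => h; have n0 : 0 <= n by exact: normr_ge0.
  rewrite -(@ler_pXn2r _ 2) ?nnegrE //; last by rewrite mulr_ge0 // ?ltW //; lra.
  have : a * n ^+ 2 <= c * L ^+ 2.
    move: h; rewrite ler_pdivrMr // => h; apply: le_trans h _.
    by rewrite expr2 mulrA ler_pM2r // ler_pM2l.
  rewrite /c /closeness -/s => h2; rewrite -(ler_pM2l a0); apply: le_trans h2 _.
  by rewrite le_eqVlt; apply/orP; left; apply/eqP; field.
apply: (@cand_count i); [by rewrite mulr_ge0 // ltW|by move=> k /andP[]|].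
move=> k k' /andP[ck /asboolP[mi [x Dx /= xp]]] /andP[ck' /asboolP[_ [x' Dx' /= xp']]].
case: hL => hL.
- have := @body_sep _ a (l i) (D i) (D m) (c * t) _ _ x x' a0 (bD i)
    (body_convex (bD m)) (disD _) (p_cl ck) (p_cl ck') Dx Dx' xp xp'.
  by rewrite -hL eq_sym => /(_ mi)/sep; nra.
have /closureP := p_cl ck; have d0 : 0 < c * t - `|x - p i k| by rewrite subr_gt0.
move=> /(_ _ d0)[q Dq qp].
have /closureP := p_cl ck'; have d0' : 0 < c * t - `|x' - p i k'| by rewrite subr_gt0.
move=> /(_ _ d0')[q' Dq' qp'].
have h1 : `|q - x| < c * t.
  by have := le_normB3 q (p i k) x; rewrite (distrC (p i k) x); lra.
have h2 : `|q' - x'| < c * t.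
  by have := le_normB3 q' (p i k') x'; rewrite (distrC (p i k') x'); lra.
have := @body_sep _ a (l m) (D m) (D i) (c * t) _ _ q q' a0 (bD m)
    (body_convex (bD i)) (disD _) (subset_closure Dx) (subset_closure Dx') Dq Dq' h1 h2.
rewrite -hL => /(_ mi)/sep h3.
have := le_normB3 (p i k) x (p i k'); have := le_normB3 x x' (p i k').
rewrite (distrC (p i k) x) => h4 h5.
have : c * t <= s / 128 * L by apply: ler_pM => //; exact: ltW.
by nra.
Qed.

(** A contact is charged to [i] itself if the partner has size at least [l i / 4], as [i] has few
    such neighbours. Otherwise it is charged to the smaller partner [m], which has few neighbours
    larger than itself, at a cost proportional to [l m]. *)
Let bad1 i : pred (I * 'I_B) :=
  fun ik => (i == ik.1) && [exists m, (l i <= 4 * l m) && touch m ik].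
Let bad2 m : pred (I * 'I_B) := fun ik => (4 * l m < l ik.1) && touch m ik.

Lemma bad1_card i : W i -> #|bad1 i|%:R <= N0 * (2 * (l i / t)).
Proof.
move=> Wi; have /and3P[vi tl lM] := Wi.
have lt0 : 0 <= 2 * (l i / t) by rewrite mulr_ge0 // divr_ge0 // ltW.
pose Q : pred I := fun m => `[< [/\ m != i, l i / 4 <= l m &
  exists k, touch m (i, k)] >].
have [z0 Dz0 _] := body_ball (bD i).
apply: (@le_trans _ _ (\sum_(m | Q m) #|[pred k | touch m (i, k)]|)%:R).
  rewrite ler_nat.
  apply: (@leq_trans (\sum_(m | Q m) #|[pred ik | (ik.1 == i) && touch m (i, ik.2)]|)).
    apply: card_cover => -[i' k] /andP[/eqP /= <-{i'}] /existsP[m /andP[h1 h2]].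
    exists m; last by rewrite /= eqxx.
    have /andP[_ /asboolP[mi _]] := h2.
    by apply/asboolP; split => //; [lra|exists k].
  apply: leq_sum => m _.
  by rewrite (card_pairs (pred1 i) (fun _ k => touch m (i, k))) big_pred1_eq.
rewrite natr_sum; apply: (@le_trans _ _ (\sum_(m | Q m) (2 * (l i / t)))).
  apply: ler_sum => m _; apply: (@touch_count i m (l i)); [have := t0; lra|by left].
rewrite sumr_const -[_ *+ #|_|]mulr_natl ler_wpM2r //.
apply: (@packing _ _ _ D l a 12 (l i / 4) z0) => //; try lra.
- by have := l0 i; lra.
- by move=> m m' _ _; exact: disD.
- by move=> m /asboolP[].
- move=> m /asboolP[mi _ [k /andP[ck /asboolP[_ [x Dx /= xp]]]]]; exists x => //.
  have := le_normB3 x (p i k) z0.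
  have := closure_diam (bD i) (p_cl ck) (subset_closure Dz0).
  have : c * t <= l i.
    rewrite -[leRHS]mul1r; apply: ler_pM => //; [exact: ltW|exact: ltW| |have := t0; lra].
    by have := c_le; have := s_le; lra.
  by have := l0 i; lra.
Qed.

Lemma bad2_card m : t <= l m -> #|bad2 m|%:R <= N0 * (2 * (l m / t)).
Proof.
move=> tl; have lt0 : 0 <= 2 * (l m / t) by rewrite mulr_ge0 // divr_ge0 // ltW.
have [z0 Dz0 _] := body_ball (bD m).
apply: (@card_pairs_le _ _ _ (fun i => `[< l m <= l i /\ exists k, touch m (i,
  k) >])) => //.
- move=> i k /andP[/= h1 h2]; apply/asboolP; split; last by exists k.
  by have := l0 m; lra.
- move=> i _; apply: le_trans (@touch_count i m (l m) tl (or_intror erefl)).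
  rewrite ler_nat; apply: subset_leq_card; apply/fintype.subsetP => k.
  by rewrite !inE => /andP[].
- apply: (@packing _ _ _ D l a 12 (l m) z0) => //; try lra.
  + by move=> i i' _ _; exact: disD.
  + by move=> i /asboolP[].
  + move=> i /asboolP[_ [k /andP[ck /asboolP[_ [x Dx /= xp]]]]].
    have /closureP/(_ _ (l0 m))[u Du up] := p_cl ck.
    exists u => //; have := le_normB3 u (p i k) z0; have := le_normB3 (p i k) x z0.
    rewrite (distrC (p i k) x); have := body_diam (bD m) Dx Dz0.
    have : c * t <= l m.
      rewrite -[leRHS]mul1r; apply: ler_pM => //; [exact: ltW|exact: ltW|].
      by have := c_le; have := s_le; lra.
    by have := l0 m; lra.
Qed.

Definition good : pred (I * 'I_B) := fun ik =>
  [&& cand ik, [forall j, ~~ badE j ik], ~~ bad1 ik.1 ik &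
      [forall m, (visible m && (t <= l m)) ==> ~~ bad2 m ik]].

Lemma good_card :
  \sum_(i | W i) l i <= t / (32 * N0) * #|good|%:R +
    8^-1 * (\sum_(i | W' i) l i) +
    (s^-1) * \sum_(j | t <= e j <= M * t) e j.
Proof.
have N1 := N0_ge1.
have tn0 : t != 0 by rewrite gt_eqF.
have sn0 : s != 0 by rewrite gt_eqF.
have Ngt0 : 0 < N0 by exact: lt_le_trans N1.
have Nn0 : N0 != 0 by rewrite gt_eqF.
have aE : a = 32 * N0 * s by rewrite /s /spacing -/N0; field.
have H : #|cand|%:R <= #|good|%:R + \sum_(j | t <= e j <= M * t) #|badE j|%:R +
   \sum_(i | W i) #|bad1 i|%:R + \sum_(m | W' m) #|bad2 m|%:R :> R.
  rewrite -!natr_sum -!natrD ler_nat.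
  pose BE : pred (I * 'I_B) := fun ik => [exists j, (t <= e j <= M * t) && badE j ik].
  pose B1 : pred (I * 'I_B) := fun ik => [exists i, W i && bad1 i ik].
  pose B2 : pred (I * 'I_B) := fun ik => [exists m, W' m && bad2 m ik].
  have cBE : (#|BE| <= \sum_(j | (t <= e j <= M * t)%R) #|badE j|)%N.
    by apply: card_cover => ik /existsP[j /andP[h1 h2]]; exists j.
  have cB1 : (#|B1| <= \sum_(i | W i) #|bad1 i|)%N.
    by apply: card_cover => ik /existsP[j /andP[h1 h2]]; exists j.
  have cB2 : (#|B2| <= \sum_(i | W' i) #|bad2 i|)%N.
    by apply: card_cover => ik /existsP[j /andP[h1 h2]]; exists j.
  apply: leq_trans (leq_add (leq_add (leq_add (leqnn _) cBE) cB1) cB2).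
  apply: leq_trans (leq_add (leq_add (card_leU (P := predU good BE) _) (leqnn _))
    (leqnn _)).
    apply: leq_trans (leq_add (card_leU (P := predU (predU good BE) B1) _) (leqnn _)).
      apply: (card_leU (A := predU (predU good BE) B1)) => -[i k] ck.
      apply/orP; case: (boolP (B2 (i, k))) => [|nB2]; [by right|left].
      rewrite /= -orbA; case: (boolP (BE (i, k))) => [|nBE]; first by rewrite /= orbT.
      case: (boolP (B1 (i, k))) => [|nB1]; first by rewrite /= !orbT.
      apply/orP; left; have [vi tl lM] := W_t ck.
      have Wi : W i by apply/and3P.
      apply/and4P; split => //.
      - apply/forallP => j; apply/negP => bj; move: nBE => /existsP; apply.
        exists j; rewrite bj andbT; have /andP[_ /asboolP[-> /= h _]] := bj.
        by move: h => /=; lra.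
      - apply/negP => b1; move: nB1 => /existsP; apply; exists i.
        by rewrite Wi.
      - apply/forallP => m; apply/implyP => /andP[vm tm]; apply/negP => b2.
        move: nB2 => /existsP; apply; exists m; rewrite b2 andbT; apply/and3P;
          split => //.
        by have /andP[/= h _] := b2; have := l0 m; lra.
    by move=> ik.
  by move=> ik.
have h1 : \sum_(j | t <= e j <= M * t) #|badE j|%:R <=
    12 * N0 / (s * t) * \sum_(j | t <= e j <= M * t) e j.
  rewrite mulr_sumr; apply: ler_sum => j /andP[te _]; apply: le_trans (badE_card te) _.
  by rewrite le_eqVlt; apply/orP; left; apply/eqP; field; rewrite ?tn0 ?sn0.
have h2 : \sum_(i | W i) #|bad1 i|%:R <= 2 * N0 / t * \sum_(i | W' i) l i.
  apply: (@le_trans _ _ (2 * N0 / t * \sum_(i | W i) l i)).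
    rewrite mulr_sumr; apply: ler_sum => i Wi; apply: le_trans (bad1_card Wi) _.
    by rewrite le_eqVlt; apply/orP; left; apply/eqP; field; rewrite ?tn0 ?sn0.
  rewrite ler_wpM2l //; first by rewrite divr_ge0 ?(ltW t0) // mulr_ge0 // ltW.
  rewrite big_mkcond [leRHS]big_mkcond; apply: ler_sum => i _.
  case: ifP => [/and3P[vi tl lM]|_].
    by rewrite ifT //; apply/and3P; split => //; have := t0; lra.
  by case: ifP => // _; exact: ltW.
have h3 : \sum_(i | W' i) #|bad2 i|%:R <= 2 * N0 / t * \sum_(i | W' i) l i.
  rewrite mulr_sumr; apply: ler_sum => i /and3P[_ ti _].
  apply: le_trans (bad2_card ti) _.
  by rewrite le_eqVlt; apply/orP; left; apply/eqP; field; rewrite ?tn0 ?sn0.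
have h4 := candidates_ge.
have h5 : \sum_(i | W i) a * l i / (s * t) = 32 * N0 / t * \sum_(i | W i) l i.
  rewrite mulr_sumr; apply: eq_bigr => i _; rewrite aE.
  by field; rewrite tn0 sn0.
move: H h4; rewrite h5; set S := \sum_(i | W i) l i.
move: h1 h2 h3; set S' := \sum_(i | W' i) l i; set SE := \sum_(j | _) e j.
set X1 := \sum_(j | _) _; set X2 := \sum_(i | _) _; set X3 := \sum_(i | _) _.
set g := (#|good|%:R : R) => h1 h2 h3 h4 {h5}.
move=> /le_trans => /(_ _ h4) h.
have {}h : 32 * N0 / t * S <= g + 12 * N0 / (s * t) * SE + 4 * N0 / t * S'.
  by apply: le_trans h _; rewrite (_ : 4 * N0 / t * S' = 2 * N0 / t * S' + 2 * N0 / t *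
    S'); [lra|ring].
have k0 : 0 < t / (32 * N0) by rewrite divr_gt0 // mulr_gt0.
have := h; rewrite -(ler_pM2l k0).
have -> : t / (32 * N0) * (32 * N0 / t * S) = S by field; rewrite tn0 Nn0.
move=> {}h; apply: le_trans h _.
have -> : t / (32 * N0) * (g + 12 * N0 / (s * t) * SE + 4 * N0 / t * S') =
  t / (32 * N0) * g + 8^-1 * S' + (12 / 32) * (s^-1 * SE) by field; rewrite tn0 sn0 Nn0.
rewrite lerD2l ler_piMl //; last lra.
have SE0 : 0 <= SE by apply: sumr_ge0 => j _; exact: ltW.
by rewrite mulr_ge0 // invr_ge0 ltW.
Qed.

Variable q : I -> 'I_B -> 'rV[R]_2.
Hypothesis q_near : forall i k, cand (i, k) -> `|q i k - p i k| <= gap * t / a.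
Hypothesis q_out : forall i k y, cand (i, k) -> `|y - q i k| < gap * t -> ~ D i y.

(** The factor 4 accounts for small bodies that are not visible: such a [D m] has within [2 * l m] a
    point of some [E j] with [l m <= e j], so all of [D m] is within [3 * e j] of that point. *)
Let covered : set 'rV[R]_2 := [set y |
  (exists2 m, visible m && (l m < t) & D m y) \/
  (exists2 j, e j < t & nb (E j) (4 * e j) y)].

Let gap_gt0 : 0 < gap.
Proof. by rewrite /gap divr_gt0 // mulr_gt0. Qed.

Let gap_le : gap <= c / 3.
Proof. by rewrite /gap -/c ler_pM2r // ger_pMr. Qed.

Let gapa_le : gap / a = c / 3.
Proof. by rewrite /gap -/c; field; rewrite gt_eqF. Qed.

Let ball_near i k y : cand (i, k) -> `|y - q i k| < gap * t ->
  `|y - p i k| < c * t.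
Proof.
move=> ck yq; have := le_normB3 y (q i k) (p i k); have := q_near ck.
rewrite mulrAC gapa_le; have : gap * t <= c / 3 * t by rewrite ler_pM2r.
by have : 0 < c * t by [exact: mulr_gt0]; lra.
Qed.

(** The point [y] is in the neighbourhood of [D i], hence in a body or a cover set. Visibility and
    [badE] exclude cover sets of size at least [t], the choice of [q] excludes [D i], [bad1]
    excludes partners of size at least [l i / 4], and [bad2] visible ones of size at least [t]. For
    a partner that is not visible, [visible_small] supplies a cover set. *)
Lemma good_ball i k y : good (i, k) -> `|y - q i k| < gap * t -> covered y.
Proof.
case/and4P => ck /forallP nE /negP n1 /forallP n2 yq.
have yp := ball_near ck yq; have [vi tl lM] := W_t ck.
have li := l0 i; have tt := t0; have cc := c_gt0.
have cs : c * t <= t / 4.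
  by have := c_le; have := s_le => h1 h2; have := t0; nra.
have /asboolP[iV iE] := vi.
have nby : nb (D i) (2 * l i) y.
  have /closureP/(_ _ li)[u Du up] := p_cl ck; exists u => //.
  have := le_normB3 u (p i k) y; rewrite (distrC (p i k) y) => h.
  by have := t0; lra.
have farE j x : e j < l i -> E j x -> `|x - y| < 4 * e j -> e j < t.
  move=> el Ex xy; rewrite ltNge; apply/negP => te; apply: (negP (nE j)).
  apply/andP; split => //; apply/asboolP; split => //; exists x => //=.
  by have := le_normB3 x y (p i k); lra.
have [[m Dm]|[j Ej]] := coverV (iV _ nby); last first.
  have el : e j < l i.
    by rewrite ltNge; apply/negP => h; exact: iE h Ej nby.
  right; exists j.
    by apply: (farE j y) => //; rewrite subrr normr0; have := e_gt0 j; lra.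
  by exists y => //; rewrite subrr normr0; have := e_gt0 j; lra.
have mi : m != i by apply/eqP => mi; apply: (q_out ck yq); rewrite -mi.
have tm : touch m (i, k).
  by apply/andP; split => //; apply/asboolP; split => //; exists y.
have ml : 4 * l m < l i.
  rewrite ltNge; apply/negP => h; apply: n1; rewrite /bad1 /= eqxx /=.
  by apply/existsP; exists m; rewrite h.
have := visible_small vi (ltW ml); case.
- by exists y, (p i k); split => //; [exact: p_cl|have := t0; lra].
- move=> vm; left; exists m => //; rewrite vm /= ltNge; apply/negP => tlm.
  have := n2 m; rewrite vm tlm /= => /negP; apply.
  by apply/andP.
- move=> [j [x [lme el Ex [w Dw wx]]]]; right.
  have xy : `|x - y| < 4 * e j.
    have := le_normB3 x w y; rewrite (distrC x w); have := body_diam (bD m) Dw Dm.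
    by have := l0 m; lra.
  by exists j; [exact: (farE j x)|exists x].
Qed.

(** At most [N0] bodies of size at least [t] come near [y]. Along one body the candidates are at
    least [s * t] apart, whereas those whose balls contain [y] are within [2 * c * t <= s * t],
    which leaves at most two. *)
Lemma good_mult y : #|[pred ik : I * 'I_B | good ik && `[< `|y - q ik.1 ik.2| < gap * t
  >]]|%:R
  <= N0 * 2 :> R.
Proof.
apply: (@card_pairs_le _ _ _ (fun i => `[< t <= l i /\ exists2 x,
  D i x & `|x - y| <= 12 * t >])) => //.
- move=> i k /andP[/and4P[ck _ _ _] /asboolP /= yq]; have [vi tl lM] := W_t ck.
  apply/asboolP; split; first by have := t0; lra.
  have /closureP/(_ _ t0)[u Du up] := p_cl ck; exists u => //.
  have := le_normB3 u (p i k) y; rewrite (distrC (p i k) y).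
  have := ball_near ck yq; have : c * t <= t.
    by rewrite ger_pMl //; have := c_le; have := s_le; lra.
  by have := t0; lra.
- move=> i _; apply: (@le_trans _ _ (2 * (c * t) / (s * t) + 1)).
    apply: (@cand_count i) => [|k /andP[/and4P[]] //|k k'].
      by rewrite mulr_ge0 // mulr_ge0 // ltW.
    move=> /andP[/and4P[ck _ _ _] /asboolP /= yq] /andP[/and4P[ck' _ _ _] /asboolP /=
      yq'].
    have := ball_near ck yq; have := ball_near ck' yq'.
    by have := le_normB3 (p i k) y (p i k'); rewrite (distrC (p i k) y); lra.
  rewrite [leRHS](_ : _ = 1 + 1) ?lerD2r; last by ring.
  rewrite ler_pdivrMr // mul1r mulrA ler_pM2r //.
  by have := c_le; have := s_gt0; lra.
- apply: (@packing _ _ _ D l a 12 t y) => //; try lra.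
  + by move=> i i' _ _; exact: disD.
  + by move=> i /asboolP[].
  + by move=> i /asboolP[].
Qed.

Lemma good_card_le : #|good|%:R * (gap * t) ^+ 2 <= 200 * N0 *
  (\sum_(m | visible m && (l m < t)) l m ^+ 2 + \sum_(j | e j < t) e j ^+ 2).
Proof.
have [K hK] := bndV.
(* The grid step lies below every size in play, so that the rounding in [cnt_le] is absorbed: [(d *
   x / h + 1) ^+ 2 <= (d + 1) ^+ 2 * (x / h) ^+ 2]. The worst case is [d = 9], from
   [nb (E j) (4 * e j)], which gives 100; the multiplicity [N0 * 2] makes it [200 * N0]. *)
pose mm := \big[Num.min/gap * t]_m l m; pose me := \big[Num.min/mm]_j e j.
have g0 : 0 < gap * t by exact: mulr_gt0.
have mm0 : 0 < mm by rewrite /mm; elim/big_ind: _ => // x y hx hy; rewrite lt_min hx.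
have h0 : 0 < me by rewrite /me; elim/big_ind: _ => // x y hx hy; rewrite lt_min hx.
pose h := me.
have hmm : h <= mm by exact: bigmin_le_id.
have hg : h <= gap * t by apply: le_trans hmm _; exact: bigmin_le_id.
have hl m : h <= l m by apply: le_trans hmm _; exact: bigmin_le.
have he j : h <= e j by exact: bigmin_le.
pose K1 := K + gap * t; pose o := - vec K1 K1.
have [Q hQ] : exists Q : nat, 2 * K1 <= h * Q%:R.
  exists (Num.truncn (2 * K1 / h)).+1.
  have := truncnS_gt (2 * K1 / h).
  by rewrite ltr_pdivrMr // [_ * h]mulrC => /ltW.
have step1 : #|good|%:R * (gap * t / h) ^+ 2 <=
    \sum_(ik | good ik) cnt o h Q [set y | `|y - q ik.1 ik.2| < gap * t].
  rewrite mulr_natl -sumr_const; apply: ler_sum => -[i k] gik.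
  have /and4P[ck _ _ _] := gik; have [vi _ _] := W_t ck.
  have /asboolP[iV _] := vi; have li := l0 i.
  have qK : `|q i k| <= K.
    apply: hK; apply: iV; have /closureP/(_ _ li)[u Du up] := p_cl ck.
    exists u => //; have := le_normB3 u (p i k) (q i k); rewrite (distrC (p i k) _).
    have := @ball_near i k (q i k) ck; rewrite subrr normr0 => /(_ g0).
    have [_ tl _] := W_t ck; have : c * t <= t.
      by rewrite ger_pMl //; have := c_le; have := s_le; lra.
    by have := t0; lra.
  have := le_trans (normx_le _) qK; have := le_trans (normy_le _) qK.
  rewrite !ler_norml => /andP[y1 y2] /andP[x1 x2].
  by apply: cnt_ge => //=; rewrite /o !cE /K1; move: hQ; rewrite /K1; lra.
have step2 : \sum_(ik | good ik) cnt o h Q [set y | `|y - q ik.1 ik.2| < gap * t] <=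
   N0 * 2 * cnt o h Q covered.
  apply: cnt_mult => [|[i k] gik y /= yq|y]; first by have := N0_ge1; lra.
    exact: good_ball gik yq.
  exact: good_mult.
have sq4 x d : h <= x -> 0 <= d -> (d * x / h + 1) ^+ 2 <= (d + 1) ^+ 2 * (x ^+ 2 / h
  ^+ 2).
  move=> hx d0; have x0 : 0 < x by exact: lt_le_trans hx.
  rewrite -expr_div_n -exprMn lerXn2r ?nnegrE //.
  - by rewrite addr_ge0 // divr_ge0 ?(ltW h0) // mulr_ge0 // ltW.
  - by rewrite mulr_ge0 ?divr_ge0 ?(ltW h0) ?(ltW x0) // addr_ge0.
  - by rewrite mulrDl mul1r mulrA lerD2l ler_pdivlMr // mul1r.
have step3 : cnt o h Q covered <=
   100 * (\sum_(m | visible m && (l m < t)) l m ^+ 2 + \sum_(j | e j < t) e j ^+ 2) / h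
     ^+ 2.
  pose C1 := [set y | exists2 m, visible m && (l m < t) & D m y].
  pose C2 := [set y | exists2 j, e j < t & nb (E j) (4 * e j) y].
  apply: le_trans (@cntU R o h Q C1 C2) _.
  have b1 : cnt o h Q C1 <= 100 * (\sum_(m | visible m && (l m < t)) l m ^+ 2) / h ^+ 2.
    apply: (@le_trans _ _ (\sum_(m | visible m && (l m < t)) cnt o h Q (D m))).
      exact: cnt_cover.
    rewrite mulrAC mulr_sumr; apply: ler_sum => m _.
    apply: le_trans (@cnt_le _ o h Q (D m) (1 * l m) h0 _ _) _.
    - by rewrite mul1r ltW.
    - by move=> u v Du Dv; rewrite mul1r; exact: body_diam (bD m) _ _ Du Dv.
    - apply: le_trans (sq4 _ _ (hl m) _) _ => //.
      rewrite mulrAC -mulrA ler_wpM2r //; last lra.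
      by rewrite divr_ge0 // sqr_ge0.
  have b2 : cnt o h Q C2 <= 100 * (\sum_(j | e j < t) e j ^+ 2) / h ^+ 2.
    apply: (@le_trans _ _ (\sum_(j | e j < t) cnt o h Q (nb (E j) (4 * e j)))).
      exact: cnt_cover.
    rewrite mulrAC mulr_sumr; apply: ler_sum => j _; have ej := e_gt0 j.
    apply: le_trans (@cnt_le _ o h Q _ (9 * e j) h0 _ _) _.
    - by rewrite mulr_ge0 // ltW.
    - move=> u v [u' Eu hu] [v' Ev hv]; have := E_diam Eu Ev.
      have := le_normB3 u u' v; have := le_normB3 u' v' v.
      by rewrite (distrC u u'); lra.
    - apply: le_trans (sq4 _ _ (he j) _) _ => //.
      rewrite mulrAC -mulrA ler_wpM2r //; last lra.
      by rewrite divr_ge0 // sqr_ge0.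
  by apply: le_trans (lerD b1 b2) _; rewrite -mulrDl -mulrDr lexx.
have hh : 0 < h ^+ 2 by rewrite exprn_gt0.
rewrite -(ler_pM2r (_ : 0 < (h ^+ 2)^-1)) ?invr_gt0 //.
have -> : #|good|%:R * (gap * t) ^+ 2 / h ^+ 2 = #|good|%:R * (gap * t / h) ^+ 2.
  by field; rewrite gt_eqF.
apply: le_trans step1 _; apply: le_trans step2 _.
apply: (@le_trans _ _ (N0 * 2 * (100 * (\sum_(m | visible m && (l m < t)) l m ^+ 2 +
  \sum_(j | e j < t) e j ^+ 2) / h ^+ 2))).
  by rewrite ler_wpM2l //; have := N0_ge1; lra.
by rewrite le_eqVlt; apply/orP; left; apply/eqP; field; rewrite gt_eqF.
Qed.

End candidates.

(** In [good_card] a good candidate weighs [t / (32 * N0)]. Multiplied by [t], this turns the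
    [200 * N0] of [good_card_le] into [200 / 32 < 7] over [gap ^+ 2]; [spacing^-1] is the
    coefficient of the cover sets of size at least [t]. *)
Definition scale_const : R := 7 / gap ^+ 2 + spacing^-1.

(* Boundary points of the large visible bodies are taken at abscissae spaced by
   spacing * t. Few of them come within closeness * t of another large body, or
   near a set E j of size between t and l i; the others have a free ball of
   radius gap * t nearby, and grid points in these balls are counted. *)
Lemma scale_ineq :
  \sum_(i | [&& visible i, 4 * t <= l i & l i <= M * t]) t * l i <=
  8^-1 * \sum_(i | [&& visible i, t <= l i & l i <= M * t]) t * l i +
  scale_const * (\sum_(i | visible i && (l i < t)) l i ^+ 2 +
    (\sum_(j | e j < t) e j ^+ 2 + \sum_(j | t <= e j <= M * t) t * e j)).
Proof.
have /choice[z hz] : forall i, exists z, D i z /\ forall y, `|y - z| < a * l i -> D i y.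
  by move=> i; have [z Dz hz] := body_ball (bD i); exists z.
pose B := (\max_i (Num.truncn (a * l i / (s * t))).+1)%N.
have hB i : a * l i <= s * t * B%:R.
  have := truncnS_gt (a * l i / (s * t)); rewrite ltr_pdivrMr // [_ * (s * t)]mulrC => h.
  apply: le_trans (ltW h) _; rewrite ler_pM2l // ler_nat.
  exact: (leq_bigmax (F := fun i => (Num.truncn (a * l i / (s * t))).+1)).
have /choice[pq hpq] : forall ik : I * 'I_B, exists pq : 'rV[R]_2 * 'rV[R]_2,
    s * t * ik.2%:R < a * l ik.1 ->
    [/\ closure (D ik.1) pq.1, ~ D ik.1 pq.1, cx pq.1 = cx (z ik.1) + s * t * ik.2%:R,
    `|pq.2 - pq.1| <= gap * t / a &
    forall y, `|y - pq.2| < gap * t -> ~ D ik.1 y].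
  move=> -[i k] /=; have [h|h] := boolP (s * t * k%:R < a * l i); last by exists (0, 0).
  have [Dz hz'] := hz i.
  (* The abscissa is less than [a * l i] to the right of the centre of the inscribed ball, so the
     vertical ray to the boundary starts inside the body. *)
  have [|p [p1 p2 p3]] := @body_boundary_above _ a (l i) (D i) (z i)
    (cx (z i) + s * t * k%:R) (bD i) hz'.
    by rewrite addrAC subrr add0r ger0_norm // mulr_ge0 // ltW.
  have gt0 : 0 < gap * t by rewrite mulr_gt0 // /gap divr_gt0 // mulr_gt0.
  have [q q1 q2] := body_exterior a0 (bD i) p1 p2 gt0.
  by exists (p, q).
pose p i k := (pq (i, k)).1; pose q i k := (pq (i, k)).2.
have p_cl i (k : 'I_B) : W i && (s * t * k%:R < a * l i) -> closure (D i) (p i k).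
  by case/andP => _ /(hpq (i, k))[].
have p_out i (k : 'I_B) : W i && (s * t * k%:R < a * l i) -> ~ D i (p i k).
  by case/andP => _ /(hpq (i, k))[].
have p_x i (k : 'I_B) : W i && (s * t * k%:R < a * l i) -> cx (p i k) = cx (z i) + s *
  t * k%:R.
  by case/andP => _ /(hpq (i, k))[].
have q_near i (k : 'I_B) : W i && (s * t * k%:R < a * l i) -> `|q i k - p i k| <= gap *
  t / a.
  by case/andP => _ /(hpq (i, k))[].
have q_out i (k : 'I_B) y : W i && (s * t * k%:R < a * l i) -> `|y - q i k| < gap * t
  -> ~ D i y.
  by case/andP => _ /(hpq (i, k))[_ _ _ _]; exact.
have h1 := good_card hB p_cl p_x.
have h2 := good_card_le p_cl p_x q_near q_out.
move: h1 h2; set g := (#|_|%:R : R) => h1 h2.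
have gg : 0 < gap by rewrite /gap divr_gt0 // mulr_gt0.
have N1 := N0_ge1; have Ngt0 : 0 < N0 by exact: lt_le_trans N1.
set X := \sum_(i | visible i && _) _ in h2 *; set Y := \sum_(j | e j < t) _ in h2 *.
have X0 : 0 <= X by apply: sumr_ge0 => i _; exact: sqr_ge0.
have Y0 : 0 <= Y by apply: sumr_ge0 => i _; exact: sqr_ge0.
rewrite -!mulr_sumr; set Z := \sum_(j | _ <= e j <= _) _ in h1 *.
have Z0 : 0 <= Z by apply: sumr_ge0 => i _; exact: ltW.
move: h1; set S := \sum_(i | _) _; set S' := \sum_(i | _) _ => h1.
have tt := t0.
have h3 : t * (t / (32 * N0) * g) <= 7 / gap ^+ 2 * (X + Y).
  have g2 : 0 < gap ^+ 2 by rewrite exprn_gt0.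
  rewrite -(ler_pM2r g2) -(ler_pM2l Ngt0).
  have -> : N0 * (t * (t / (32 * N0) * g) * gap ^+ 2) = g * (gap * t) ^+ 2 / 32.
    by field; rewrite gt_eqF.
  have -> : N0 * (7 / gap ^+ 2 * (X + Y) * gap ^+ 2) = 7 * N0 * (X + Y).
    by field; rewrite gt_eqF.
  have : 0 <= N0 * (X + Y) by rewrite mulr_ge0 ?addr_ge0 // ltW.
  by move: h2; lra.
have h4 : 0 <= 7 / gap ^+ 2 * (t * Z).
  by apply: mulr_ge0; [apply: divr_ge0 => //; exact: sqr_ge0|apply: mulr_ge0 => //;
    exact: ltW].
have h5 : 0 <= spacing^-1 * (X + Y) by rewrite mulr_ge0 ?addr_ge0 // invr_ge0 ltW.
have h6 : t * S <= t * (t / (32 * N0) * g) + 8^-1 * (t * S') + spacing^-1 * (t * Z).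
  rewrite (_ : _ + _ + _ = t * (t / (32 * N0) * g + 8^-1 * S' + s^-1 * Z));
    last by rewrite /s; ring.
  by rewrite ler_pM2l.
rewrite /scale_const (_ : (7 / gap ^+ 2 + spacing^-1) * (X + (Y + t * Z)) =
  7 / gap ^+ 2 * (X + Y) + 7 / gap ^+ 2 * (t * Z) + spacing^-1 * (X + Y) + spacing^-1 *
    (t * Z)); last by ring.
by lra.
Qed.

End one_scale.
End scale.

(** * Summation over dyadic scales *)

Section multiscale.
Context {R : realType}.
Variables (n : nat) (T : R).
Hypothesis n2 : (2 <= n)%N.
Hypothesis T0 : 0 < T.

Let tau (k : nat) : R := T / 2 ^+ k.
Let psi (x : R) : R := x `^ n%:R^-1.

Let tau_gt0 k : 0 < tau k. Proof. by rewrite divr_gt0 // exprn_gt0. Qed.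

Let tauD k m : tau k = 2 ^+ m * tau (k + m)%N.
Proof. by rewrite /tau exprD; field; rewrite !expf_neq0. Qed.

Let tauS k : tau k = 2 * tau k.+1.
Proof. by rewrite (tauD k 1) expr1 addn1. Qed.

Let n_inv : 0 < n%:R^-1 :> R.
Proof. by rewrite invr_gt0 ltr0n (leq_trans _ n2). Qed.

Let psi_gt0 x : 0 < x -> 0 < psi x. Proof. exact: powR_gt0. Qed.

Let psi_le x y : 0 < x -> x <= y -> psi x <= psi y.
Proof.
move=> x0 xy; apply: ge0_ler_powR ; rewrite ?nnegrE ?invr_ge0 ?ler0n //; lra.
Qed.

(** The exponent [1/n] is matched to windows of [n] dyadic scales: across a whole window [psi] loses
    only the factor 2. *)
Let psi_half x : 0 < x -> psi x = 2 * psi (x / 2 ^+ n).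
Proof.
move=> x0; have p0 : 0 < 2 ^+ n :> R by rewrite exprn_gt0.
have {1}-> : x = 2 ^+ n * (x / 2 ^+ n) by field; rewrite gt_eqF.
rewrite /psi powRM ?divr_ge0 ?(ltW x0) ?(ltW p0) // -powR_mulrn // -powRrM divff
  ?powRr1 //.
by rewrite pnatr_eq0 -lt0n (leq_trans _ n2).
Qed.

Let psi_double x : 0 < x -> psi (2 * x) <= 3 / 2 * psi x.
Proof.
move=> x0; rewrite /psi powRM //; last exact: ltW.
rewrite ler_pM2r ?powR_gt0 //.
have h : (3 / 2 : R) = ((3 / 2) ^+ n) `^ n%:R^-1.
  rewrite -powR_mulrn; last lra.
  by rewrite -powRrM divff ?powRr1 ?pnatr_eq0 -?lt0n ?(leq_trans _ n2) //; lra.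
rewrite h; apply: ge0_ler_powR; rewrite ?nnegrE ?(ltW n_inv) ?exprn_ge0 //; try lra.
apply: (@le_trans _ _ ((3 / 2) ^+ 2)); first by rewrite expr2; lra.
by rewrite ler_weXn2l //; lra.
Qed.

Let u k := psi (tau k) / tau k.

Let u_gt0 k : 0 < u k. Proof. by rewrite divr_gt0 // psi_gt0. Qed.

Let uS k : u k <= 3 / 4 * u k.+1.
Proof.
rewrite /u (tauS k) ler_pdivrMr; last by rewrite mulr_gt0.
apply: le_trans (psi_double (tau_gt0 _)) _; rewrite le_eqVlt; apply/orP; left.
by apply/eqP; field; rewrite gt_eqF.
Qed.

(** At least [n - 2] scales satisfy both conditions, and at each of them [psi (tau k) >= psi (x / 2
    ^+ n) = psi x / 2]. The bounds on [x] by [T] and [tau K] ensure that these scales occur among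
    the [k < K]. *)
Lemma sum_window_ge (K : nat) x : 0 < x -> x < 4 * T -> tau K <= x / 2 ^+ n ->
  (n%:R - 2) / 2 * psi x <=
  \sum_(k < K | (4 * tau k <= x) && (x <= 2 ^+ n * tau k)) psi (tau k).
Proof.
move=> x0 xT hK; have p0 m : 0 < 2 ^+ m :> R by rewrite exprn_gt0.
have ex : exists k, 4 * tau k <= x.
  exists (K + 2)%N; have := tauD K 2; rewrite expr2.
  have : x / 2 ^+ n <= x.
    by rewrite ler_pdivrMr // ler_peMr ?(ltW x0) // exprn_ege1 //; lra.
  by lra.
have [k0 hk0 mk0] := ex_minnP ex.
have k08 : x < 8 * tau k0.
  case: k0 hk0 mk0 => [|k0] hk0 mk0; first by move: hk0; rewrite /tau expr0; lra.
  by rewrite ltNge; apply/negP => h; have := mk0 k0; rewrite (tauS k0) ltnn; move=> H;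
    apply: (notF (H _)); lra.
have lo m : (m < n - 2)%N -> x < 2 ^+ n * tau (k0 + m)%N.
  move=> mn; apply: lt_le_trans k08 _; rewrite (tauD k0 m) mulrA ler_pM2r //.
  have -> : 8 * 2 ^+ m = 2 ^+ (3 + m) :> R by rewrite exprD; congr (_ * _); ring.
  rewrite ler_weXn2l //; first lra.
  by lia.
have ltK (m : 'I_(n - 2)) : (k0 + m < K)%N.
  rewrite ltnNge; apply/negP => h; have := lo m (ltn_ord m).
  have : tau (k0 + m)%N <= tau K.
    rewrite (tauD K (k0 + m - K)) subnKC // ler_peMl ?(ltW (tau_gt0 _)) //.
    by rewrite exprn_ege1 //; lra.
  move=> h1; have := le_trans h1 hK; rewrite ler_pdivlMr // mulrC.
  by lra.
pose f m : 'I_K := Ordinal (ltK m).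
have finj : injective f by move=> i j /(congr1 val) /= /addnI /val_inj.
apply: (@le_trans _ _ (\sum_(k in f @: [set: 'I_(n - 2)]%SET) psi (tau k))).
  rewrite big_imset /=; last by move=> i j _ _; exact: finj.
  apply: (@le_trans _ _ (\sum_(m in [set: 'I_(n - 2)]%SET) psi x / 2)).
    rewrite sumr_const cardsT card_ord -[_ *+ (n - 2)]mulr_natl natrB // le_eqVlt.
    by apply/orP; left; apply/eqP; ring.
  apply: ler_sum => m _; rewrite (psi_half x0) mulrC mulKf //.
  apply: psi_le; first by rewrite divr_gt0.
  by rewrite ler_pdivrMr // mulrC ltW // lo.
rewrite big_mkcond [leRHS]big_mkcond /=; apply: ler_sum => k _.
case: ifP => [/imsetP[m _ ->]|_] /=; last first.
  by case: ifP => // _; rewrite ltW // psi_gt0.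
rewrite ifT // (ltW (lo _ (ltn_ord m))) andbT; apply: le_trans hk0.
by rewrite (tauD k0 m) ler_pM2l // ler_peMl ?(ltW (tau_gt0 _)) // exprn_ege1 //; lra.
Qed.

(** At most [n + 1] dyadic scales fit between [x / 2 ^+ n] and [x], both ends included, and [psi] is
    at most [psi x] there. *)
Lemma sum_window_le (K : nat) x : 0 < x ->
  \sum_(k < K | (tau k <= x) && (x <= 2 ^+ n * tau k)) psi (tau k) <=
  (n%:R + 1) * psi x.
Proof.
move=> x0; pose P : pred 'I_K := fun k => (tau k <= x) && (x <= 2 ^+ n * tau k).
apply: (@le_trans _ _ (\sum_(k < K | P k) psi x)).
  by apply: ler_sum => k /andP[h _]; exact: psi_le.
rewrite sumr_const -[_ *+ #|_|]mulr_natl ler_wpM2r ?(ltW (psi_gt0 x0)) //.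
rewrite natr1 ler_nat; have [k1 Pk1|P0] := pickP P; last by rewrite (eq_card0 P0).
have [m Pm hm] : exists2 m : 'I_K, P m & forall i : 'I_K, P i -> (m <= i)%N.
  by case: (arg_minnP (fun i : 'I_K => val i) Pk1) => m Pm hm; exists m.
have -> : n.+1 = (m + n.+1 - m)%N by rewrite addKn.
apply: card_ord_itv => k Pk; rewrite hm //= ltnNge; apply/negP => h.
have /andP[mx _] := Pm; have /andP[_ kx] := Pk.
have e : (k = m + n.+1 + (k - (m + n.+1)) :> nat)%N by rewrite subnKC.
move: mx; rewrite (tauD m n.+1) (tauD (m + n.+1) (k - (m + n.+1))) -e exprS.
set w := 2 ^+ n in kx *; set r := 2 ^+ (k - _).
have r1 : 1 <= r by rewrite exprn_ege1 //; lra.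
have : 0 < w * tau k by rewrite mulr_gt0 // exprn_gt0.
by nra.
Qed.

(** The terms grow with [k] by a factor of at least 4/3, so the sum is at most 4 times the last
    term; that one has [x < tau k <= 2 * x] and is at most 3/2 of [psi x / x]. *)
Lemma sum_above_le (K : nat) x : 0 < x -> tau K <= x ->
  \sum_(k < K | x < tau k) psi (tau k) / tau k <= 6 * (psi x / x).
Proof.
move=> x0; have H k : x < tau k -> \sum_(i < k.+1 | x < tau i) u i <= 4 * u k.
  elim: k => [|k IH] xk.
    by rewrite big_mkcond big_ord_recr big_ord0 /= xk add0r; have := u_gt0 0; lra.
  rewrite big_mkcond big_ord_recr /= xk -big_mkcond /=.
  have xk' : x < tau k by rewrite (tauS k); have := tau_gt0 k.+1; lra.
  by have := IH xk'; have := uS k; lra.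
have psix : 0 < psi x / x by rewrite divr_gt0 // psi_gt0.
elim: K => [|K IH] hK; first by rewrite big_ord0 mulr_ge0 // ltW.
have [h|h] := ltP x (tau K).
  apply: le_trans (H _ h) _; have t2 : tau K <= 2 * x by rewrite (tauS K); lra.
  have : u K <= 3 / 2 * (psi x / x).
    rewrite /u ler_pdivrMr //; apply: (@le_trans _ _ (3 / 2 * psi x)).
      by apply: le_trans (psi_double x0); exact: psi_le.
    rewrite -!mulrA ler_pM2l; last lra.
    by rewrite ler_pM2l ?invr_gt0 // ler_peMr ?(ltW (psi_gt0 x0)) // mulrC ler_pdivlMr
      // mul1r ltW.
  by lra.
rewrite big_mkcond big_ord_recr /= ltNge h /= addr0 -big_mkcond.
exact: IH.
Qed.

End multiscale.

Lemma exchange_cond (R : realType) (I K : finType) (v : pred I)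
    (P : K -> pred I) (w : K -> R) (F : K -> I -> R) :
  \sum_k w k * (\sum_(i | v i && P k i) F k i) =
  \sum_(i | v i) \sum_(k | P k i) w k * F k i.
Proof.
under eq_bigr do rewrite big_mkcondr mulr_sumr.
rewrite exchange_big /=; apply: eq_bigr => i _; rewrite [RHS]big_mkcond.
by apply: eq_bigr => k _; case: ifP => //; rewrite mulr0.
Qed.

Lemma exchange_cond0 (R : realType) (I K : finType)
    (P : K -> pred I) (w : K -> R) (F : K -> I -> R) :
  \sum_k w k * (\sum_(i | P k i) F k i) =
  \sum_i \sum_(k | P k i) w k * F k i.
Proof. exact: (exchange_cond xpredT). Qed.

(** With weights [psi (tau k) / tau k] the one-scale inequalities add up to [(n - 2)/2 L <= (n +
    1)/8 L + 6 C L + C (n + 7) S], where [L] and [S] are the sums over bodies and over the cover.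
    The condition [16 C + 6 <= n] makes the terms in [L] combine to at least [L]. *)
Lemma multiscale (R : realType) (I J : finType) (v : pred I) (l : I -> R)
    (e : J -> R) (C : R) (n : nat) :
  0 <= C -> 16 * C + 6 <= n%:R ->
  (forall i, 0 < l i) -> (forall j, 0 < e j) ->
  (forall t, 0 < t ->
    \sum_(i | [&& v i, 4 * t <= l i & l i <= 2 ^+ n * t]) t * l i <=
    8^-1 * \sum_(i | [&& v i, t <= l i & l i <= 2 ^+ n * t]) t * l i +
    C * (\sum_(i | v i && (l i < t)) l i ^+ 2 +
      (\sum_(j | e j < t) e j ^+ 2 +
       \sum_(j | t <= e j <= 2 ^+ n * t) t * e j))) ->
  \sum_(i | v i) l i * l i `^ n%:R^-1 <=
  C * (n%:R + 7) * \sum_j e j * e j `^ n%:R^-1.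
Proof.
move=> C0 hn l0 e0 h.
have n2 : (2 <= n)%N by rewrite -(ler_nat R); lra.
have nn : 6 <= n%:R :> R by lra.
(* The first scale has to satisfy [l i < 4 * T] for [sum_window_ge]; the smallest size [m] below
   determines the number [K] of scales. *)
pose T := 1 + \sum_i l i.
have T0 : 0 < T by apply: ltr_wpDr => //; apply: sumr_ge0 => i _; exact: ltW.
have lT i : l i < 4 * T.
  have : l i <= \sum_i l i.
    by rewrite (bigD1 i) //= lerDl; apply: sumr_ge0 => ? _; exact: ltW.
  by rewrite /T; have := l0 i; lra.
pose m1 := \big[Num.min/(1 : R)]_i l i; pose m := \big[Num.min/m1]_j e j.
have m10 : 0 < m1 by rewrite /m1; elim/big_ind: _ => // x y hx hy; rewrite lt_min hx.
have m0 : 0 < m by rewrite /m; elim/big_ind: _ => // x y hx hy; rewrite lt_min hx.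
have ml i : m <= l i by apply: (@le_trans _ _ m1); [exact: bigmin_le_id|exact: bigmin_le].
have me j : m <= e j by exact: bigmin_le.
pose tau k := T / 2 ^+ k; pose psi (x : R) := x `^ n%:R^-1.
have p0 k : 0 < 2 ^+ k :> R by rewrite exprn_gt0.
have tau0 k : 0 < tau k by rewrite divr_gt0.
have [K hK] : exists K, tau K <= m / 2 ^+ n.
  pose K := (Num.truncn (T * 2 ^+ n / m)).+1; exists K.
  have h1 : T * 2 ^+ n / m < 2 ^+ K.
    have K2 : K%:R <= 2 ^+ K :> R by rewrite -natrX ler_nat ltnW // ltn_expl.
    exact: lt_le_trans (truncnS_gt _) K2.
  rewrite /tau ler_pdivrMr // mulrAC ler_pdivlMr //.
  by move: h1; rewrite ltr_pdivrMr // [_ * m]mulrC => /ltW.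
have hKl i : tau K <= l i / 2 ^+ n by apply: le_trans hK _; rewrite ler_pM2r ?invr_gt0.
have le1 (x : R) : 0 < x -> x / 2 ^+ n <= x.
  by move=> x0; rewrite ler_pdivrMr // ler_peMr ?(ltW x0) // exprn_ege1 //; lra.
have hKl' i : tau K <= l i by apply: le_trans (hKl i) (le1 _ _).
have hKe j : tau K <= e j.
  by apply: le_trans hK _; apply: le_trans (le1 _ m0) _; exact: me.
pose w (k : 'I_K) := psi (tau k) / tau k.
pose A1 := \sum_(i | v i) \sum_(k < K | (4 * tau k <= l i) && (l i <= 2 ^+ n * tau k))
  w k * (tau k * l i).
pose A2 := \sum_(i | v i) \sum_(k < K | (tau k <= l i) && (l i <= 2 ^+ n * tau k)) w k
  * (tau k * l i).
pose A3 := \sum_(i | v i) \sum_(k < K | l i < tau k) w k * l i ^+ 2.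
pose A4 := \sum_j \sum_(k < K | e j < tau k) w k * e j ^+ 2.
pose A5 := \sum_j \sum_(k < K | tau k <= e j <= 2 ^+ n * tau k) w k * (tau k * e j).
have H : A1 <= 8^-1 * A2 + C * (A3 + (A4 + A5)).
  have -> : A4 = \sum_k w k * \sum_(j | e j < tau k) e j ^+ 2.
    by rewrite exchange_cond0.
  have -> : A5 = \sum_k w k * \sum_(j | tau k <= e j <= 2 ^+ n * tau k) tau k * e j.
    by rewrite exchange_cond0.
  rewrite /A1 /A2 /A3 -!exchange_cond.
  rewrite -!big_split /= !mulr_sumr -big_split /=; apply: ler_sum => k _.
  have w0 : 0 <= w k by rewrite divr_ge0 ?powR_ge0 // ltW.
  apply: le_trans (ler_wpM2l w0 (h _ (tau0 k))) _.
  by rewrite le_eqVlt; apply/orP; left; apply/eqP; ring.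
have simp k (x : R) : w k * (tau k * x) = x * psi (tau k).
  by rewrite /w; field; rewrite gt_eqF.
set L := \sum_(i | v i) _; set S := \sum_j _.
have h1 : (n%:R - 2) / 2 * L <= A1.
  rewrite mulr_sumr; apply: ler_sum => i _.
  under eq_bigr do rewrite simp.
  rewrite -mulr_sumr mulrCA ler_pM2l //; exact: (sum_window_ge n2 T0).
have h2 : A2 <= (n%:R + 1) * L.
  rewrite mulr_sumr; apply: ler_sum => i _.
  under eq_bigr do rewrite simp.
  rewrite -mulr_sumr mulrCA ler_pM2l //; exact: sum_window_le.
have h5 : A5 <= (n%:R + 1) * S.
  rewrite mulr_sumr; apply: ler_sum => i _.
  under eq_bigr do rewrite simp.
  rewrite -mulr_sumr mulrCA ler_pM2l //; exact: sum_window_le.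
have sq (x : R) : 0 < x -> x ^+ 2 * (6 * (psi x / x)) = 6 * (x * psi x).
  by move=> x0; field; rewrite gt_eqF.
have h3 : A3 <= 6 * L.
  rewrite mulr_sumr; apply: ler_sum => i _; rewrite -mulr_suml mulrC -sq //.
  by rewrite ler_pM2l ?exprn_gt0 //; exact: sum_above_le.
have h4 : A4 <= 6 * S.
  rewrite mulr_sumr; apply: ler_sum => i _; rewrite -mulr_suml mulrC -sq //.
  by rewrite ler_pM2l ?exprn_gt0 //; exact: sum_above_le.
have L0 : 0 <= L by apply: sumr_ge0 => i _; rewrite mulr_ge0 ?powR_ge0 // ltW.
have S0 : 0 <= S by apply: sumr_ge0 => i _; rewrite mulr_ge0 ?powR_ge0 // ltW.
have c3 := ler_wpM2l C0 h3; have c4 := ler_wpM2l C0 h4; have c5 := ler_wpM2l C0 h5.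
have : (16 * C + 6) * L <= n%:R * L by rewrite ler_wpM2r.
rewrite !mulrDr in H; set N := n%:R in h1 h2 h5 c5 *.
move=> c6; have c7 : N * L / 2 - L <= A1 by apply: le_trans h1; rewrite le_eqVlt;
  apply/orP; left; apply/eqP; field.
have c8 : 8^-1 * A2 <= N * L / 8 + L / 8 by lra.
have -> : C * (N + 7) * S = C * (6 * S) + C * ((N + 1) * S) by ring.
have c9 : C * (6 * L) = 6 * (C * L) by ring.
have c10 : (16 * C + 6) * L = 16 * (C * L) + 6 * L by ring.
by rewrite c9 in c3; rewrite c10 in c6; lra.
Qed.

(** If [i0] is visible, its term is part of the left side of [multiscale]. If it is not, some cover
    set is at least as large as [D i0], and its term alone suffices. *)
Lemma content_lower (R : realType) (a : R) : 0 < a <= 1 ->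
  exists n : nat, (0 < n)%N /\ exists2 c : R, 0 < c &
  forall (I J : finType) (D : I -> set 'rV[R]_2) (l : I -> R)
    (E : J -> set 'rV[R]_2) (e : J -> R) (V : set 'rV[R]_2) (i0 : I),
  (forall i, body a (l i) (D i)) ->
  (forall i j, i != j -> D i `&` D j = set0) ->
  (forall j, 0 < e j) ->
  (forall j x y, E j x -> E j y -> `|x - y| <= e j) ->
  (forall y, V y -> (exists i, D i y) \/ (exists j, E j y)) ->
  (exists B, forall y, V y -> `|y| <= B) ->
  nb (D i0) (2 * l i0) `<=` V ->
  c * (l i0 * l i0 `^ n%:R^-1) <= \sum_j e j * e j `^ n%:R^-1.
Proof.
move=> a01; pose C := scale_const a; pose n := (Num.truncn (16 * `|C| + 6)).+1.
have hn : 16 * `|C| + 6 <= n%:R by exact/ltW/truncnS_gt.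
have C0 : 0 <= `|C| by exact: normr_ge0.
have n0 : 0 < n%:R :> R by rewrite ltr0n.
pose c := (`|C| * (n%:R + 7) + 1)^-1.
have cn0 : 0 <= `|C| * (n%:R + 7) by rewrite mulr_ge0 //; lra.
exists n; split => //; exists c; first by rewrite invr_gt0; lra.
move=> I J D l E e V i0 bD dis e0 Ed cov bnd nbV.
pose f (x : R) := x * x `^ n%:R^-1.
have f0 x : 0 < x -> 0 <= f x by move=> x0; rewrite mulr_ge0 ?powR_ge0 // ltW.
have S0 : 0 <= \sum_j f (e j) by apply: sumr_ge0 => j _; exact: f0.
have l0 i : 0 < l i by exact: body_gt0 (bD i).
suff H : f (l i0) <= (`|C| * (n%:R + 7) + 1) * \sum_j f (e j).
  by rewrite /c ler_pdivrMl //; lra.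
have [v0|nv] := boolP (visible D l E e V i0).
  have H : \sum_(i | visible D l E e V i) f (l i) <=
      `|C| * (n%:R + 7) * \sum_j f (e j).
    apply: multiscale => // t t0.
    apply: le_trans (scale_ineq a01 bD dis e0 Ed cov bnd (2 ^+ n) t0) _.
    rewrite lerD2l ler_wpM2r ?ler_norm // !addr_ge0 //; apply: sumr_ge0 => i _.
    - exact: sqr_ge0.
    - exact: sqr_ge0.
    - by rewrite mulr_ge0 // ltW.
  move: H; rewrite (bigD1 i0) //=; set X := \sum_(i | _) _ => H.
  have : 0 <= X by apply: sumr_ge0 => i _; exact: f0.
  by lra.
have [j lj] : exists j, l i0 <= e j.
  apply: contrapT => nex; move/negP: nv; apply; apply/asboolP; split => // j y lj.
  by exfalso; apply: nex; exists j.
have h1 : f (l i0) <= f (e j).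
  rewrite /f; apply: ler_pM; rewrite ?powR_ge0 ?(ltW (l0 _)) //.
  apply: ge0_ler_powR; rewrite ?nnegrE ?invr_ge0 ?(ltW n0) ?(ltW (l0 _)) ?(ltW (e0 _)) //.
have h2 : f (e j) <= \sum_j f (e j).
  by rewrite (bigD1 j) //= lerDl; apply: sumr_ge0 => i _; exact: f0.
have := mulr_ge0 cn0 S0; lra.
Qed.

(** * Calculus for plane curves *)

Definition dot (R : realType) (u v : 'rV[R]_2) : R := cx u * cx v + cy u * cy v.

Section calculus.
Context {R : realType}.
Implicit Types (f df : R -> R) (g : R -> 'rV[R]_2) (u v w p : 'rV[R]_2).

Lemma is_derive_coord g t (j : 'I_2) : derivable g t 1 ->
  is_derive t 1 (fun s => g s ord0 j) (g^`()%classic t ord0 j).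
Proof.
move=> dg; rewrite derive1E derive_mx // mxE; apply: derivableP.
by have /derivable_mxP := dg; apply.
Qed.

Lemma is_derive_dot0 g (dg : 'rV[R]_2) (t : R) v :
  (forall j, is_derive t (1 : R) (fun s => g s ord0 j) (dg ord0 j)) ->
  is_derive t (1 : R) (fun s => dot (g s) v) (dot dg v).
Proof.
move=> h; have dx := h ord0; have dy := h (lift ord0 ord0).
have -> : (fun s => dot (g s) v) =
    (cx v *: (fun s => g s ord0 ord0)) + (cy v *: (fun s => g s ord0 (lift ord0 ord0))).
  by apply/funext => s; rewrite /dot !fctE /cx /cy -![_ *: _]/(_ * _); ring.
apply: is_derive_eq; rewrite /dot /cx /cy.
by rewrite -![_ *: _]/(_ * _); ring.
Qed.

Lemma is_derive_dot g (dg : 'rV[R]_2) (t : R) p v :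
  (forall j, is_derive t (1 : R) (fun s => g s ord0 j) (dg ord0 j)) ->
  is_derive t (1 : R) (fun s => dot (g s - p) v) (dot dg v).
Proof.
move=> /(@is_derive_dot0 _ _ _ v) h.
have -> : (fun s => dot (g s - p) v) = (fun s => dot (g s) v) - cst (dot p v).
  by apply/funext => s; rewrite !fctE /dot !cE; ring.
by apply: is_derive_eq; rewrite subr0.
Qed.

Lemma continuous_dot g p v : continuous g -> continuous (fun s => dot (g s - p) v).
Proof.
move=> cg t; have cc j : {for t, continuous (fun s => g s ord0 j)}.
  by apply: (@continuous_comp _ _ _ g (fun z : 'rV[R]_2 => z ord0 j));
    [exact: cg|exact: coord_continuous].
have -> : (fun s => dot (g s - p) v) =
    (cx v *: (fun s => g s ord0 ord0)) + (cy v *: (fun s => g s ord0 (lift ord0 ord0))) +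
    cst (- dot p v).
  by apply/funext => s; rewrite /dot !cE !fctE /cst /= /cx /cy -![_ *: _]/(_ * _); ring.
apply: continuousD; last exact: cst_continuous.
by apply: continuousD; apply: continuousZr; exact: cc.
Qed.

Lemma continuous_dot0 g v : continuous g -> continuous (fun s => dot (g s) v).
Proof.
move=> /(@continuous_dot g 0 v).
by have -> : (fun s => dot (g s - 0) v) = (fun s => dot (g s) v)
  by apply/funext => s; rewrite subr0.
Qed.

Lemma continuous_affine (b c : R) : continuous (fun x : R => b + x * c).
Proof.
by move=> s; apply: cvgD; [exact: cvg_cst|apply: cvgM; [exact: cvg_id|exact: cvg_cst]].
Qed.

Lemma continuous_addZ g f w : continuous g -> continuous f ->
  continuous (fun x : R => g x + f x *: w).
Proof.
by move=> cg cf s; apply: cvgD; [exact: cg|apply: cvgZ; [exact: cf|exact: cvg_cst]].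
Qed.

Lemma continuous_path g f : continuous f -> continuous g ->
  continuous (fun x : R => g (f x)).
Proof. by move=> cf cg x; apply: (cvg_comp f g); [exact: cf|exact: cg]. Qed.

Lemma continuous_distp g p : continuous g -> continuous (fun s => `|g s - p|).
Proof.
move=> cg s; apply: (@continuous_comp _ _ _ (fun s => g s - p) (fun z : 'rV[R]_2 =>
  `|z|)).
  by apply: continuousB; [exact: cg|exact: cst_continuous].
exact: norm_continuous.
Qed.

Lemma continuousP_eps f t e : {for t, continuous f} -> 0 < e ->
  exists2 d, 0 < d & forall s, `|s - t| < d -> `|f s - f t| < e.
Proof.
move=> /cvgrPdist_lt h e0; have /nbhs_ballP[d /= d0 hd] := h _ e0.
exists d => // s st; rewrite distrC; apply: hd.
by rewrite /ball /= distrC.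
Qed.

Lemma derive_continuous f df : (forall t, is_derive t (1 : R) f (df t)) -> continuous f.
Proof.
move=> h t; apply/differentiable_continuous/derivable1_diffP.
by have [] := h t.
Qed.

Lemma max_derive f (t x : R) : (forall s, f s <= f t) ->
  (forall s, derivable f s 1) -> is_derive t (1 : R) f x -> x = 0.
Proof.
move=> fmax df h.
have tI : t \in `]t - 1, t + 1[%R by rewrite in_itv /=; apply/andP; split; lra.
have t11 : t - 1 <= t + 1 by lra.
have h0 := @derive1_at_max R f (t - 1) (t + 1) t t11 (fun s _ =>
  df s) tI (fun s _ => fmax s).
have e0 := @derive_val _ _ _ _ _ _ _ h0.
have e1 := @derive_val _ _ _ _ _ _ _ h.
by rewrite -e1.
Qed.

Lemma mean_value f df a b : (forall t, is_derive t (1 : R) f (df t)) -> a <= b ->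
  exists2 c, a <= c <= b & f b - f a = df c * (b - a).
Proof.
move=> h ab; have [|c cab e] := @MVT_segment R f df a b ab (fun x _ => h x).
  by apply: continuous_subspaceT; exact: derive_continuous h.
by exists c.
Qed.

Lemma intermediate_value f a b y : continuous f -> a <= b -> f a <= y <= f b ->
  exists2 c, a <= c <= b & f c = y.
Proof.
move=> cf ab /andP[h1 h2]; have [||c cab e] := @IVT R f a b y ab.
- exact: continuous_subspaceT.
- by rewrite ge_min h1 /= le_max h2 orbT.
- by exists c.
Qed.

Lemma no_zero_sign f a b : continuous f -> (forall t, a < t < b -> f t != 0) ->
  forall s t, a < s < b -> a < t < b -> 0 < f s -> 0 < f t.
Proof.
move=> cf nz s t sab tab fs; rewrite lt_neqAle eq_sym nz //= leNgt; apply/negP => ft.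
have [st|ts] := leP s t.
- have cnf : continuous (fun x => - f x) by move=> x; apply: continuousN; exact: cf.
  have [|c cst fc] := @intermediate_value _ s t 0 cnf st.
    by rewrite oppr_le0 oppr_ge0 !ltW.
  have : f c != 0 by apply: nz; lra.
  by move/eqP: fc; rewrite oppr_eq0 => /eqP ->; rewrite eqxx.
- have [|c cst fc] := @intermediate_value f t s 0 cf (ltW ts); first by rewrite !ltW.
  have : f c != 0 by apply: nz; lra.
  by rewrite fc eqxx.
Qed.

(* Two mean value steps: f'(s) has the sign of s - t since f'' >= c. *)
Lemma quadratic_lower f df ddf t d c :
  (forall s, is_derive s (1 : R) f (df s)) ->
  (forall s, is_derive s (1 : R) df (ddf s)) ->
  f t = 0 -> df t = 0 -> (forall s, `|s - t| < d -> 2 * c <= ddf s) ->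
  forall s, `|s - t| < d -> c * (s - t) ^+ 2 <= f s.
Proof.
move=> hf hdf ft dft hc s sd.
pose h x := f x - c * (x - t) ^+ 2.
have hh x : is_derive x (1 : R) h (df x - 2 * c * (x - t)).
  have -> : h = f - (c *: ((id - cst t) ^+ 2)).
    by apply/funext => y; rewrite /h /= !fctE.
  apply: is_derive_eq; rewrite /= !fctE expr1 subr0 -![_ *: _]/(_ * _).
  by rewrite -mulr_natl; ring.
have ht : h t = 0 by rewrite /h ft subrr expr0n /= mulr0 subrr.
suff : 0 <= h s by rewrite /h subr_ge0.
have hc' x y : `|x - t| < d -> (t <= y <= x) || (x <= y <= t) -> 2 * c <= ddf y.
  move=> xd xy; apply: hc; move: xd; rewrite !ltr_norml => /andP[h1 h2].
  by case/orP: xy => /andP[h3 h4]; lra.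
have key x : `|x - t| < d -> 0 <= (df x - 2 * c * (x - t)) * (x - t).
  move=> xd; have [tx|xt] := leP t x.
    have [y ty e] := mean_value hdf tx.
    have h1 : 2 * c <= ddf y by apply: hc' xd _; rewrite ty.
    move: e; rewrite dft subr0 => ->.
    rewrite (_ : _ * _ = (ddf y - 2 * c) * (x - t) ^+ 2); last by ring.
    by rewrite mulr_ge0 ?sqr_ge0 // subr_ge0.
  have [y ty e] := mean_value hdf (ltW xt).
  have h1 : 2 * c <= ddf y by apply: hc' xd _; rewrite ty orbT.
  move: e; rewrite dft sub0r => e; have -> : df x = ddf y * (x - t) by rewrite -[df
    x]opprK e; ring.
  rewrite (_ : _ * _ = (ddf y - 2 * c) * (x - t) ^+ 2); last by ring.
  by rewrite mulr_ge0 ?sqr_ge0 // subr_ge0.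
have between y : (t <= y <= s) || (s <= y <= t) -> `|y - t| < d.
  move=> xy; move: sd; rewrite !ltr_norml => /andP[h1 h2].
  by case/orP: xy => /andP[h3 h4]; lra.
have [ts|st] := leP t s.
  have [y ty e] := mean_value hh ts.
  have := key y (between y _); rewrite ty => /(_ isT) h1.
  move: e; rewrite ht subr0 => ->; have /andP[ty1 ty2] := ty.
  have [yt|yt] := leP (y - t) 0.
    have -> : y = t by lra.
    by rewrite dft subrr mulr0 subrr mul0r.
  by apply: mulr_ge0; [rewrite -(pmulr_lge0 _ yt)|lra].
have [y ty e] := mean_value hh (ltW st).
have := key y (between y _); rewrite ty orbT => /(_ isT) h1.
move: e; rewrite ht sub0r => e; have /andP[ty1 ty2] := ty.
have -> : h s = (df y - 2 * c * (y - t)) * (s - t) by rewrite -[h s]opprK e; ring.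
have [yt|yt] := leP 0 (y - t).
  have -> : y = t by lra.
  by rewrite dft subrr mulr0 subrr mul0r.
have h2 : df y - 2 * c * (y - t) <= 0 by rewrite -(nmulr_lge0 _ yt).
by apply: mulr_le0 => //; lra.
Qed.

Lemma dotDl u v w : dot (u + v) w = dot u w + dot v w.
Proof. by rewrite /dot !cE; ring. Qed.
Lemma dotZl c u v : dot (c *: u) v = c * dot u v.
Proof. by rewrite /dot !cE; ring. Qed.
Lemma dotC u v : dot u v = dot v u.
Proof. by rewrite /dot; ring. Qed.
Lemma dot_ge0 u : 0 <= dot u u.
Proof. by rewrite /dot addr_ge0 // -expr2 sqr_ge0. Qed.

Lemma dot_sqr_le u v : dot u v ^+ 2 <= dot u u * dot v v.
Proof.
rewrite -subr_ge0 (_ : _ - _ = (cx u * cy v - cy u * cx v) ^+ 2) ?sqr_ge0 //.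
by rewrite /dot; ring.
Qed.

Lemma dot_norm_le u v : `|dot u v| <= 2 * `|u| * `|v|.
Proof.
rewrite /dot; apply: le_trans (ler_normD _ _) _; rewrite !normrM.
have hx := normx_le u; have hy := normy_le u.
have hx' := normx_le v; have hy' := normy_le v.
have := ler_pM (normr_ge0 _) (normr_ge0 _) hx hx'.
have := ler_pM (normr_ge0 _) (normr_ge0 _) hy hy'.
by lra.
Qed.

Lemma dot_near p v z e : 0 < e -> exists2 d, 0 < d &
  forall w, `|w - z| < d -> `|dot (w - p) v - dot (z - p) v| < e.
Proof.
move=> e0; have v0 := normr_ge0 v; exists (e / (2 * `|v| + 1)).
  by apply: divr_gt0 => //; lra.
move=> w h; have -> : dot (w - p) v - dot (z - p) v = dot (w - z) v by rewrite /dot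
  !cE; ring.
apply: le_lt_trans (dot_norm_le _ _) _.
move: h; rewrite ltr_pdivlMr; last lra.
by have := normr_ge0 (w - z); lra.
Qed.

Lemma norm_sqr_le_dot u : `|u| ^+ 2 <= dot u u.
Proof.
have sq (x : R) : `|x| ^+ 2 = x ^+ 2 by rewrite -normrX ger0_norm ?sqr_ge0.
have -> : dot u u = cx u ^+ 2 + cy u ^+ 2 by rewrite /dot; ring.
have hx := sqr_ge0 (cx u); have hy := sqr_ge0 (cy u).
by rewrite norm_max; case: (leP `|cx u| `|cy u|) => _; rewrite sq; lra.
Qed.

Lemma dot_le_norm_sqr u : dot u u <= 2 * `|u| ^+ 2.
Proof.
by have := dot_norm_le u u; rewrite ger0_norm ?dot_ge0 // expr2 mulrA.
Qed.

Lemma dot_perp u v w : dot u v = 0 -> dot u u != 0 -> dot v v != 0 -> dot w u = 0 ->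
  w = (dot w v / dot v v) *: v.
Proof.
move=> uv u0 v0 wu.
have cr : cx w * cy v - cy w * cx v = 0.
  have : dot u u * (cx w * cy v - cy w * cx v) =
    dot w u * (cx u * cy v - cy u * cx v) + dot u v * (cx w * cy u - cy w * cx u).
    by rewrite /dot; ring.
  by rewrite uv wu !mul0r addr0 => /eqP; rewrite mulf_eq0 (negbTE u0) => /eqP.
have hx : cx w * dot v v = dot w v * cx v.
  apply/eqP; rewrite -subr_eq0 (_ : _ - _ = cy v * (cx w * cy v - cy w * cx v)).
    by rewrite cr mulr0.
  by rewrite /dot; ring.
have hy : cy w * dot v v = dot w v * cy v.
  apply/eqP; rewrite -subr_eq0 (_ : _ - _ = - cx v * (cx w * cy v - cy w * cx v)).
    by rewrite cr mulr0.
  by rewrite /dot; ring.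
apply: vecP; rewrite !cE mulrAC.
  by rewrite -hx mulfK.
by rewrite -hy mulfK.
Qed.

End calculus.

(* The curvature of g is |g2| / L^2: sc_curv says that it is at least k / L. *)
Record speed_curve (R : realType) (k L : R) (g g1 g2 : R -> 'rV[R]_2) : Prop :=
  SpeedCurve {
  sc_k : 0 < k;
  sc_L : 0 < L;
  sc_cont : continuous g;
  sc_d1 : forall (t : R) j,
    is_derive t (1 : R) (fun s => g s ord0 j) (g1 t ord0 j);
  sc_d2 : forall (t : R) j,
    is_derive t (1 : R) (fun s => g1 s ord0 j) (g2 t ord0 j);
  sc_cont2 : continuous g2;
  sc_speed : forall t, dot (g1 t) (g1 t) = L ^+ 2;
  sc_curv : forall t, (k * L) ^+ 2 <= dot (g2 t) (g2 t);
  sc_inj : forall s t, g s = g t <-> s - t \is a Num.int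
}.

(** * The curve in the frame of one of its points *)

Section curve.
Context {R : realType} (k L : R) (g g1 g2 : R -> 'rV[R]_2).
Hypothesis hg : speed_curve k L g g1 g2.

Let k0 : 0 < k. Proof. exact: sc_k hg. Qed.
Let L0 : 0 < L. Proof. exact: sc_L hg. Qed.
Let gc : continuous g. Proof. exact: sc_cont hg. Qed.
Let g2c : continuous g2. Proof. exact: sc_cont2 hg. Qed.
Let speedE t : dot (g1 t) (g1 t) = L ^+ 2. Proof. exact: sc_speed hg t. Qed.
Let curvE t : (k * L) ^+ 2 <= dot (g2 t) (g2 t). Proof. exact: sc_curv hg t. Qed.
Let ginj s t : g s = g t <-> s - t \is a Num.int. Proof. exact: sc_inj hg s t. Qed.

Let W t := dot (g2 t) (g2 t).

Let dg (t0 : R) p v : is_derive t0 (1 : R) (fun s => dot (g s - p) v) (dot (g1 t0) v).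
Proof. by apply: is_derive_dot; exact: sc_d1 hg t0. Qed.

Let dg1 (t0 : R) v : is_derive t0 (1 : R) (fun s => dot (g1 s) v) (dot (g2 t0) v).
Proof. by apply: is_derive_dot0; exact: sc_d2 hg t0. Qed.

Let W_gt0 t : 0 < W t.
Proof. by apply: lt_le_trans (curvE t); rewrite exprn_gt0 // mulr_gt0. Qed.

Let L2_gt0 : 0 < L ^+ 2. Proof. by rewrite exprn_gt0. Qed.

(** This is the derivative of the constant [dot (g1 t) (g1 t)]. Hence [g2] is a normal vector, and
    it never vanishes by [sc_curv]. *)
Lemma tangent_orth t : dot (g2 t) (g1 t) = 0.
Proof.
have dx := sc_d2 hg t ord0; have dy := sc_d2 hg t (lift ord0 ord0).
have h := is_deriveD (is_deriveM dx dx) (is_deriveM dy dy).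
have e : (fun s => g1 s ord0 ord0) * (fun s => g1 s ord0 ord0) +
  (fun s => g1 s ord0 (lift ord0 ord0)) * (fun s =>
    g1 s ord0 (lift ord0 ord0)) = cst (L ^+ 2).
  by apply/funext => s; rewrite !fctE -(speedE s).
rewrite e in h; have := @derive_val _ _ _ _ _ _ _ h; rewrite derive_cst => h2.
have : 2 * dot (g2 t) (g1 t) = 0.
  by rewrite h2 /dot /cx /cy -![_ *: _]/(_ * _); ring.
by move/eqP; rewrite mulf_eq0 pnatr_eq0 /= => /eqP.
Qed.

(** Within [d] of [t0] the frame [g1 t0], [g2 t0] still describes the curve: the diagonal products
    keep at least half, respectively three quarters, of their values at [t0], and the mixed
    products, zero at [t0], stay small. The bound [1 / 2] keeps the arc within one period. *)
Definition framed t0 d := 0 < d <= 1 / 2 /\ forall u, `|u - t0| < d ->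
  [/\ L ^+ 2 / 2 <= dot (g1 u) (g1 t0), `|dot (g1 u) (g2 t0)| <= W t0 / 4,
   3 / 4 * W t0 <= dot (g2 u) (g2 t0) & `|dot (g2 u) (g1 t0)| <= L ^+ 2 / 2].

Lemma framed_exists t0 : exists d, framed t0 d.
Proof.
have c1 v : continuous (fun s => dot (g1 s) v).
  exact: (derive_continuous (fun t => dg1 t v)).
have c2 v : continuous (fun s => dot (g2 s) v) by exact: continuous_dot0.
have Wt := W_gt0 t0; have LL := L2_gt0.
have e1 : 0 < L ^+ 2 / 2 by lra. have e2 : 0 < W t0 / 4 by lra.
have [d1 d10 h1] := continuousP_eps (c1 (g1 t0) t0) e1.
have [d2 d20 h2] := continuousP_eps (c1 (g2 t0) t0) e2.
have [d3 d30 h3] := continuousP_eps (c2 (g2 t0) t0) e2.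
have [d4 d40 h4] := continuousP_eps (c2 (g1 t0) t0) e1.
have o1 := tangent_orth t0; have o2 : dot (g1 t0) (g2 t0) = 0 by rewrite dotC.
exists (Num.min (1 / 2) (Num.min (Num.min d1 d2) (Num.min d3 d4))); split.
  by rewrite ge_min lexx /= !lt_min d10 d20 d30 d40 /= andbT; lra.
move=> u; rewrite !lt_min => /andP[_ /andP[/andP[u1 u2] /andP[u3 u4]]].
have a1 := h1 _ u1; have a2 := h2 _ u2; have a3 := h3 _ u3; have a4 := h4 _ u4.
rewrite speedE ltr_norml in a1; rewrite o2 subr0 in a2; rewrite o1 subr0 in a4.
rewrite -/(W t0) ltr_norml in a3.
move: a1 a3 => /andP[a1 _] /andP[a3 _].
by split; [lra|exact: ltW|lra|exact: ltW].
Qed.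

Section frame.
Variables (t0 d : R).
Hypothesis fr : framed t0 d.

Let d0 : 0 < d. Proof. by have [/andP[]] := fr. Qed.

Lemma dotBself u v : dot (g u - g u) v = 0.
Proof. by rewrite subrr /dot !cE !mul0r addr0. Qed.

Let between u v c : `|u - t0| < d -> `|v - t0| < d -> u <= c <= v -> `|c - t0| < d.
Proof.
by rewrite !ltr_norml => /andP[? ?] /andP[? ?] /andP[? ?]; apply/andP; split; lra.
Qed.

Lemma frame_tangent_ge u v : `|u - t0| < d -> `|v - t0| < d ->
  L ^+ 2 / 2 * `|v - u| <= `|dot (g v - g u) (g1 t0)|.
Proof.
wlog uv : u v / u <= v => [H hu hv|hu hv].
  have [h|h] := leP u v; first exact: H.
  rewrite distrC (_ : dot _ _ = - dot (g u - g v) (g1 t0)); last by rewrite /dot !cE;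
    ring.
  by rewrite normrN; apply: H => //; exact: ltW.
have [c cuv e] := mean_value (fun t => dg t (g u) (g1 t0)) uv.
have [h1 _ _ _] := fr.2 c (between hu hv cuv).
move: e; rewrite dotBself subr0 => ->.
rewrite normrM ler_wpM2r // ger0_norm //; have := L2_gt0; lra.
Qed.

Lemma frame_normal_le u v : `|u - t0| < d -> `|v - t0| < d ->
  `|dot (g v - g u) (g2 t0)| <= W t0 / 4 * `|v - u|.
Proof.
wlog uv : u v / u <= v => [H hu hv|hu hv].
  have [h|h] := leP u v; first exact: H.
  rewrite (distrC v) (_ : dot _ _ = - dot (g u - g v) (g2 t0));
    last by rewrite /dot !cE; ring.
  by rewrite normrN; apply: H => //; exact: ltW.
have [c cuv e] := mean_value (fun t => dg t (g u) (g2 t0)) uv.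
have [_ h1 _ _] := fr.2 c (between hu hv cuv).
by move: e; rewrite dotBself subr0 => ->; rewrite normrM ler_wpM2r.
Qed.

Lemma frame_tangent_le u v : u <= v -> `|dot (g v - g u) (g1 t0)| <= L ^+ 2 * `|v - u|.
Proof.
move=> uv; have [c cuv e] := mean_value (fun t => dg t (g u) (g1 t0)) uv.
move: e; rewrite dotBself subr0 => ->; rewrite normrM ler_wpM2r //.
rewrite -(@ler_pXn2r _ 2) ?nnegrE ?(ltW L2_gt0) //.
by rewrite -normrX ger0_norm ?sqr_ge0 //; apply: le_trans (dot_sqr_le _ _) _;
  rewrite !speedE -expr2.
Qed.

Lemma frame_quadratic u : `|u - t0| < d ->
  3 / 8 * W t0 * (u - t0) ^+ 2 <= dot (g u - g t0) (g2 t0).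
Proof.
move=> ud; apply: (@quadratic_lower _ (fun s => dot (g s - g t0) (g2 t0))
  (fun s => dot (g1 s) (g2 t0)) (fun s => dot (g2 s) (g2 t0)) t0 d _ _ _ _ _ _ u ud).
- by move=> s; exact: dg.
- by move=> s; exact: dg1.
- exact: dotBself.
- by rewrite dotC tangent_orth.
- by move=> s sd; have [_ _ h _] := fr.2 s sd; lra.
Qed.

(** The curve might return close to [g t0] at a remote parameter. Injectivity modulo integers and
    compactness of the rest [[t0 + d, t0 + 1 - d]] of the period keep it at a positive distance. *)
Lemma curve_far : exists2 r, 0 < r & forall u, `|g u - g t0| < r ->
  exists2 u', g u' = g u & `|u' - t0| < d.
Proof.
have [/andP[_ d1] _] := fr.
have le : t0 + d <= t0 + 1 - d by lra.
have cf := @continuous_distp _ _ (g t0) gc.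
have [c cI hc] := EVT_min le (continuous_subspaceT cf).
move: cI; rewrite in_itv /= => /andP[c1 c2].
have gp : 0 < `|g c - g t0|.
  rewrite normr_gt0 subr_eq0; apply/negP => /eqP /ginj /intrP[m hm].
  have : 0 < (m%:~R : R) < 1 by rewrite -hm; apply/andP; split; have := d0; lra.
  by rewrite ltr0z -[1]/(1%:~R) ltr_int; lia.
exists `|g c - g t0| => // u hu.
have shift (n : int) : g (u - n%:~R) = g u.
  by apply/ginj; rewrite addrAC subrr add0r rpredN intr_int.
pose n := Num.floor (u - t0 + d); have /andP[n1 n2] := floor_itv (u - t0 + d).
rewrite -/n intrD in n1 n2.
have far x : g x = g u -> t0 + d <= x <= t0 + 1 - d -> False.
  move=> gx hx; have := hc x; rewrite in_itv /= hx gx => /(_ isT).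
  by rewrite leNgt hu.
have n3 : u - n%:~R < t0 + 1 - d by move: n2; rewrite mulr1z; lra.
have [h|h] := ltP (u - n%:~R) (t0 + d).
  have [h'|h'] := ltP (t0 - d) (u - n%:~R).
    by exists (u - n%:~R) => //; rewrite ltr_norml; apply/andP; split; lra.
  exfalso; apply: (far (u - (n - 1)%:~R)) => //.
  by rewrite intrD rmorphN /= mulr1z; apply/andP; split; lra.
by exfalso; apply: (far (u - n%:~R)) => //; rewrite h ltW.
Qed.

(** The intermediate value theorem for the tangential coordinate gives [u] with [z - g u] orthogonal
    to [g1 t0], hence a multiple of [g2 t0]. With the direction fixed at [t0], the problem is
    one-dimensional. *)
Lemma frame_coords d' r : 0 < d' <= d -> 0 < r ->
  exists2 r1, 0 < r1 & forall z, `|z - g t0| < r1 ->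
  exists u v, [/\ `|u - t0| < d', `|v| < r & z = g u + v *: g2 t0].
Proof.
move=> /andP[d'0 d'd] r0.
pose A := `|g1 t0|; pose B := `|g2 t0|; have A0 : 0 <= A := normr_ge0 _.
have B0 : 0 <= B := normr_ge0 _.
have Wt := W_gt0 t0; have LL := L2_gt0.
pose ra := L ^+ 2 * d' / (8 * (A + 1)); pose M := 2 * B + W t0 * A / L ^+ 2 + 1.
have WAL : 0 <= W t0 * A / L ^+ 2 by rewrite divr_ge0 ?mulr_ge0 // ltW.
have M0 : 0 < M by rewrite /M; lra.
pose rb := r * W t0 / M.
have ra0 : 0 < ra by rewrite divr_gt0 ?mulr_gt0 //; lra.
have rb0 : 0 < rb by rewrite divr_gt0 ?mulr_gt0.
exists (Num.min ra rb); first by rewrite lt_min ra0.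
move=> z; rewrite lt_min => /andP[za zb].
set n := `|z - g t0| in za zb; have n0 : 0 <= n := normr_ge0 _.
have hz1 : `|dot (z - g t0) (g1 t0)| <= 2 * n * A by exact: dot_norm_le.
have hz2 : `|dot (z - g t0) (g2 t0)| <= 2 * n * B by exact: dot_norm_le.
have hna : n * A <= L ^+ 2 * d' / 8.
  have : n * (8 * (A + 1)) < L ^+ 2 * d' by rewrite -ltr_pdivlMr //; lra.
  by nra.
have hnM : n * M < r * W t0 by rewrite -ltr_pdivlMr.
have hd2 : `|d' / 2| < d by rewrite ger0_norm; lra.
have hp : `|t0 + d' / 2 - t0| < d by rewrite addrAC subrr add0r.
have hm : `|t0 - d' / 2 - t0| < d by rewrite addrAC subrr add0r normrN.
have ht : `|t0 - t0| < d by rewrite subrr normr0; exact: d0.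
pose f s := dot (g s - g t0) (g1 t0).
have cf : continuous f by apply: continuous_dot; exact: gc.
have le1 : t0 <= t0 + d' / 2 by lra.
have le2 : t0 - d' / 2 <= t0 by lra.
have fp : L ^+ 2 * d' / 4 <= f (t0 + d' / 2).
  have [c ct e] := mean_value (fun t => dg t (g t0) (g1 t0)) le1.
  have [h1 _ _ _] := fr.2 c (between ht hp ct).
  move: e; rewrite dotBself subr0 -/(f _) => ->.
  rewrite addrAC subrr add0r; nra.
have fm : f (t0 - d' / 2) <= - (L ^+ 2 * d' / 4).
  have [c ct e] := mean_value (fun t => dg t (g t0) (g1 t0)) le2.
  have [h1 _ _ _] := fr.2 c (between hm ht ct).
  move: e; rewrite dotBself sub0r -/(f _) => e.
  rewrite -[f _]opprK e lerN2 opprB addrC subrK; nra.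
have [||u /andP[u1 u2] fu] := @intermediate_value _ f (t0 - d' / 2) (t0 + d' / 2)
    (dot (z - g t0) (g1 t0)) cf; first lra.
  move: hz1; rewrite ler_norml => /andP[z1 z2]; apply/andP; split; lra.
have ud' : `|u - t0| < d' by rewrite ltr_norml; apply/andP; split; lra.
have ud : `|u - t0| < d by exact: lt_le_trans d'd.
have perp : dot (z - g u) (g1 t0) = 0.
  have -> : dot (z - g u) (g1 t0) = dot (z - g t0) (g1 t0) - f u.
    by rewrite /f /dot !cE; ring.
  by rewrite fu subrr.
have zE : z - g u = (dot (z - g u) (g2 t0) / W t0) *: g2 t0.
  apply: (@dot_perp _ (g1 t0)) => //.
  - by rewrite dotC tangent_orth.
  - by rewrite speedE gt_eqF.
  - by rewrite gt_eqF // W_gt0.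
exists u, (dot (z - g u) (g2 t0) / W t0); split => //; last by rewrite -zE addrC subrK.
rewrite normrM normfV (gtr0_norm Wt) ltr_pdivrMr //.
apply: le_lt_trans hnM.
have -> : dot (z - g u) (g2 t0) = dot (z - g t0) (g2 t0) - dot (g u - g t0) (g2 t0).
  by rewrite /dot !cE; ring.
apply: le_trans (ler_normB _ _) _.
have h1 := frame_normal_le ht ud; have h2 := frame_tangent_ge ht ud.
have h3 : L ^+ 2 / 2 * `|u - t0| <= 2 * n * A by apply: le_trans h2 _; rewrite -/(f u) fu.
have h4 : `|u - t0| <= 4 * n * A / L ^+ 2.
  by rewrite ler_pdivlMr // mulrC; lra.
have h5 : W t0 / 4 * `|u - t0| <= n * (W t0 * A / L ^+ 2).
  apply: (@le_trans _ _ (W t0 / 4 * (4 * n * A / L ^+ 2))).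
    by rewrite ler_pM2l //; lra.
  by rewrite le_eqVlt; apply/orP; left; apply/eqP; field; rewrite gt_eqF.
rewrite /M !mulrDr mulr1; have := n0; lra.
Qed.

(** By [curve_far], a curve point on such a segment has a parameter inside the frame. There the
    tangential coordinate is injective, and it is constant on the segment; so the point is the foot
    [g u], and [v = 0]. *)
Lemma curtain : exists d' r, [/\ 0 < d' <= d, 0 < r &
  forall u v, `|u - t0| < d' -> v != 0 -> `|v| < r -> forall s, g u + v *: g2 t0 <> g s].
Proof.
have [r0 r00 hr0] := curve_far.
have cf := @continuous_distp _ _ (g t0) gc t0.
have h2 : 0 < r0 / 2 by lra.
have [d1 d10 hd1] := continuousP_eps cf h2.
have B0 : 0 <= `|g2 t0| := normr_ge0 _.
exists (Num.min d d1), (r0 / (2 * (`|g2 t0| + 1))); split.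
- by rewrite lt_min d0 d10 ge_min lexx.
- by rewrite divr_gt0 // mulr_gt0 //; lra.
move=> u v; rewrite lt_min => /andP[ud ud1] v0 vr s e.
have vB : `|v| * `|g2 t0| < r0 / 2.
  move: vr; rewrite ltr_pdivlMr; last by rewrite mulr_gt0 //; lra.
  by have := normr_ge0 v; nra.
have [s' gs' s'd] : exists2 u', g u' = g s & `|u' - t0| < d.
  apply: hr0; rewrite -e addrAC; apply: le_lt_trans (ler_normD _ _) _.
  rewrite normrZ; have := hd1 _ ud1; rewrite subrr normr0 subr0 normr_id; lra.
have h3 := frame_tangent_ge ud s'd.
have : dot (g s' - g u) (g1 t0) = 0.
  by rewrite gs' -e addrAC subrr add0r dotZl tangent_orth mulr0.
move=> h4; rewrite h4 normr0 in h3.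
have : `|s' - u| <= 0 by have := L2_gt0; have := normr_ge0 (s' - u); nra.
rewrite normr_le0 subr_eq0 => /eqP su.
have : v *: g2 t0 = 0 by apply: (addrI (g u)); rewrite e -gs' su addr0.
move=> /(congr1 (fun z => dot z (g2 t0))); rewrite dotZl -/(W t0).
have -> : dot (0 : 'rV[R]_2) (g2 t0) = 0 by rewrite /dot !cE !mul0r addr0.
by move/eqP; rewrite mulf_eq0 (negbTE v0) gt_eqF // W_gt0.
Qed.

End frame.

End curve.

(** * The side of the curve on which the region lies *)

Lemma path_stays (R : realType) (D : set 'rV[R]_2) (f : R -> 'rV[R]_2) :
  continuous f -> open D ->
  (forall s, 0 <= s <= 1 -> closure D (f s) -> D (f s)) -> D (f 0) -> D (f 1).
Proof.
move=> cf oD nf D0; have : `[0, 1]%classic `&` f @^-1` D = `[0, 1]%classic.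
  apply: (@segment_connected R 0 1).
  - by exists 0; split => //=; rewrite in_itv /= lexx ler01.
  - by exists (f @^-1` D) => //; apply: open_comp => // x _; exact: cf.
  - exists (f @^-1` closure D).
      by apply: closed_comp => [x _|]; [exact: cf|exact: closed_closure].
    apply/seteqP; split => [s [sI Ds]|s [sI Ds]]; split => //.
      exact: subset_closure.
    by apply: nf Ds; move: sI => /=; rewrite in_itv.
move=> e; have : `[0, 1]%classic (1 : R) by rewrite /= in_itv /= lexx ler01.
by rewrite -e => -[].
Qed.

Record curve_region (R : realType) (g : R -> 'rV[R]_2) (D : set 'rV[R]_2) :
    Prop := CurveRegion {
  cr_open : open D;
  cr_conn : connected D;
  cr_nonempty : D !=set0;
  cr_bounded : exists B, forall z, D z -> `|z| <= B;
  cr_boundary : forall z, closure D z -> ~ D z -> exists t, z = g t;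
  cr_closure : forall t, closure D (g t);
  cr_out : forall t, ~ D (g t)
}.

Section region.
Context {R : realType} (k L : R) (g g1 g2 : R -> 'rV[R]_2) (D : set 'rV[R]_2).
Hypothesis hg : speed_curve k L g g1 g2.
Hypothesis hD : curve_region g D.

Let k0 : 0 < k. Proof. exact: sc_k hg. Qed.
Let L0 : 0 < L. Proof. exact: sc_L hg. Qed.
Let gc : continuous g. Proof. exact: sc_cont hg. Qed.
Let g2c : continuous g2. Proof. exact: sc_cont2 hg. Qed.
Let oD : open D. Proof. exact: cr_open hD. Qed.
Let bdD z : closure D z -> ~ D z -> exists t, z = g t.
Proof. exact: cr_boundary hD z. Qed.
Let W t := dot (g2 t) (g2 t).

Let W_gt0 t : 0 < W t.
Proof. by apply: lt_le_trans (sc_curv hg t); rewrite exprn_gt0 // mulr_gt0. Qed.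

Let L2_gt0 : 0 < L ^+ 2. Proof. by rewrite exprn_gt0. Qed.

Lemma path_inside (f : R -> 'rV[R]_2) : continuous f ->
  (forall s t, 0 <= s <= 1 -> f s <> g t) -> D (f 0) -> D (f 1).
Proof.
move=> cf nf D0; apply: (path_stays cf oD) D0 => s sI Ds.
by apply: contrapT => nDs; have [t e] := bdD Ds nDs; exact: (nf s t).
Qed.

(** The vector [g2 t] is expected to be the inward normal; this says that a short normal segment on
    the opposite side misses [D]. *)
Definition outer t := exists2 r, 0 < r & forall v, 0 < v < r -> ~ D (g t - v *: g2 t).

(* Near t0, the points g t - v g2(t) all lie in the curtain below the curve,
   which is connected and misses the curve. *)
Lemma outer_curtain t0 : exists d r e,
  [/\ framed L g1 g2 t0 d, 0 < r, 0 < e <= d &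
   forall t, `|t - t0| < e -> outer t <->
     (forall u v, `|u - t0| < d -> - r < v < 0 -> ~ D (g u + v *: g2 t0))].
Proof.
have [d1 fr1] := framed_exists hg t0.
have [d [r [/andP[d0 dd1] r0 hcur]]] := curtain hg fr1.
have fr : framed L g1 g2 t0 d.
  by case: fr1 => /andP[_ h1] h2; split; [rewrite d0; lra|move=> u ud; apply: h2;
    exact: lt_le_trans dd1].
have same u v u' v' : `|u - t0| < d -> - r < v < 0 -> `|u' - t0| < d -> - r < v' < 0 ->
    D (g u + v *: g2 t0) -> D (g u' + v' *: g2 t0).
  move=> hu /andP[v1 v2] hu' /andP[v1' v2'] Dv.
  pose f s := g (u + s * (u' - u)) + (v + s * (v' - v)) *: g2 t0.
  have -> : g u' + v' *: g2 t0 = f 1 by rewrite /f !mul1r !(addrC _ (_ - _)) !subrK.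
  apply: path_inside => [s|s t /andP[s0 s1]|]; last by rewrite /f !mul0r !addr0.
  - move: s; apply: continuous_addZ; last exact: continuous_affine.
    by apply: continuous_path; [exact: continuous_affine|exact: gc].
  - have hv : v + s * (v' - v) < 0 by nra.
    apply: hcur; last 1 first.
    + rewrite ltr0_norm //; have [vv|vv] := leP v v'.
        have : 0 <= s * (v' - v) by rewrite mulr_ge0 ?subr_ge0.
        lra.
      have : s * (v - v') <= v - v' by rewrite ler_piMl ?subr_ge0 // ltW.
      have -> : s * (v' - v) = - (s * (v - v')) by ring.
      lra.
    + move: hu hu'; rewrite !ltr_norml => /andP[a1 a2] /andP[b1 b2].
      have [uu|uu] := leP u u'.
        have : 0 <= s * (u' - u) <= u' - u by rewrite mulr_ge0 ?ler_piMl ?subr_ge0.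
        by move=> /andP[? ?]; apply/andP; split; lra.
      have : 0 <= s * (u - u') <= u - u' by rewrite mulr_ge0 ?ler_piMl ?subr_ge0 // ltW.
      have -> : s * (u' - u) = - (s * (u - u')) by ring.
      by move=> /andP[? ?]; apply/andP; split; lra.
    + by rewrite lt_eqF.
have d00 : 0 < d <= d by rewrite d0 lexx.
have [r1 r10 hr1] := frame_coords hg fr d00 r0.
have cf := @continuous_distp _ _ (g t0) gc t0.
have h2 : 0 < r1 / 2 by lra.
have [e1 e10 he1] := continuousP_eps cf h2.
exists d, r, (Num.min d e1); split => //; first by rewrite lt_min d0 e10 ge_min lexx.
move=> t; rewrite lt_min => /andP[td te].
have {}te : `|g t - g t0| < r1 / 2.
  by have := he1 _ te; rewrite subrr normr0 subr0 normr_id.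
have B0 : 0 <= `|g2 t| := normr_ge0 _.
pose rt := r1 / (2 * (`|g2 t| + 1)).
have rt0 : 0 < rt by rewrite divr_gt0 // mulr_gt0 //; lra.
(* Going from [g t] to the foot [g u] shifts the parameter by at most [v], which changes the normal
   coordinate by at most [W t0 / 4 * v]. The descent along [g2 t] is at least [3 / 4 * W t0 * v], so
   [v'] is negative. *)
have below v : 0 < v < rt -> exists u v', [/\ `|u - t0| < d, - r < v' < 0 &
    g t - v *: g2 t = g u + v' *: g2 t0].
  move=> /andP[v0 vrt].
  have : `|g t - v *: g2 t - g t0| < r1.
    rewrite addrAC; apply: le_lt_trans (ler_normB _ _) _; rewrite normrZ gtr0_norm //.
    have : v * (2 * (`|g2 t| + 1)) < r1 by rewrite -ltr_pdivlMr // mulr_gt0 //; lra.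
    by nra.
  move=> /hr1[u [v' [ud v'r e]]]; exists u, v'; split => //.
  have LL := L2_gt0; have Wt := W_gt0 t0.
  have [_ _ f3 f4] := fr.2 t td.
  have e1' : dot (g t - g u) (g1 t0) = v * dot (g2 t) (g1 t0).
    have : g t - g u = v *: g2 t + v' *: g2 t0.
      have -> : g t = g u + v' *: g2 t0 + v *: g2 t by rewrite -e subrK.
      by apply: vecP; rewrite !cE; ring.
    by move=> ->; rewrite dotDl !dotZl (tangent_orth hg) mulr0 addr0.
  have e2' : v' * W t0 = dot (g t - g u) (g2 t0) - v * dot (g2 t) (g2 t0).
    have : v' *: g2 t0 = (g t - g u) + (- v) *: g2 t.
      have -> : g t = g u + v' *: g2 t0 + v *: g2 t by rewrite -e subrK.
      by apply: vecP; rewrite !cE; ring.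
    by move=> /(congr1 (fun z => dot z (g2 t0))); rewrite dotDl !dotZl mulNr.
  have h3 := frame_tangent_ge hg fr ud td; have h4 := frame_normal_le hg fr ud td.
  rewrite -/(W t0) in h4.
  rewrite e1' normrM (gtr0_norm v0) in h3.
  have h5 : `|t - u| <= v.
    have : v * `|dot (g2 t) (g1 t0)| <= v * (L ^+ 2 / 2) by rewrite ler_pM2l.
    move=> h6; have := le_trans h3 h6; rewrite mulrC ler_pM2r //; lra.
  have : dot (g t - g u) (g2 t0) <= W t0 / 4 * v.
    apply: le_trans (ler_norm _) _; apply: le_trans h4 _; rewrite ler_pM2l //; lra.
  move: v'r; rewrite ltr_norml => /andP[-> _] h6 /=.
  have h7 : v * (3 / 4 * W t0) <= v * dot (g2 t) (g2 t0) by rewrite ler_pM2l.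
  have h8 : 0 < v * W t0 by exact: mulr_gt0.
  by rewrite -(pmulr_llt0 _ Wt) e2'; lra.
split=> [[r2 r20 hr2] u v hu hv Duv|hK].
  pose v0 := Num.min r2 rt / 2.
  have m0 : 0 < Num.min r2 rt by rewrite lt_min r20.
  have v00 : 0 < v0 by rewrite divr_gt0.
  have v01 : v0 < r2 /\ v0 < rt.
    have : Num.min r2 rt <= r2 by rewrite ge_min lexx.
    have : Num.min r2 rt <= rt by rewrite ge_min lexx orbT.
    by rewrite /v0; split; lra.
  apply: (hr2 v0); first by rewrite v00 v01.1.
  have [|u' [v' [hu' hv' ->]]] := below v0; first by rewrite v00 v01.2.
  exact: same Duv.
exists rt => // v /below[u [v' [hu hv ->]]]; exact: hK.
Qed.

(** At a point of the closure with the largest abscissa, the abscissa along the curve has zero first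
    derivative and nonpositive second derivative, so [g2] points towards smaller abscissae. A step
    against [g2] leaves the closure. *)
Lemma outer_somewhere : exists t, outer t.
Proof.
have [B hB] := cr_bounded hD; have [z0 Dz0] := cr_nonempty hD.
have cpt : compact (closure D).
  apply: bounded_closed_compact; last exact: closed_closure.
  exists (B + 1); split; first exact: num_real.
  move=> M hM z /closureP cz.
  have [|w Dw wz] := cz (M - B); first lra.
  have := hB _ Dw; have := ler_normB w (w - z); rewrite subKr /= => h1 h2; lra.
have cne : closure D !=set0 by exists z0; exact: subset_closure.
have ccx : {within closure D, continuous (@cx R)}.
  by apply: continuous_subspaceT => z; exact: coord_continuous.
have [p pcl hp] := EVT_max_rV cne cpt ccx; rewrite inE in pcl.
have {}hp z : closure D z -> cx z <= cx p by move=> h; apply: hp; rewrite inE.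
have nDp : ~ D p.
  move=> /(openP oD)[e e0 he]; have : D (p + vec (e / 2) 0).
    by apply: he; rewrite addrAC subrr add0r norm_lt !cE normr0 e0 gtr0_norm ?andbT; lra.
  by move=> /subset_closure/hp; rewrite !cE; lra.
have [t pE] := bdD pcl nDp; exists t.
pose f s := dot (g s) (vec 1 0).
have fE s : f s = cx (g s) by rewrite /f /dot !cE; ring.
have df s : is_derive s (1 : R) f (dot (g1 s) (vec 1 0)).
  by apply: is_derive_dot0; exact: sc_d1 hg s.
have ddf s : is_derive s (1 : R) (fun x => dot (g1 x) (vec 1 0)) (dot (g2 s) (vec 1 0)).
  by apply: is_derive_dot0; exact: sc_d2 hg s.
have fmax s : f s <= f t by rewrite !fE -pE; apply: hp; exact: cr_closure hD s.
have df0 : dot (g1 t) (vec 1 0) = 0.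
  by apply: (max_derive fmax _ (df t)) => s; have [] := df s.
have ddf0 : dot (g2 t) (vec 1 0) <= 0.
  rewrite leNgt; apply/negP => h.
  have c2 : continuous (fun s => dot (g2 s) (vec 1 0)) by exact: continuous_dot0.
  have h2 : 0 < dot (g2 t) (vec 1 0) / 2 by lra.
  have [d d0 hd] := continuousP_eps (c2 t) h2.
  have := @quadratic_lower _ (fun s => f s - f t) (fun s => dot (g1 s) (vec 1 0))
    (fun s => dot (g2 s) (vec 1 0)) t d (dot (g2 t) (vec 1 0) / 4) _ ddf _ df0.
  have h3 s : is_derive s (1 : R) (fun s => f s - f t) (dot (g1 s) (vec 1 0)).
    have -> : (fun s => f s - f t) = f - cst (f t) by apply/funext.
    by apply: is_derive_eq; rewrite subr0.
  rewrite subrr => /(_ h3 erefl) h4.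
  have := h4 _ (t + d / 2); rewrite addrAC subrr add0r gtr0_norm; last lra.
  move=> /(_ _ _) h5.
  have : dot (g2 t) (vec 1 0) / 4 * (d / 2) ^+ 2 <= f (t + d / 2) - f t.
    apply: h5; last lra.
    by move=> s /hd; rewrite ltr_norml => /andP[]; lra.
  have : 0 < dot (g2 t) (vec 1 0) / 4 * (d / 2) ^+ 2 by rewrite mulr_gt0 ?exprn_gt0 //;
    lra.
  by have := fmax (t + d / 2); lra.
have cx0' : cx (g1 t) = 0 by move: df0; rewrite /dot !cE; lra.
have cy0' : cy (g1 t) != 0.
  apply/eqP => h; have := sc_speed hg t; rewrite /dot cx0' h !mul0r addr0 => e.
  by have := L2_gt0; rewrite -e ltxx.
have cyg2 : cy (g2 t) = 0.
  have := tangent_orth hg t; rewrite /dot cx0' mulr0 add0r => /eqP.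
  by rewrite mulf_eq0 (negbTE cy0') orbF => /eqP.
have cxg2 : cx (g2 t) < 0.
  have h := W_gt0 t; rewrite /W /dot cyg2 mul0r addr0 in h.
  have : cx (g2 t) <= 0 by move: ddf0; rewrite /dot !cE; lra.
  rewrite le_eqVlt => /orP[/eqP h0|//].
  by move: h; rewrite h0 mul0r ltxx.
exists 1 => // v /andP[v0 _] /subset_closure/hp; rewrite -pE !cE; nra.
Qed.

(** The criterion in [outer_curtain] does not depend on [t], so [outer] is locally constant on the
    connected line. *)
Lemma outer_everywhere t : outer t.
Proof.
have cT : connected [set: R] by apply/connected_intervalP => x y _ _ z _.
have : [set t | outer t] = [set: R]; last by move=> e; have : [set: R] t by [];
  rewrite -e.
have op (A : set R) : (forall t0, exists2 e, 0 < e & forall t,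
  `|t - t0| < e -> A t <-> A t0) -> open A.
  move=> h; rewrite openE => t0 At0; have [e e0 he] := h t0.
  by apply/nbhs_ballP; exists e => //= s; rewrite /ball /= distrC => /he [_ h2];
    exact: h2 At0.
have loc t0 : exists2 e, 0 < e & forall t, `|t - t0| < e -> outer t <-> outer t0.
  have [d [r [e [_ _ /andP[e0 _] h]]]] := outer_curtain t0.
  exists e => // s hs; rewrite (h _ hs) (h t0) //.
  by rewrite subrr normr0.
apply: cT.
- exact: outer_somewhere.
- by exists [set t | outer t]; [exact: op|rewrite setTI].
- exists [set t | outer t]; last by rewrite setTI.
  rewrite -openC; apply: op => t0; have [e e0 he] := loc t0.
  by exists e => // s /he h; split => /= n /h.
Qed.

(** In frame coordinates [D] lies above the curve, and the curve above a parabola: its normal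
    coordinate is at least [3 / 8 * W t0 * (u - t0) ^+ 2], its tangential one at most
    [L ^+ 2 * |u - t0|] in absolute value. *)
Lemma local_support t0 : exists2 r, 0 < r & forall z, closure D z -> `|z - g t0| < r ->
  3 / 8 * W t0 / L ^+ 4 * dot (z - g t0) (g1 t0) ^+ 2 <= dot (z - g t0) (g2 t0).
Proof.
have [d [r [e [fr r0 /andP[e0 ed] h]]]] := outer_curtain t0.
have d00 : 0 < d <= d by rewrite lexx andbT (lt_le_trans e0).
have [r1 r10 hr1] := frame_coords hg fr d00 r0.
have LL := L2_gt0; have Wt := W_gt0 t0.
have hout := (h t0 _).1 (outer_everywhere t0).
have inD z : D z -> `|z - g t0| < r1 ->
    3 / 8 * W t0 / L ^+ 4 * dot (z - g t0) (g1 t0) ^+ 2 <= dot (z - g t0) (g2 t0).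
  move=> Dz /hr1[u [v [ud vr zE]]].
  have v0 : 0 < v.
    rewrite ltNge; apply/negP; rewrite le_eqVlt => /orP[/eqP v0|v0].
      by move: Dz; rewrite zE v0 scale0r addr0; exact: (cr_out hD).
    apply: (hout _ u v) => //; last by rewrite -zE.
      by rewrite subrr normr0.
    by move: vr; rewrite ltr_norml v0 andbT => /andP[].
  have zg : z - g t0 = (g u - g t0) + v *: g2 t0 by rewrite zE addrAC.
  rewrite zg !(dotDl (g u - g t0)) !dotZl (tangent_orth hg) mulr0 addr0 -/(W t0).
  have h1 := frame_quadratic hg fr ud; rewrite -/(W t0) in h1.
  have h2 : `|dot (g u - g t0) (g1 t0)| <= L ^+ 2 * `|u - t0|.
    have [tu|ut] := leP t0 u; first exact: (frame_tangent_le hg t0 tu).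
    rewrite (_ : dot _ _ = - dot (g t0 - g u) (g1 t0)); last by rewrite /dot !cE; ring.
    by rewrite normrN distrC; exact: (frame_tangent_le hg t0 (ltW ut)).
  have h3 : dot (g u - g t0) (g1 t0) ^+ 2 <= L ^+ 4 * (u - t0) ^+ 2.
    have -> : L ^+ 4 * (u - t0) ^+ 2 = (L ^+ 2 * `|u - t0|) ^+ 2.
      by rewrite exprMn -exprM -[`|_| ^+ 2]normrX ger0_norm ?sqr_ge0.
    rewrite -[leLHS]ger0_norm ?sqr_ge0 // normrX lerXn2r ?nnegrE //.
    by rewrite mulr_ge0 // ltW.
  have L4 : 0 < L ^+ 4 by rewrite exprn_gt0.
  have h4 : 3 / 8 * W t0 / L ^+ 4 * dot (g u - g t0) (g1 t0) ^+ 2 <= 3 / 8 * W t0 * (u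
    - t0) ^+ 2.
    rewrite mulrAC ler_pdivrMr //.
    rewrite (_ : _ * L ^+ 4 = 3 / 8 * W t0 * (L ^+ 4 * (u - t0) ^+ 2)); last by ring.
    by apply: ler_wpM2l => //; rewrite mulr_ge0 // ltW.
  have : 0 < v * W t0 by rewrite mulr_gt0.
  by lra.
(* Passage to the closure: a violation at [z] by the amount [gp] persists at points of [D] close
   enough to [z]. *)
exists r1 => // z cz zr; rewrite leNgt; apply/negP => hlt.
set c := 3 / 8 * W t0 / L ^+ 4 in inD hlt *.
have c0 : 0 < c by rewrite /c divr_gt0 ?exprn_gt0 // mulr_gt0.
set x := dot (z - g t0) (g1 t0) in hlt; set y := dot (z - g t0) (g2 t0) in hlt.
pose gp := c * x ^+ 2 - y; have gp0 : 0 < gp by rewrite subr_gt0.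
have x0 := normr_ge0 x.
pose e1 := gp / (2 * c * (2 * `|x| + 1)).
have x1 : 0 < 2 * `|x| + 1 by rewrite ltr_wpDl // mulr_ge0.
have xc0 : 0 < 2 * c * (2 * `|x| + 1) by rewrite mulr_gt0 // mulr_gt0.
have e10 : 0 < e1 by rewrite divr_gt0.
have gp2 : 0 < gp / 2 by lra.
have m0 : 0 < Num.min e1 (gp / 2) by rewrite lt_min e10.
have [d1 d10 hd1] := dot_near (g t0) (g1 t0) z m0.
have [d2 d20 hd2] := dot_near (g t0) (g2 t0) z gp2.
have /closureP/(_ (Num.min (Num.min d1 d2) (r1 - `|z - g t0|))) := cz.
rewrite !lt_min d10 d20 subr_gt0 zr => /(_ isT)[w Dw];
  rewrite !lt_min => /andP[/andP[wz1 wz2] wz3].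
have wr : `|w - g t0| < r1 by have := le_normB3 w z (g t0); lra.
have := inD _ Dw wr; have := hd1 _ wz1; have := hd2 _ wz2; rewrite -/x -/y.
set x' := dot (w - g t0) (g1 t0); set y' := dot (w - g t0) (g2 t0).
rewrite lt_min ltr_norml => /andP[y1 y2] /andP[hx1 hx2] hxy.
have : c * x ^+ 2 - c * x' ^+ 2 < gp / 2.
  have e1E : e1 * (2 * c * (2 * `|x| + 1)) = gp by rewrite /e1 divfK // gt_eqF.
  have xx : x ^+ 2 - x' ^+ 2 <= `|x' - x| * (2 * `|x|).
    rewrite (_ : x ^+ 2 - x' ^+ 2 = (x' - x) * (- (2 * x)) - (x' - x) ^+ 2); last by ring.
    apply: (@le_trans _ _ ((x' - x) * (- (2 * x)))); first by rewrite gerBl sqr_ge0.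
    by apply: le_trans (ler_norm _) _; rewrite normrM normrN normrM (ger0_norm (ler0n _
      2)).
  have h1 : `|x' - x| * (2 * `|x|) <= e1 * (2 * `|x|).
    by rewrite ler_wpM2r ?(ltW hx1) // mulr_ge0.
  have h2 : 0 < e1 * c by rewrite mulr_gt0.
  have h3 : c * (x ^+ 2 - x' ^+ 2) <= c * (e1 * (2 * `|x|)).
    by rewrite ler_pM2l //; exact: le_trans xx h1.
  move: h3; rewrite mulrBr => h3; apply: le_lt_trans h3 _.
  rewrite -e1E; lra.
by rewrite /gp in y2 *; lra.
Qed.

End region.

(** * Convexity and strict convexity of the region *)

Lemma tube (R : realType) (D : set 'rV[R]_2) (f : R -> 'rV[R]_2) :
  open D -> continuous f -> (forall s, 0 <= s <= 1 -> D (f s)) ->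
  exists2 e, 0 < e & forall s z, 0 <= s <= 1 -> `|z - f s| < e -> D z.
Proof.
move=> oD cf Df.
have /compact_near_coveringP cov := @segment_compact R 0 1.
have H : \forall e \near (0 : R)^'+, `[0, 1]%classic `<=` (fun s => forall z,
  `|z - f s| < e -> D z).
  apply: (cov R _ (fun e s => forall z, `|z - f s| < e -> D z)) => s /=.
  rewrite in_itv /= => sI; have [r r0 hr] := openP oD (Df _ sI).
  have r2 : 0 < r / 2 by lra.
  have := @continuous_distp _ _ (f s) cf s; move=> /(continuousP_eps)/(_ r2)[d d0 hd].
  exists (ball s d, [set e | e < r / 2]); first split => /=.
  - exact: nbhsx_ballx.
  - exact: nbhs_right_lt.
  move=> [s' e] /= [hs' he] z hz; apply: hr.
  have := hd s'; rewrite subrr normr0 subr0 normr_id distrC => /(_ hs').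
  by have := le_normB3 z (f s') (f s); lra.
have : \forall e \near (0 : R)^'+, 0 < e by exact: nbhs_right_gt.
move=> /(filterI H)/filter_ex[e [he e0]]; exists e => // s z sI; apply: he.
by rewrite /= in_itv.
Qed.

(** Here [u], [v] are tangential and [x], [y] normal coefficients of a parabola at a point where it
    touches the boundary. The term of order [d] takes both signs, hence [x = 0]; adding the
    inequalities at [d] and [- d] then isolates order [d ^+ 2]. *)
Lemma touch_second_order (R : realType) (c x y u v r : R) : 0 < c -> 0 < r ->
  (forall d, `|d| < r -> c * (d * u - d ^+ 2 * v) ^+ 2 <= d * x - d ^+ 2 * y) ->
  x = 0 /\ c * u ^+ 2 <= - y.
Proof.
move=> c0 r0 h.
have ge0 d : `|d| < r -> d ^+ 2 * y <= d * x.
  move=> /h; have : 0 <= c * (d * u - d ^+ 2 * v) ^+ 2 by rewrite mulr_ge0 ?sqr_ge0 //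
    ltW.
  by lra.
have y0 := normr_ge0 y; have yy := ler_norm (- y); rewrite normrN in yy.
have x_le : `|x| <= 0.
  rewrite leNgt; apply/negP => x0.
  pose e := Num.min (r / 2) (`|x| / (2 * (`|y| + 1))).
  have e0 : 0 < e by rewrite lt_min !divr_gt0 //; lra.
  have er : e <= r / 2 by rewrite ge_min lexx.
  have ex : e * (2 * (`|y| + 1)) <= `|x|.
    by rewrite -ler_pdivlMr; [rewrite ge_min lexx orbT|lra].
  have ey : - (e * y) < `|x| by have : e * (- y) <= e * `|y| by [rewrite ler_pM2l]; nra.
  have [xp|xn] := leP 0 x.
    have : (- e) ^+ 2 * y <= - e * x by apply: ge0; rewrite normrN gtr0_norm; lra.
    by rewrite sqrrN expr2 -mulrA mulNr -mulrN ler_pM2l // (ger0_norm xp) in ey *; lra.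
  have : e ^+ 2 * y <= e * x by apply: ge0; rewrite gtr0_norm; lra.
  by rewrite expr2 -mulrA ler_pM2l // (ltr0_norm xn) in ey *; lra.
have x0 : x = 0 by apply/eqP; rewrite -normr_le0.
split => //; pose d := r / 2; have d0 : 0 < d by rewrite /d; lra.
have h1 := h d; have h2 := h (- d).
rewrite normrN gtr0_norm // x0 !mulr0 !sub0r in h1 h2.
have dr : d < r by rewrite /d; lra.
have {}h1 := h1 dr; have {}h2 := h2 dr.
have d2 : 0 < 2 * d ^+ 2 by rewrite mulr_gt0 // exprn_gt0.
rewrite -(ler_pM2l d2).
have : 0 <= c * (d ^+ 2 * v) ^+ 2 by rewrite mulr_ge0 ?sqr_ge0 // ltW.
have e1 : c * (d * u - d ^+ 2 * v) ^+ 2 + c * (- d * u - (- d) ^+ 2 * v) ^+ 2 =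
  2 * d ^+ 2 * (c * u ^+ 2) + 2 * (c * (d ^+ 2 * v) ^+ 2) by ring.
by rewrite sqrrN in h2 e1; lra.
Qed.

Section region_body.
Context {R : realType} (k L : R) (g g1 g2 : R -> 'rV[R]_2) (D : set 'rV[R]_2).
Hypothesis hg : speed_curve k L g g1 g2.
Hypothesis hD : curve_region g D.

Let k0 : 0 < k. Proof. exact: sc_k hg. Qed.
Let L0 : 0 < L. Proof. exact: sc_L hg. Qed.
Let oD : open D. Proof. exact: cr_open hD. Qed.
Let bdD z : closure D z -> ~ D z -> exists t, z = g t.
Proof. exact: cr_boundary hD z. Qed.
Let W t := dot (g2 t) (g2 t).

Let W_gt0 t : 0 < W t.
Proof. by apply: lt_le_trans (sc_curv hg t); rewrite exprn_gt0 // mulr_gt0. Qed.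

Let c t := 3 / 8 * W t / L ^+ 4.
Let c_gt0 t : 0 < c t.
Proof. by rewrite /c divr_gt0 ?exprn_gt0 // mulr_gt0 // W_gt0. Qed.

Let L2 t : dot (g1 t) (g1 t) != 0.
Proof. by rewrite (sc_speed hg) gt_eqF // exprn_gt0. Qed.

Let orth t : dot (g1 t) (g2 t) = 0. Proof. by rewrite dotC (tangent_orth hg). Qed.

(** At a boundary point inside the segment [local_support] applies in both directions. The normal
    term is odd and the tangential square even, so both components of [y - x] would vanish. *)
Lemma no_flat_segment x y s : (forall t, 0 <= t <= 1 -> closure D (x + t *: (y - x))) ->
  x != y -> 0 < s < 1 -> D (x + s *: (y - x)).
Proof.
move=> hcl xy /andP[s0 s1]; apply: contrapT => nD.
have [|t0 zE] := bdD (hcl s _) nD; first by rewrite !ltW.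
have [r r0 hr] := local_support hg hD t0.
set v := y - x in hcl zE nD *; have v0 : 0 < `|v| by rewrite normr_gt0 subr_eq0 eq_sym.
pose h := Num.min (Num.min s (1 - s)) (r / `|v|) / 2.
have m0 : 0 < Num.min (Num.min s (1 - s)) (r / `|v|).
  by rewrite !lt_min s0 subr_gt0 s1 divr_gt0.
have h0 : 0 < h by rewrite divr_gt0.
have hs : h < s /\ h < 1 - s.
  have : Num.min (Num.min s (1 - s)) (r / `|v|) <= s by rewrite !ge_min lexx.
  have : Num.min (Num.min s (1 - s)) (r / `|v|) <= 1 - s by rewrite !ge_min lexx orbT.
  by rewrite /h; split; lra.
have hv : h * `|v| < r.
  rewrite -ltr_pdivlMr //; have : Num.min (Num.min s (1 - s)) (r / `|v|) <= r / `|v|.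
    by rewrite ge_min lexx orbT.
  by rewrite /h; lra.
have key d : `|d| = h -> 
    c t0 * (d * dot v (g1 t0)) ^+ 2 <= d * dot v (g2 t0).
  move=> dh; have hd : x + (s + d) *: v - g t0 = d *: v.
    by rewrite -zE; apply: vecP; rewrite !cE; ring.
  have := hr (x + (s + d) *: v); rewrite hd !dotZl normrZ dh; apply => //.
  apply: hcl; have : - h <= d <= h by rewrite -ler_norml dh.
  by move=> /andP[? ?]; apply/andP; split; lra.
have k1 := key h (gtr0_norm h0).
have k2 := key (- h); rewrite normrN (gtr0_norm h0) in k2; have {}k2 := k2 erefl.
have cc := c_gt0 t0.
have sq0 : (h * dot v (g1 t0)) ^+ 2 <= 0.
  rewrite -(pmulr_rle0 _ cc); rewrite mulNr sqrrN in k2; lra.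
have e1 : dot v (g1 t0) = 0.
  have : (h * dot v (g1 t0)) ^+ 2 == 0 by rewrite eq_le sq0 sqr_ge0.
  by rewrite expf_eq0 /= mulf_eq0 gt_eqF //= => /eqP.
have e2 : dot v (g2 t0) = 0.
  rewrite e1 !mulr0 expr0n /= mulr0 in k1 k2.
  apply/eqP; rewrite eq_le -(pmulr_rle0 _ h0) -(pmulr_rge0 _ h0) k1 andbT.
  by rewrite mulNr in k2; lra.
have := dot_perp (orth t0) (L2 t0) (negbT (gt_eqF (W_gt0 t0))) e1.
rewrite e2 mul0r scale0r => ve; by move: v0; rewrite ve normr0 ltxx.
Qed.

(** The points whose segment from [x] stays in [D] form an open set by [tube] and a relatively
    closed one by [no_flat_segment]; connectedness of [D] concludes. *)
Lemma region_convex : convexs D.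
Proof.
move=> x; suff H y : D x -> D y -> forall s, 0 <= s <= 1 -> D (x + s *: (y - x)).
  by move=> y s Dx Dy; exact: H.
move=> Dx; pose S := [set y | forall s, 0 <= s <= 1 -> D (x + s *: (y - x))].
have SD : S `<=` D.
  by move=> z /(_ 1); rewrite ler01 lexx scale1r addrC subrK; apply.
have : D `&` S = D.
  apply: (cr_conn hD).
  - by exists x; split => // s _; rewrite subrr scaler0 addr0.
  - exists S => //; apply: openPn => z Sz.
    have cf : continuous (fun s : R => x + s *: (z - x)).
      apply: (@continuous_addZ _ (fun=> x) id); first by move=> ?; exact: cst_continuous.
      by move=> ?; exact: cvg_id.
    have [e e0 he] := tube oD cf Sz; exists e => // w wz s sI; apply: (he s) => //.
    rewrite (_ : _ - _ = s *: (w - z)); last by apply: vecP; rewrite !cE; ring.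
    have /andP[s0 s1] := sI; rewrite normrZ (ger0_norm s0).
    by apply: le_lt_trans wz; rewrite ler_piMl.
  - exists (closure S); first exact: closed_closure.
    apply/seteqP; split=> z [Dz Sz]; split => //; first exact: subset_closure.
    have cl s : 0 <= s <= 1 -> closure D (x + s *: (z - x)).
      move=> sI; apply/closureP => e e0; have /closureP/(_ e e0)[w Sw wz] := Sz.
      exists (x + s *: (w - x)); first exact: Sw.
      rewrite (_ : _ - _ = s *: (w - z)); last by apply: vecP; rewrite !cE; ring.
      have /andP[s0 s1] := sI; rewrite normrZ (ger0_norm s0).
      by apply: le_lt_trans wz; rewrite ler_piMl.
    move=> s sI; have [xz|xz] := eqVneq x z.
      by rewrite -xz subrr scaler0 addr0.
    have [->|sn0] := eqVneq s 0; first by rewrite scale0r addr0.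
    have [->|sn1] := eqVneq s 1; first by rewrite scale1r addrC subrK.
    apply: no_flat_segment => //; have /andP[s0 s1] := sI.
    by rewrite !lt_neqAle s0 s1 sn1 eq_sym sn0.
move=> e Dy; have : (D `&` S) y by rewrite e.
by case.
Qed.

Lemma closure_region_convex x y s : closure D x -> closure D y -> 0 <= s <= 1 ->
  closure D (x + s *: (y - x)).
Proof.
move=> /closureP cx /closureP cy sI; apply/closureP => e e0.
have [u Du ux] := cx _ e0; have [v Dv vy] := cy _ e0.
exists (u + s *: (v - u)); first exact: region_convex.
rewrite (_ : _ - _ = (1 - s) *: (u - x) + s *: (v - y)); last by apply: vecP;
  rewrite !cE; ring.
have /andP[s0 s1] := sI; apply: le_lt_trans (ler_normD _ _) _; rewrite !normrZ.
rewrite (ger0_norm s0) ger0_norm ?subr_ge0 //.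
have [h|h] := leP `|u - x| `|v - y|.
  apply: le_lt_trans vy; have : (1 - s) * `|u - x| <= (1 - s) * `|v - y|.
    by rewrite ler_wpM2l // subr_ge0.
  by lra.
apply: le_lt_trans ux; have : s * `|v - y| <= s * `|u - x| by rewrite ler_wpM2l // ltW.
by lra.
Qed.

(** Convexity allows [z] to be moved towards [g t] until it is within range of [local_support], and
    this scaling preserves the sign. *)
Lemma global_support z t : closure D z -> 0 <= dot (z - g t) (g2 t).
Proof.
move=> cz; have [r r0 hr] := local_support hg hD t.
have n0 := normr_ge0 (z - g t).
pose e := Num.min 1 (r / (2 * (`|z - g t| + 1))).
have e0 : 0 < e by rewrite lt_min ltr01 divr_gt0 // mulr_gt0 //; lra.
have e1 : e <= 1 by rewrite ge_min lexx.
have en : e * `|z - g t| < r.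
  have : e * (2 * (`|z - g t| + 1)) <= r.
    by rewrite -ler_pdivlMr; [rewrite ge_min lexx orbT|lra].
  by nra.
have pE : g t + e *: (z - g t) - g t = e *: (z - g t) by rewrite addrAC subrr add0r.
have := hr (g t + e *: (z - g t)); rewrite pE normrZ gtr0_norm // !dotZl => h.
rewrite -(pmulr_rge0 _ e0); apply: le_trans (h _ en).
  by rewrite mulr_ge0 ?sqr_ge0 // ltW // c_gt0.
apply: closure_region_convex => //; last by rewrite (ltW e0).
exact: (cr_closure hD).
Qed.

(** Parabolic arcs from [x] to [y] deform the segment into an arc through the desired point. If they
    ever left [D], some arc inside the closure would touch the boundary; there it is tangent to the
    curve, and [touch_second_order] demands more bending than [w] provides. *)
Lemma region_mid x y w : D x -> D y ->
  `|w| < k / 64 * `|x - y| ^+ 2 / L -> `|w| <= `|x - y| / 8 ->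
  D (2^-1 *: (x + y) + w).
Proof.
move=> Dx Dy hw1 hw2.
(* The factor 4 makes the point at [s = 1 / 2] the midpoint plus [l *: w]. *)
pose q (l s : R) := x + s *: (y - x) + (4 * l * (s * (1 - s))) *: w.
have s1s (s : R) : 0 <= s <= 1 -> 0 <= s * (1 - s) <= 1.
  by move=> /andP[s0 s1]; apply/andP; split; nra.
pose S := [set l | forall s, 0 <= s <= 1 -> D (q l s)].
have cq l : continuous (q l).
  apply: continuous_addZ.
    apply: (@continuous_addZ _ (fun=> x) id); first by move=> ?; exact: cst_continuous.
    by move=> ?; exact: cvg_id.
  move=> s; apply: cvgM; first exact: cvg_cst.
  apply: cvgM; first exact: cvg_id.
  by apply: cvgB; [exact: cvg_cst|exact: cvg_id].
have qd l l' s : q l s - q l' s = (4 * (l - l') * (s * (1 - s))) *: w.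
  by apply: vecP; rewrite /q !cE; ring.
have qn l l' s : 0 <= s <= 1 -> `|q l s - q l' s| <= `|l - l'| * (4 * `|w|).
  move=> /s1s/andP[h0 h1]; rewrite qd normrZ (normrM (4 * (l - l'))) (ger0_norm h0)
    normrM (ger0_norm (ler0n _ 4)).
  rewrite [leRHS](_ : _ = 4 * `|l - l'| * 1 * `|w|); last by ring.
  by apply: ler_wpM2r => //; apply: ler_wpM2l => //; rewrite mulr_ge0.
have w0 := normr_ge0 w.
suff : `[0, 1]%classic `&` S = `[0, 1]%classic.
  move=> e; have : (`[0, 1]%classic `&` S) 1 by rewrite e /= in_itv /= ler01 lexx.
  move=> [_ /(_ (1 / 2))]; rewrite /q => h.
  rewrite (_ : _ + w = x + (1 / 2) *: (y - x) + (4 * 1 * (1 / 2 * (1 - 1 / 2))) *: w).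
    by apply: h; lra.
  by apply: vecP; rewrite !cE; field.
apply: (@segment_connected R 0 1).
- exists 0; split; first by rewrite /= in_itv /= lexx ler01.
  move=> s sI; rewrite /q mulr0 mul0r scale0r addr0; exact: region_convex.
- exists S => //; rewrite openE => l Sl.
  have [e e0 he] := tube oD (cq l) Sl.
  apply/nbhs_ballP; exists (e / (4 * `|w| + 1)) => /=; first by rewrite divr_gt0 //; lra.
  move=> l'; rewrite /ball /= distrC ltr_pdivlMr; last lra.
  move=> hl s sI; apply: (he s) => //; apply: le_lt_trans (qn _ _ _ sI) _.
  by have := normr_ge0 (l' - l); lra.
- exists (closure S); first exact: closed_closure.
  apply/seteqP; split=> l [lI Sl]; split => //; first exact: subset_closure.
  have cl s : 0 <= s <= 1 -> closure D (q l s).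
    move=> sI; apply/closureP => e e0.
    have := Sl (ball l (e / (4 * `|w| + 1))).
    case=> [|l' [Sl' hl']]; first by apply: nbhsx_ballx; rewrite divr_gt0 //; lra.
    exists (q l' s); first exact: Sl'.
    apply: le_lt_trans (qn _ _ _ sI) _.
    move: hl'; rewrite /ball /= distrC ltr_pdivlMr; last lra.
    by have := normr_ge0 (l' - l); lra.
  move=> s sI; apply: contrapT => nD; have [t0 zE] := bdD (cl s sI) nD.
  have /andP[l0 l1] : 0 <= l <= 1 by move: lI; rewrite /= in_itv.
  have sn0 : s != 0.
    by apply/eqP => s0; apply: nD; rewrite s0 /q mul0r mulr0 !scale0r !addr0.
  have sn1 : s != 1.
    by apply/eqP => s1; apply: nD; rewrite s1 /q subrr !mulr0 scale0r scale1r addr0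
      addrC subrK.
  have /andP[s0 s1] : 0 < s < 1.
    by have /andP[a b] := sI; rewrite !lt_neqAle a b sn1 eq_sym sn0.
  have [r r0 hr] := local_support hg hD t0.
  pose e := (y - x) + (4 * l * (1 - 2 * s)) *: w.
  have qe d : q l (s + d) - g t0 = d *: e - (d ^+ 2) *: ((4 * l) *: w).
    by rewrite -zE /q /e; apply: vecP; rewrite !cE; ring.
  have [d1 d10 hd1] : exists2 d1, 0 < d1 & forall d,
    `|d| < d1 -> `|q l (s + d) - g t0| < r.
    have [d1 d10 hd1] := continuousP_eps (@continuous_distp _ _ (g t0) (cq l) s) r0.
    exists d1 => // d hd; have := hd1 (s + d); rewrite addrAC subrr add0r => /(_ hd).
    by rewrite zE subrr normr0 subr0 normr_id.
  have m0 : 0 < Num.min d1 (Num.min s (1 - s)) by rewrite !lt_min d10 s0 subr_gt0 s1.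
  have H d : `|d| < Num.min d1 (Num.min s (1 - s)) ->
      c t0 * (d * dot e (g1 t0) - d ^+ 2 * dot ((4 * l) *: w) (g1 t0)) ^+ 2 <=
      d * dot e (g2 t0) - d ^+ 2 * dot ((4 * l) *: w) (g2 t0).
    rewrite !lt_min => /andP[hd /andP[hds hds']].
    have := hr (q l (s + d)) _ (hd1 _ hd).
    rewrite qe -scaleNr !(dotDl (d *: e)) !(dotZl d e) !(dotZl (- d ^+ 2)) !mulNr;
      apply; apply: cl.
    by move: hds hds'; rewrite !ltr_norml => /andP[? ?] /andP[? ?]; apply/andP; split;
      lra.
  have [a0 hc] := touch_second_order (c_gt0 t0) m0 H.
  have eE : e = (dot e (g1 t0) / dot (g1 t0) (g1 t0)) *: g1 t0.
    apply: (dot_perp _ (negbT (gt_eqF (W_gt0 t0))) (L2 t0) a0).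
    exact: (tangent_orth hg).
  set gam := dot e (g1 t0) in hc eE.
  have ee : dot e e * L ^+ 2 = gam ^+ 2.
    rewrite {1 2}eE dotZl dotC dotZl (sc_speed hg); field; rewrite gt_eqF //.
  (* The bound [|w| <= |x - y| / 8] enters here: the bending changes the velocity [y - x] by at most
     [4 * |w|], half of its norm. *)
  have ne : `|x - y| / 2 <= `|e|.
    have := ler_normB e ((4 * l * (1 - 2 * s)) *: w); rewrite /e addrK normrZ !normrM.
    rewrite (distrC y x) (ger0_norm (ler0n _ 4)) (ger0_norm l0) -/e.
    have : `|1 - 2 * s| <= 1 by rewrite ler_norml; apply/andP; split; lra.
    set b := `|1 - 2 * s| => b1; have b0 : 0 <= b by exact: normr_ge0.
    have : 4 * l * b <= 4 by rewrite -[leRHS]mulr1 -mulrA ler_pM2l //; nra.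
    by nra.
  set n := `|x - y| in hw1 hw2 ne; have n0 : 0 <= n by exact: normr_ge0.
  have E1 : n ^+ 2 / 4 <= dot e e.
    apply: le_trans (norm_sqr_le_dot e); rewrite (_ : n ^+ 2 / 4 = (n / 2) ^+ 2);
      last by field.
    by rewrite lerXn2r ?nnegrE //; lra.
  set E := dot e e in ee E1.
  have WW := W_gt0 t0; have LL : 0 < L ^+ 2 by rewrite exprn_gt0.
  have h1 : 3 / 8 * W t0 * E <= L ^+ 2 * (4 * `|dot w (g2 t0)|).
    have := hc; rewrite -ee /c dotZl => h.
    have : 3 / 8 * W t0 / L ^+ 4 * (E * L ^+ 2) = 3 / 8 * W t0 * E / L ^+ 2 by field;
      rewrite gt_eqF.
    move=> e1; rewrite e1 in h.
    have : 3 / 8 * W t0 * E / L ^+ 2 <= 4 * `|dot w (g2 t0)|.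
      apply: le_trans h _; rewrite -mulNr -mulrN; apply: le_trans (ler_norm _) _.
      rewrite !normrM normrN (ger0_norm (ler0n _ 4)) (ger0_norm l0) -!mulrA ler_pM2l //.
      by rewrite ler_piMl.
    by rewrite ler_pdivrMr // [_ * L ^+ 2]mulrC.
  have E0 : 0 <= E by apply: le_trans E1; rewrite divr_ge0 // sqr_ge0.
  have h2 : (3 / 8 * W t0 * E) ^+ 2 <= (L ^+ 2) ^+ 2 * (16 * (2 * `|w| ^+ 2 * W t0)).
    apply: (@le_trans _ _ ((L ^+ 2 * (4 * `|dot w (g2 t0)|)) ^+ 2)).
      rewrite lerXn2r ?nnegrE // ?mulr_ge0 // ?ltW //; lra.
    rewrite exprMn ler_pM2l ?exprn_gt0 // exprMn -[`|_| ^+ 2]normrX ger0_norm ?sqr_ge0 //.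
    rewrite (_ : 4 ^+ 2 = 16 :> R); last by ring.
    rewrite ler_pM2l //; apply: le_trans (dot_sqr_le _ _) _.
    by rewrite -/(W t0) ler_pM2r //; exact: dot_le_norm_sqr.
  have h3 : 9 / 64 * W t0 * E ^+ 2 <= (L ^+ 2) ^+ 2 * (32 * `|w| ^+ 2).
    by rewrite -(ler_pM2r WW); lra.
  have h4 : 9 / 64 * (k * L) ^+ 2 * E ^+ 2 <= (L ^+ 2) ^+ 2 * (32 * `|w| ^+ 2).
    apply: le_trans h3; apply: ler_wpM2r; first exact: sqr_ge0.
    by rewrite ler_pM2l //; exact: (sc_curv hg t0).
  (* With [n ^+ 2 / 4 <= E] this forces [L * |w| >= 3 * k * n ^+ 2 / (128 * sqrt 2)]. Since
     [128 * sqrt 2 / 3] is about 60.3, the constant 64 of the hypothesis gives a contradiction. *)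
  have h5 : 9 / 64 * k ^+ 2 * E ^+ 2 <= 32 * (L * `|w|) ^+ 2.
    rewrite -(ler_pM2r LL); lra.
  have h6 : L * `|w| < k / 64 * n ^+ 2 by rewrite mulrC -ltr_pdivlMr.
  have Lw : 0 <= L * `|w| by rewrite mulr_ge0 // ltW.
  have h7 : (L * `|w|) ^+ 2 < (k / 64 * n ^+ 2) ^+ 2.
    rewrite -subr_gt0 subr_sqr mulr_gt0 //; lra.
  have h8 : (n ^+ 2 / 4) ^+ 2 <= E ^+ 2.
    by rewrite lerXn2r ?nnegrE // divr_ge0 // sqr_ge0.
  have k2 : 0 < k ^+ 2 by rewrite exprn_gt0.
  have h9 : 9 / 64 * k ^+ 2 * (n ^+ 2 / 4) ^+ 2 <= 9 / 64 * k ^+ 2 * E ^+ 2.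
    by rewrite ler_wpM2l // mulr_ge0 // ltW.
  have h10 : 0 <= k ^+ 2 * (n ^+ 2) ^+ 2 by rewrite mulr_ge0 ?sqr_ge0 // ltW.
  lra.
Qed.

End region_body.

(** * Diameter and inscribed ball of the region *)

Section curve_body.
Context {R : realType} (k L : R) (g g1 g2 : R -> 'rV[R]_2) (D : set 'rV[R]_2).
Hypothesis hg : speed_curve k L g g1 g2.
Hypothesis hD : curve_region g D.

Let k0 : 0 < k. Proof. exact: sc_k hg. Qed.
Let L0 : 0 < L. Proof. exact: sc_L hg. Qed.

Lemma curve_dist_le u v : `|g u - g v| <= L.
Proof.
have shift s : exists2 s', 0 <= s' <= 1 & g s' = g s.
  have /andP[n1 n2] := floor_itv s.
  exists (s - (Num.floor s)%:~R).
    by move: n2; rewrite intrD mulr1z => n2; apply/andP; split; lra.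
  by apply/(sc_inj hg); rewrite addrAC subrr add0r rpredN intr_int.
have [u' hu <-] := shift u; have [v' hv <-] := shift v.
have key (w : 'rV[R]_2) s t : dot w w = 1 -> 0 <= s <= 1 -> 0 <= t <= 1 ->
    `|dot (g s - g t) w| <= L.
  move=> ww; wlog ts : s t / t <= s => [H hs ht|/andP[s0 s1] /andP[t0 t1]].
    have [h|h] := leP t s; first exact: H.
    rewrite (_ : dot _ _ = - dot (g t - g s) w); last by rewrite /dot !cE; ring.
    by rewrite normrN; apply: H => //; exact: ltW.
  have [c _ e] := mean_value (fun x => is_derive_dot (g t) w (sc_d1 hg x)) ts.
  have d0 : dot (g t - g t) w = 0 by rewrite subrr /dot !cE !mul0r addr0.
  rewrite d0 subr0 in e; rewrite e normrM (@ger0_norm _ (s - t)); last lra.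
  have : `|dot (g1 c) w| <= L.
    rewrite -(@ler_pXn2r _ 2) ?nnegrE ?(ltW L0) // -normrX ger0_norm ?sqr_ge0 //.
    by apply: le_trans (dot_sqr_le _ _) _; rewrite (sc_speed hg) ww mulr1.
  have := normr_ge0 (dot (g1 c) w); nra.
rewrite norm_le; apply/andP; split.
  have e1 : dot (vec 1 0) (vec 1 0) = 1 :> R by rewrite /dot !cE; ring.
  have := key _ u' v' e1 hu hv; rewrite (_ : dot _ _ = cx (g u' - g v')) //.
  by rewrite /dot !cE; ring.
have e2 : dot (vec 0 1) (vec 0 1) = 1 :> R by rewrite /dot !cE; ring.
have := key _ u' v' e2 hu hv; rewrite (_ : dot _ _ = cy (g u' - g v')) //.
by rewrite /dot !cE; ring.
Qed.

(** Prolonging the segment at both ends until it leaves [D] gives two points of the curve that are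
    at least as far apart. *)
Lemma region_diam x y : D x -> D y -> `|x - y| <= L.
Proof.
move=> Dx Dy; have [->|xy] := eqVneq x y; first by rewrite subrr normr0 ltW.
have [B hB] := cr_bounded hD.
have bnd u v : D u -> D v -> `|u - v| <= 2 * B.
  by move=> /hB hu /hB hv; apply: le_trans (ler_normB _ _) _; lra.
have w0 : x - y != 0 by rewrite subr_eq0.
have w0' : y - x != 0 by rewrite subr_eq0 eq_sym.
have [v v0 [vD vcl _]] := exit_point (cr_open hD) Dx (fun z Dz => bnd _ _ Dx Dz) w0.
have [u u0 [uD ucl _]] := exit_point (cr_open hD) Dy (fun z Dz => bnd _ _ Dy Dz) w0'.
have [s sE] := cr_boundary hD vcl vD; have [t tE] := cr_boundary hD ucl uD.
apply: le_trans (curve_dist_le s t); rewrite -sE -tE.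
rewrite (_ : x + _ - _ = (1 + v + u) *: (x - y)); last by apply: vecP; rewrite !cE; ring.
by rewrite normrZ ger0_norm ?ler_peMl //; lra.
Qed.

Lemma normal_axis u (e : 'rV[R]_2) : dot e e = 1 -> dot (g1 u) e = 0 ->
  g2 u = dot (g2 u) e *: e /\ dot (g2 u) e != 0.
Proof.
move=> ee ue.
have L2 : dot (g1 u) (g1 u) != 0 by rewrite (sc_speed hg) gt_eqF // exprn_gt0.
have E : g2 u = dot (g2 u) e *: e.
  have := dot_perp ue L2 _ (tangent_orth hg u); rewrite ee divr1; apply.
  by rewrite oner_neq0.
split => //; apply/eqP => e0; have := sc_curv hg u; rewrite E e0 scale0r.
have : 0 < (k * L) ^+ 2 by rewrite exprn_gt0 // mulr_gt0.
by rewrite /dot !cE !mul0r addr0; lra.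
Qed.

(* Both points maximize or both minimize the same coordinate over the closure
   of D, which contains no segment in its boundary. *)
Lemma same_normal u u' (e : 'rV[R]_2) : dot e e = 1 ->
  dot (g1 u) e = 0 -> dot (g1 u') e = 0 ->
  (0 < dot (g2 u) e) = (0 < dot (g2 u') e) -> g u = g u'.
Proof.
move=> ee ue u'e sgn; have [gE gn0] := normal_axis ee ue;
  have [gE' gn0'] := normal_axis ee u'e.
have supp t z : dot (g1 t) e = 0 -> closure D z -> 0 <= dot (g2 t) e * dot (z - g t) e.
  move=> te cz; have [hE _] := normal_axis ee te.
  by have := global_support hg hD t cz; rewrite {1}hE dotC dotZl (dotC e).
have [//|guu] := eqVneq (g u) (g u').
have clu := (@cr_closure _ _ _ hD u); have clu' := (@cr_closure _ _ _ hD u').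
have half : 0 < (2^-1 : R) < 1 by apply/andP; split; lra.
have Dm := no_flat_segment hg hD (fun s hs =>
  closure_region_convex hg hD clu clu' hs) guu half.
set m := g u + _ in Dm.
have [r r0 hr] := openP (cr_open hD) Dm.
have e0 : 0 <= `|e| by exact: normr_ge0.
pose h := r / (`|e| + 1) / 2.
have h0 : 0 < h by rewrite !divr_gt0 //; lra.
have he : h * `|e| < r.
  have : 2 * h * (`|e| + 1) = r by rewrite /h; field; lra.
  by nra.
have inD s : `|s| = h -> closure D (m + s *: e).
  by move=> sh; apply/subset_closure/hr; rewrite addrAC subrr add0r normrZ sh.
have mE s : dot (m + s *: e - g u) e = 2^-1 * dot (g u' - g u) e + s * dot e e.
  by rewrite /m /dot !cE; ring.
have mE' s : dot (m + s *: e - g u') e = - 2^-1 * dot (g u' - g u) e + s * dot e e.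
  by rewrite /m /dot !cE; field.
have := supp u _ ue (inD h (gtr0_norm h0)); have := supp u' _ u'e (inD h (gtr0_norm h0)).
have nh : `|- h| = h by rewrite normrN gtr0_norm.
have := supp u _ ue (inD (- h) nh); have := supp u' _ u'e (inD (- h) nh).
rewrite !mE !mE' ee !mulr1 => h1 h2 h3 h4; exfalso; move: h1 h2 h3 h4.
have [gp|gn] := ltP 0 (dot (g2 u) e).
  have gp' : 0 < dot (g2 u') e by rewrite -sgn.
  by rewrite !(pmulr_rge0 _ gp) !(pmulr_rge0 _ gp'); lra.
have {}gn : dot (g2 u) e < 0 by rewrite lt_neqAle gn0.
have gn' : dot (g2 u') e < 0.
  by rewrite lt_neqAle gn0' leNgt -sgn -leNgt ltW.
by rewrite !(nmulr_rge0 _ gn) !(nmulr_rge0 _ gn'); lra.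
Qed.

(** Pigeonhole: by [same_normal] a period has at most four points with tangent parallel to an axis,
    one for each axis and each sign of the normal, so one of five arcs has none. *)
Lemma monotone_arc : exists (i : nat),
  forall u, i%:R / 5 < u < i.+1%:R / 5 -> dot (g1 u) (vec 1 0) != 0 /\ dot (g1 u) (vec
    0 1) != 0.
Proof.
apply: contrapT => nex.
pose ax (b : bool) : 'rV[R]_2 := if b then vec 1 0 else vec 0 1.
have axax b : dot (ax b) (ax b) = 1 by case: b; rewrite /ax /dot !cE; ring.
have /choice[ub hub] : forall i : 'I_5, exists ub : R * bool,
    i%:R / 5 < ub.1 < i.+1%:R / 5 /\ dot (g1 ub.1) (ax ub.2) = 0.
  move=> i; apply: contrapT => nub; apply: nex; exists i => u hu; split.
    by apply/eqP => h; apply: nub; exists (u, true).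
  by apply/eqP => h; apply: nub; exists (u, false).
pose code (i : 'I_5) := ((ub i).2, 0 < dot (g2 (ub i).1) (ax (ub i).2)).
have /injectivePn[i [j ij codeE]] : ~~ injectiveb code.
  apply/negP => /injectiveP/card_imset => /(_ [set: 'I_5]%SET).
  rewrite cardsT card_ord => h; have := max_card [pred x | x \in code @: [set: 'I_5]%SET].
  by rewrite h card_prod card_bool.
case: codeE => b sgn; have [hi zi] := hub i; have [hj zj] := hub j.
rewrite -b in zj sgn.
have /(sc_inj hg)/intrP[m hm] := same_normal (axax _) zi zj sgn.
have i5 : i%:R <= 4 :> R by rewrite -[4]/(4%:R) ler_nat -ltnS ltn_ord.
have j5 : j%:R <= 4 :> R by rewrite -[4]/(4%:R) ler_nat -ltnS ltn_ord.
have i0 : 0 <= i%:R :> R by rewrite ler0n.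
have j0 : 0 <= j%:R :> R by rewrite ler0n.
have si (p : nat) : (p.+1%:R : R) = p%:R + 1 by rewrite natr1.
rewrite (si i) in hi; rewrite (si j) in hj; move: hi hj => /andP[hi1 hi2] /andP[hj1 hj2].
have m1 : -1 < (m%:~R : R) < 1 by rewrite -hm; apply/andP; split; lra.
have m0 : m = 0.
  have /andP[ma mb] := m1; have : (-1 < m)%R by rewrite -(ltr_int R) rmorphN1.
  have : (m < 1)%R by rewrite -(ltr_int R).
  by clear; lia.
rewrite m0 in hm; move/eqP: ij; apply; apply/val_inj => /=.
have h1 : (i%:R : R) < j%:R + 1 by move: hm => /=; lra.
have h2 : (j%:R : R) < i%:R + 1 by move: hm => /=; lra.
by rewrite !natr1 !ltr_nat in h1 h2; apply/eqP; rewrite eqn_leq -ltnS h1 -ltnS h2.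
Qed.

Lemma const_sign (f : R -> R) a b : continuous f -> (forall t,
  a < t < b -> f t != 0) -> a < b ->
  exists s, `|s| = 1 /\ forall t, a < t < b -> s * f t = `|f t|.
Proof.
move=> cf nz ab; have mab : a < (a + b) / 2 < b by apply/andP; split; lra.
have [fm|fm] := ltP 0 (f ((a + b) / 2)).
  exists 1; rewrite normr1; split => // t tab; rewrite mul1r gtr0_norm //.
  exact: (no_zero_sign cf nz mab tab fm).
have cnf : continuous (fun t => - f t) by move=> x; apply: cvgN; exact: cf.
exists (-1); rewrite normrN normr1; split => // t tab; rewrite mulN1r ltr0_norm //.
rewrite -oppr_gt0; apply: (no_zero_sign cnf _ mab tab).
  by move=> s hs; rewrite oppr_eq0 nz.
by rewrite oppr_gt0 lt_neqAle fm nz.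
Qed.

(** On a monotone arc the components of [g1] keep their signs, so the displacement along
    [w = (s1, s2)] grows at the rate [|X| + |Y| >= L]. Half of the arc yields [L / 10], and
    [dot_norm_le] loses a factor 2. *)
Lemma far_points : exists u v, L / 20 <= `|g u - g v|.
Proof.
have [i hi] := monotone_arc; pose a : R := i%:R / 5; pose b : R := i.+1%:R / 5.
have ab5 : b = a + 1 / 5 by rewrite /a /b -natr1; field.
have ab : a < b by lra.
have c1 v : continuous (fun s => dot (g1 s) v).
  exact: (derive_continuous (fun t => is_derive_dot0 v (sc_d2 hg t))).
have [s1 [s11 h1]] := const_sign (c1 (vec 1 0)) (fun u hu => (hi u hu).1) ab.
have [s2 [s22 h2]] := const_sign (c1 (vec 0 1)) (fun u hu => (hi u hu).2) ab.
pose u := a + 1 / 20; pose v := a + 3 / 20; have uv : u <= v by rewrite /u /v; lra.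
exists v, u; set w := vec s1 s2.
have [c /andP[uc cv] e] := mean_value (fun x => is_derive_dot (g u) w (sc_d1 hg x)) uv.
have d0 : dot (g u - g u) w = 0 by rewrite subrr /dot !cE !mul0r addr0.
rewrite d0 subr0 (_ : v - u = 1 / 10) in e; last by rewrite /u /v; field.
have cab : a < c < b by apply/andP; split; rewrite /u /v in uc cv; lra.
have Lc : L <= dot (g1 c) w.
  have -> : dot (g1 c) w = s1 * dot (g1 c) (vec 1 0) + s2 * dot (g1 c) (vec 0 1).
    by rewrite /w /dot !cE; ring.
  rewrite (h1 _ cab) (h2 _ cab); set X := dot _ _; set Y := dot _ _.
  have X0 := normr_ge0 X; have Y0 := normr_ge0 Y.
  rewrite -(@ler_pXn2r _ 2) ?nnegrE ?(ltW L0) ?addr_ge0 // -(sc_speed hg c).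
  have -> : dot (g1 c) (g1 c) = `|X| ^+ 2 + `|Y| ^+ 2.
    rewrite -!normrX !ger0_norm ?sqr_ge0 // /X /Y /dot !cE; ring.
  by rewrite sqrrD; have := mulr_ge0 X0 Y0; lra.
have w1 : `|w| = 1 by rewrite norm_max /w !cE s11 s22 maxxx.
have := dot_norm_le (g v - g u) w; rewrite w1 mulr1 e ger0_norm; last first.
  by rewrite mulr_ge0 //; have := L0; lra.
by lra.
Qed.

Let a0 := Num.min (k / 64) (1 / 8).

Lemma region_mid_min x y w : D x -> D y -> `|w| < a0 * `|x - y| ^+ 2 / L ->
  D (2^-1 *: (x + y) + w).
Proof.
move=> Dx Dy hw; have xyL := region_diam Dx Dy.
set n := `|x - y| in hw xyL; have n0 : 0 <= n by exact: normr_ge0.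
have ak : a0 <= k / 64 by rewrite ge_min lexx.
have a8 : a0 <= 1 / 8 by rewrite ge_min lexx orbT.
apply: (region_mid hg hD) => //; rewrite -/n.
  apply: lt_le_trans hw _; rewrite -!(mulrA _ (n ^+ 2)).
  by apply: ler_wpM2r => //; rewrite divr_ge0 ?sqr_ge0 // ltW.
apply: ltW; apply: lt_le_trans hw _; rewrite ler_pdivrMr //.
have : a0 * n ^+ 2 <= 1 / 8 * n ^+ 2 by rewrite ler_wpM2r // sqr_ge0.
have : n ^+ 2 <= n * L by rewrite expr2 ler_wpM2l.
lra.
Qed.

(** The inscribed ball is centred at the midpoint of two points of [D] close to the far points. They
    are at least [L / 21] apart, so [region_mid_min] gives the radius [a0 * L / 441], more than the
    [a0 * L / 800] required. *)
Lemma curve_body : body (a0 / 800) L D.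
Proof.
have a00 : 0 < a0 by rewrite lt_min divr_gt0 // divr_gt0.
have a8 : a0 <= 1 / 8 by rewrite ge_min lexx orbT.
split.
- exact: L0.
- exact: cr_open hD.
- exact: region_convex hg hD.
- exact: region_diam.
- move=> x y w Dx Dy hw; apply: region_mid_min => //; apply: lt_le_trans hw _.
  rewrite -!(mulrA _ (`|x - y| ^+ 2)).
  have : 0 <= `|x - y| ^+ 2 / L by rewrite divr_ge0 ?sqr_ge0 // ltW.
  by move/(mulr_ge0 (ltW a00)); set X := _ / L; lra.
have [u [v uv]] := far_points.
pose e := a0 * L / 40 / 40; have LL := L0.
have e0 : 0 < e by rewrite !divr_gt0 // mulr_gt0.
have aL : a0 * L <= L / 8 by rewrite ler_pdivlMr //; nra.
have /closureP/(_ e e0)[x Dx xu] := (@cr_closure _ _ _ hD u).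
have /closureP/(_ e e0)[y Dy yv] := (@cr_closure _ _ _ hD v).
exists (2^-1 *: (x + y)); first exact: convexs_mid (region_convex hg hD) Dx Dy.
move=> z hz.
rewrite (_ : z = 2^-1 *: (x + y) + (z - 2^-1 *: (x + y))); last by rewrite addrC subrK.
apply: region_mid_min => //; apply: lt_le_trans hz _.
have n1 : L / 21 <= `|x - y|.
  have := le_normB3 (g u) x (g v); have := le_normB3 x y (g v).
  by rewrite (distrC (g u) x) /e in xu yv *; lra.
have n2 : (L / 21) ^+ 2 <= `|x - y| ^+ 2.
  by rewrite lerXn2r ?nnegrE // divr_ge0 // ltW.
rewrite ler_pdivlMr //.
apply: (@le_trans _ _ (a0 * (L / 21) ^+ 2)); last by rewrite ler_pM2l.
have : 0 <= a0 * L ^+ 2 by rewrite mulr_ge0 ?sqr_ge0 // ltW.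
by lra.
Qed.

End curve_body.

(** * From Jordan regions to bodies *)

Section regions.
Context {R : realType}.

Lemma component_open (A : set 'rV[R]_2) x : open A -> open (connected_component A x).
Proof.
move=> oA; apply: openPn => z cz; have [e e0 he] := openP oA (connected_component_sub cz).
exists e => // w hw.
pose f (t : R) := z + t *: (w - z).
have cf : continuous f by apply: continuous_addZ => t; [exact: cvg_cst|exact: cvg_id].
have cim : connected (f @` `[0, 1]%classic).
  apply: connected_continuous_connected; first exact: segment_connected.
  exact: continuous_subspaceT.
have fz : (f @` `[0, 1]%classic) z.
  by exists 0; rewrite /f ?scale0r ?addr0 //= in_itv /= lexx ler01.
have cxz := same_connected_component cz.
rewrite cxz; apply: (connected_component_max fz _ cim).
  move=> _ [t /= /[!in_itv]/= /andP[t0 t1] <-]; apply: he.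
  by rewrite addrAC subrr add0r normrZ ger0_norm // (le_lt_trans _ hw) // ler_piMl.
by exists 1; rewrite /f ?scale1r ?subrKC //= in_itv /= ler01 lexx.
Qed.

Lemma jordan_curve_closed (C : set 'rV[R]_2) : jordan_curve C -> closed C.
Proof.
move=> [g [cg gE <-]]; suff -> : range g = g @` `[0, 1]%classic.
  apply: compact_closed; first exact: norm_hausdorff.
  apply: continuous_compact; last exact: segment_compact.
  exact: continuous_subspaceT.
apply/seteqP; split; last by move=> _ [t _ <-]; exists t.
move=> _ [t _ <-]; have /andP[n1 n2] := floor_itv t.
exists (t - (Num.floor t)%:~R).
  by move: n2; rewrite /= in_itv /= intrD mulr1z => n2; apply/andP; split; lra.
by apply/gE; rewrite addrAC subrr add0r rpredN intr_int.
Qed.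

Lemma jordan_region_open (D : set 'rV[R]_2) : jordan_region D -> open D.
Proof.
move=> [C [jC [x [_ -> _]]]]; apply: component_open.
by rewrite openC; exact: jordan_curve_closed.
Qed.

(** The Jordan curve [C] that defines the region shows that [D] is open and connected; the
    statements about the boundary come from [g], which parametrizes [boundary D]. *)
Lemma jordan_region_curve (g : R -> 'rV[R]_2) (D : set 'rV[R]_2) :
  jordan_region D -> range g = boundary D -> curve_region g D.
Proof.
move=> jD gD; have oD := jordan_region_open jD; move: jD => [C [jC [x [Cx DE bD]]]].
have bdE z : boundary D z <-> closure D z /\ ~ D z.
  by rewrite /boundary (interior_id _).1.
split => //.
- by rewrite DE; exact: component_connected.
- by exists x; rewrite DE; exact: connected_component_refl.
- have [B [_ hB]] := bD; exists (B + 1) => z Dz.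
  by apply: hB => //; rewrite ltrDl.
- move=> z cz Dz; have : boundary D z by apply/bdE.
  by rewrite -gD => -[t _ <-]; exists t.
- move=> t; have : boundary D (g t) by rewrite -gD; exists t.
  by move/bdE => [].
- move=> t; have : boundary D (g t) by rewrite -gD; exists t.
  by move/bdE => [].
Qed.

Lemma dot_enorm (v : 'rV[R]_2) : dot v v = enorm v ^+ 2.
Proof. by rewrite enorm_sqr sqr_sqrtr ?addr_ge0 ?sqr_ge0 // /dot !expr2. Qed.

Lemma packing_body (k : R) (D : set 'rV[R]_2) : 0 < k -> jordan_region D ->
  curvature_ge_div_length (boundary D) k ->
  exists l, body (Num.min (k / 64) (1 / 8) / 800) l D.
Proof.
move=> k0 jD [g [[[cg gE gD] [d1 d2 cg2] nz] spd curv]].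
have hD := jordan_region_curve jD gD.
exists (curve_length g); set L := curve_length g in spd curv *.
have sL t : enorm (g^`()%classic t) = L by exact: spd.
have L0 : 0 < L.
  rewrite -(sL 0); apply: lt_le_trans (norm_le_enorm _); by rewrite normr_gt0 nz.
apply: (@curve_body _ k L g g^`()%classic g^`(2)%classic) hD; split => //.
- by move=> t j; apply: is_derive_coord; exact: d1.
- by move=> t j; apply: is_derive_coord; exact: d2.
- by move=> t; rewrite dot_enorm sL.
- move=> t; rewrite dot_enorm; have := curv t.
  rewrite /curvature -/L ler_pdivlMl ?exprn_gt0 // => h.
  rewrite lerXn2r ?nnegrE ?sqrtr_ge0 ?mulr_ge0 ?(ltW L0) ?(ltW k0) //.
  apply: le_trans h; rewrite (_ : _ * (k / L) = k * L) //.
  by field; rewrite gt_eqF.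
Qed.

End regions.

(** * The bodies near a residual point *)

Section dichotomy.
Context {R : realType}.

Lemma common_radius (P : nat -> R -> Prop) M :
  (forall i, exists2 e, 0 < e & P i e) ->
  (forall i e e', P i e -> e' <= e -> P i e') ->
  exists2 e, 0 < e & forall i, (i < M)%N -> P i e.
Proof.
move=> ex mono; elim: M => [|M [e e0 he]]; first by exists 1.
have [e' e'0 he'] := ex M; exists (Num.min e e') => [|i]; first by rewrite lt_min e0.
rewrite ltnS leq_eqVlt => /predU1P[->|/he Pi].
  by apply: mono he' _; rewrite ge_min lexx orbT.
by apply: mono Pi _; rewrite ge_min lexx.
Qed.

Lemma bounded_index (F : pred nat) N :
  (forall n, #|[pred i : 'I_n | F i]| <= N)%N -> exists M, forall i, F i -> (i < M)%N.
Proof.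
move=> hN; apply: contrapT => nex.
have ex M : exists2 i, F i & (M <= i)%N.
  apply: contrapT => nexM; apply: nex; exists M => i Fi; rewrite ltnNge.
  by apply/negP => Mi; apply: nexM; exists i.
pose c n := (\sum_(i < n) F i)%N.
have cE n : c n = #|[pred i : 'I_n | F i]|.
  by rewrite -sum1_card big_mkcond; apply: eq_bigr => i _; rewrite inE; case: (F i).
have cmono n m : (n <= m)%N -> (c n <= c m)%N.
  elim: m => [|m IH]; first by rewrite leqn0 => /eqP ->.
  rewrite leq_eqVlt => /predU1P[->//|/IH h].
  by rewrite /c big_ord_recr /= (leq_trans h) // leq_addr.
have big p : exists n, (p <= c n)%N.
  elim: p => [|p [n pn]]; first by exists 0%N.
  have [i Fi ni] := ex n; exists i.+1; rewrite /c big_ord_recr /= Fi addn1 ltnS.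
  exact: leq_trans pn (cmono _ _ ni).
by have [n] := big N.+1; rewrite cE ltnNge hN.
Qed.

Context (a : R) (D : nat -> set 'rV[R]_2) (l : nat -> R).
Hypothesis a01 : 0 < a <= 1.
Hypothesis bD : forall i, body a (l i) (D i).
Hypothesis dis : forall i j, i <> j -> D i `&` D j = set0.

Let a0 : 0 < a. Proof. by case/andP: a01. Qed.

Lemma disj_closure i j y : i <> j -> D i y -> closure (D j) y -> False.
Proof.
move=> ij Diy cjy; have [z [Djz Diz]] := cjy _ (open_nbhs_nbhs (conj (body_open (bD i))
  Diy)).
by have : (D i `&` D j) z by []; rewrite dis.
Qed.

(* Otherwise the midpoint of the two common points lies in both bodies. *)
Lemma common_closure i j x y : i <> j -> closure (D i) x -> closure (D j) x ->
  closure (D i) y -> closure (D j) y -> x = y.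
Proof.
move=> ij ix jx iy jy; have [//|xy] := eqVneq x y; exfalso.
have mid k : closure (D k) x -> closure (D k) y -> D k (2^-1 *: (x + y)).
  move=> kx ky; rewrite -[_ *: _]addr0; apply: (closure_mid a0 (bD k)) => //.
  rewrite normr0 divr_gt0 ?(body_gt0 (bD k)) // mulr_gt0 // exprn_gt0 //.
  by rewrite normr_gt0 subr_eq0.
exact: (disj_closure ij (mid i ix iy) (subset_closure (mid j jx jy))).
Qed.

Lemma closure_far j x : ~ closure (D j) x ->
  exists2 e, 0 < e & forall y, `|y - x| < e -> ~ D j y.
Proof.
move=> njx; apply: contrapT => nex; apply: njx; apply/closureP => e e0.
apply: contrapT => nw; apply: nex; exists e => // y yx Dy; by apply: nw; exists y.
Qed.

(* Otherwise the points near x0 outside of the bodies lie in two closures, hence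
   are isolated, and one can walk around x0 within a single convex body. *)
Lemma not_covered M x0 r : 0 < r -> (forall i, ~ D i x0) ->
  ~ (forall y, `|y - x0| < r -> exists2 i, (i < M)%N & closure (D i) y).
Proof.
move=> r0 Dx0 cov.
(* If only one of the closures contained [y], a whole square around [y] would lie in it, and strict
   convexity would put the centre [y] in that body. *)
have two y : `|y - x0| < r -> (forall i, ~ D i y) ->
    exists i j, [/\ (i < M)%N, (j < M)%N, i <> j, closure (D i) y & closure (D j) y].
  move=> yr Dy; have [i iM iy] := cov y yr; apply: contrapT => nex.
  have [e e0 he] : exists2 e, 0 < e & forall j, (j < M)%N -> j <> i ->
      forall z, `|z - y| < e -> ~ D j z.
    have [||e e0 he] := @common_radius (fun j e => (j < M)%N -> j <> i ->
      forall z, `|z - y| < e -> ~ D j z) M; last by exists e => // j jM; exact: he.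
      move=> j; have [jy|/closure_far[e e0 he]] := pselect (closure (D j) y);
        last by exists e.
      by exists 1 => // jM ji; exfalso; apply: nex; exists j, i.
    by move=> j e e' h ee' jM ji z ze'; apply: h => //; exact: lt_le_trans ee'.
  pose d := Num.min e (r - `|y - x0|).
  have de : d <= e by rewrite ge_min lexx.
  have dr : d <= r - `|y - x0| by rewrite ge_min lexx orbT.
  have d0 : 0 < d by rewrite lt_min e0 subr_gt0.
  have inD z : `|z - y| < d -> closure (D i) z.
    move=> zy; have zx := le_normB3 z y x0.
    have [j jM jz] : exists2 j, (j < M)%N & closure (D j) z by apply: cov; lra.
    have [<-//|/eqP ji] := eqVneq j i.
    have e1 : 0 < d - `|z - y| by rewrite subr_gt0.
    have /closureP/(_ _ e1)[w Dw wz] := jz.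
    have wy := le_normB3 w z y; exfalso; apply: he Dw => //; lra.
  pose u : 'rV[R]_2 := vec (d / 2) 0.
  have un : `|u| = d / 2 by rewrite norm_max !cE normr0 gtr0_norm ?divr_gt0 // max_l //
    ltW ?divr_gt0.
  apply: (Dy i); rewrite (_ : y = 2^-1 *: ((y + u) + (y - u)) + 0); last first.
    by apply: vecP; rewrite !cE; field.
  apply: (closure_mid a0 (bD i)).
  - by apply: inD; rewrite addrAC subrr add0r un; lra.
  - by apply: inD; rewrite addrAC subrr add0r normrN un; lra.
  rewrite normr0 divr_gt0 ?(body_gt0 (bD i)) // mulr_gt0 // exprn_gt0 //.
  rewrite (_ : _ - _ = 2 *: u); last by apply: vecP; rewrite !cE; ring.
  by rewrite normrZ un mulr_gt0 // ?normr_gt0 // divr_gt0.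
have [e e0 iso] : exists2 e, 0 < e & forall i, (i < M)%N -> forall j,
  (j < M)%N -> i <> j ->
    forall y, `|y - x0| < e -> closure (D i) y -> closure (D j) y -> y = x0.
  apply: (@common_radius (fun i e => forall j, (j < M)%N -> i <> j ->
    forall y, `|y - x0| < e -> closure (D i) y -> closure (D j) y -> y = x0)) => [i|];
      last first.
    by move=> i e e' h ee' j jM ij y ye; apply: (h j) => //; exact: lt_le_trans ee'.
  apply: (@common_radius (fun j e => i <> j ->
    forall y, `|y - x0| < e -> closure (D i) y -> closure (D j) y -> y = x0)) => [j|];
      last first.
    by move=> j e e' h ee' ij y ye; apply: h => //; exact: lt_le_trans ee'.
  have [[y [yx iy jy]]|nex] := pselect (exists y, [/\ y <> x0,
    closure (D i) y & closure (D j) y]).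
    exists `|y - x0|; first by rewrite normr_gt0 subr_eq0; apply/eqP.
    by move=> ij z zx iz jz; move: zx; rewrite (common_closure ij iz jz iy jy) ltxx.
  exists 1 => // ij y _ iy jy; apply: contrapT => yx; apply: nex; exists y; split => //.
pose d := Num.min e r; have d0 : 0 < d by rewrite lt_min e0.
have de : d <= e by rewrite ge_min lexx.
have dr : d <= r by rewrite ge_min lexx orbT.
have punct y : `|y - x0| < d -> y <> x0 -> exists j, D j y.
  move=> yd yx; apply: contrapT => nD; apply: yx.
  have [||i [j [iM jM ij iy jy]]] := two y; first exact: lt_le_trans dr.
    by move=> i Dy; apply: nD; exists i.
  by apply: iso iy jy => //; exact: lt_le_trans de.
(* A path near [x0] that avoids [x0] cannot leave [D j]: each of its points is in some body, and a
   point of another body is not in the closure of [D j]. *)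
have walk j (p q : 'rV[R]_2) : (forall s,
  0 <= s <= 1 -> `|p + s *: (q - p)| < d /\ p + s *: (q - p) <> 0) ->
    D j (x0 + p) -> D j (x0 + q).
  move=> pq Dp; pose f (s : R) := (x0 + p) + s *: (q - p).
  have -> : x0 + q = f 1 by apply: vecP; rewrite /f !cE; ring.
  apply: path_stays => [|||]; [|exact: body_open (bD j)| |by rewrite /f scale0r addr0].
    by apply: continuous_addZ => t; [exact: cvg_cst|exact: cvg_id].
  move=> s /pq[sd s0] cj; have [||i Di] := punct (f s).
  - by rewrite (_ : f s - x0 = p + s *: (q - p)) //; apply: vecP; rewrite /f !cE; ring.
  - by move=> fx; apply: s0; apply: (addrI x0); rewrite addr0 addrA.
  have [<-//|/eqP ij] := eqVneq i j.
  by exfalso; exact: disj_closure ij Di cj.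
pose h := d / 2; have h0 : 0 < h by rewrite divr_gt0.
have hd : h < d by rewrite /h; lra.
have [||j D1] := punct (x0 + vec h 0).
- by rewrite addrAC subrr add0r norm_lt !cE normr0 d0 gtr0_norm // hd.
- move=> /(congr1 (@cx R)); rewrite !cE; lra.
have D2 : D j (x0 + vec 0 h).
  apply: walk D1 => s /andP[s0 s1]; split.
    rewrite norm_lt !cE; apply/andP; split; rewrite ltr_norml; apply/andP; split; nra.
  move=> z; have := congr1 (@cx R) z; have := congr1 (@cy R) z; rewrite !cE; nra.
have D3 : D j (x0 + vec (- h) 0).
  apply: walk D2 => s /andP[s0 s1]; split.
    rewrite norm_lt !cE; apply/andP; split; rewrite ltr_norml; apply/andP; split; nra.
  move=> z; have := congr1 (@cx R) z; have := congr1 (@cy R) z; rewrite !cE; nra.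
apply: (Dx0 j); rewrite (_ : x0 = 2^-1 *: ((x0 + vec h 0) + (x0 + vec (- h) 0))).
  exact: convexs_mid (body_convex (bD j)) D1 D3.
by apply: vecP; rewrite !cE; field.
Qed.

(** If no body has its neighbourhood inside a small square about [x0], all bodies that come close to
    [x0] are large. By [packing] they are finitely many, and [not_covered] gives a point outside
    their closures, hence a square free of bodies. *)
Lemma local_dichotomy (G : set 'rV[R]_2) x0 : open G -> G x0 -> (forall i, ~ D i x0) ->
  exists q r, [/\ 0 < r, (forall y, `|y - q| <= r -> G y) &
    (forall y i, `|y - q| <= r -> ~ D i y) \/
    (exists j, forall y, nb (D j) (2 * l j) y -> `|y - q| <= r)].
Proof.
move=> oG Gx Dx0; apply: contrapT => nex; have [e e0 he] := openP oG Gx.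
pose r := e / 2; have r0 : 0 < r by rewrite divr_gt0.
have re : r < e by rewrite /r; lra.
have large i y : D i y -> `|y - x0| <= r / 2 -> r / 8 <= l i.
  move=> Dy yx; rewrite leNgt; apply/negP => li; apply: nex; exists x0, r; split => //.
    by move=> z zr; apply: he; exact: le_lt_trans re.
  right; exists i => z [w Dw wz]; have wy := body_diam (bD i) Dw Dy.
  have := le_normB3 z w x0; have := le_normB3 w y x0; rewrite (distrC z w); lra.
pose F i := `[< exists2 y, D i y & `|y - x0| <= 4 * (r / 8) >].
have [M hM] : exists M, forall i, F i -> (i < M)%N.
  apply: (@bounded_index F (Num.truncn (neighbours a 4)).+1) => n.
  rewrite -(ler_nat R); apply: le_trans (ltW (truncnS_gt _)).
  apply: (@packing R 'I_n _ (fun i => D i) (fun i => l i) a 4 (r / 8) x0) => //.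
  - by rewrite divr_gt0.
  - by move=> i j _ _ ij; apply: dis => /val_inj/eqP; apply/negP.
  - by move=> i /asboolP[y Dy yx]; apply: (large i y) => //; lra.
  - by move=> i /asboolP.
apply: (@not_covered M x0 (r / 2)) => // [|y yr]; first by rewrite divr_gt0.
apply: contrapT => ny.
have [||e1 e10 he1] := @common_radius (fun j e => (j < M)%N ->
    forall z, `|z - y| < e -> ~ D j z) M.
- move=> j; have [jM|jM] := pselect (j < M)%N; last by exists 1 => // /jM.
  have /closure_far[e1 e10 h] : ~ closure (D j) y by move=> jy; apply: ny; exists j.
  by exists e1.
- by move=> i e1 e2 h ee' jM z ze; apply: h => //; exact: lt_le_trans ee'.
pose d := Num.min e1 (r / 2 - `|y - x0|).
have de : d <= e1 by rewrite ge_min lexx.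
have dr : d <= r / 2 - `|y - x0| by rewrite ge_min lexx orbT.
have d0 : 0 < d by rewrite lt_min e10 subr_gt0.
have yx0 := normr_ge0 (y - x0).
apply: nex; exists y, (d / 2); split; first by rewrite divr_gt0.
  by move=> z zd; apply: he; have := le_normB3 z y x0; lra.
left => z i zd Dz; have zx := le_normB3 z y x0.
have iM : (i < M)%N by apply: hM; apply/asboolP; exists z => //; lra.
by apply: (he1 i iM iM z) => //; lra.
Qed.

End dichotomy.

(** * Lower bounds for open covers of the residual set *)

Section residual_content.
Context {R : realType}.

Lemma closed_square (q : 'rV[R]_2) r : closed [set y | `|y - q| <= r].
Proof.
rewrite closure_id; apply/seteqP; split; first exact: subset_closure.
move=> y /closureP cy; apply/ler_addgt0Pr => e e0; have [w /= wr wy] := cy e e0.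
by have := le_normB3 y w q; rewrite (distrC y w); lra.
Qed.

Lemma compact_square (q : 'rV[R]_2) r : compact [set y | `|y - q| <= r].
Proof.
apply: bounded_closed_compact; last exact: closed_square.
exists (r + `|q|); split; first exact: num_real.
move=> M hM y /= yr; have := le_normB3 y q 0; rewrite !subr0; lra.
Qed.

Lemma compact_countable_cover (V : set 'rV[R]_2) (W : nat -> set 'rV[R]_2) :
  compact V -> (forall i, open (W i)) -> (forall y, V y -> exists i, W i y) ->
  exists N, forall y, V y -> exists2 i, (i < N)%N & W i y.
Proof.
move=> cV oW VW; have := cV; rewrite compact_cover => /(_ nat setT W (fun i _ => oW i)).
case=> [y /VW[i Wi]|F _ FV]; first by exists i.
exists (\max_(i <- finmap.enum_fset F) i)%N.+1 => y /FV[i /= iF Wi]; exists i => //.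
by rewrite ltnS; exact: (@leq_bigmax_seq _ _ xpredT (fun i => i)).
Qed.

(* Counts the points of a fine grid. *)
Lemma square_content N (E : nat -> set 'rV[R]_2) (e : nat -> R) q r : 0 < r ->
  (forall i, 0 < e i) -> (forall i x y, E i x -> E i y -> `|x - y| <= e i) ->
  (forall y, `|y - q| < r -> exists2 i, (i < N)%N & E i y) ->
  r ^+ 2 <= 4 * \sum_(i < N) e i ^+ 2.
Proof.
move=> r0 e0 Ed cov.
have [||h0 h00 hh] := @common_radius R (fun i h => h <= e i) N.
- by move=> i; exists (e i).
- by move=> i h h' h1 h2; exact: le_trans h2 h1.
pose h := Num.min h0 r; have hp : 0 < h by rewrite lt_min h00.
have hr : h <= r by rewrite ge_min lexx orbT.
have he (i : 'I_N) : h <= e i by rewrite (le_trans _ (hh i (ltn_ord i))) // ge_min lexx.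
pose Q := (Num.truncn (2 * r / h)).+1; pose o := q - vec r r.
have hQ : 2 * r <= h * Q%:R.
  by rewrite (mulrC h) -ler_pdivrMr //; exact/ltW/truncnS_gt.
have low : (r / h) ^+ 2 <= cnt o h Q [set y | `|y - q| < r].
  by apply: cnt_ge => //; rewrite /o !cE; lra.
have up : cnt o h Q [set y | `|y - q| < r] <= \sum_(i < N) cnt o h Q (E i).
  by apply: cnt_cover => y /cov[i iN Ei]; exists (Ordinal iN).
have each (i : 'I_N) : cnt o h Q (E i) <= 4 * e i ^+ 2 / h ^+ 2.
  apply: le_trans (cnt_le _ _ hp (ltW (e0 i)) (@Ed i)) _.
  rewrite (_ : 4 * _ / _ = (2 * (e i / h)) ^+ 2); last by field; rewrite gt_eqF.
  have eh : 0 <= e i / h by rewrite divr_ge0 // ltW.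
  apply: lerXn2r; rewrite ?nnegrE; [exact: addr_ge0|exact: mulr_ge0|].
  have : 1 <= e i / h by rewrite ler_pdivlMr // mul1r.
  by lra.
have h2 : 0 < h ^+ 2 by rewrite exprn_gt0.
rewrite -(ler_pM2r (_ : 0 < (h ^+ 2)^-1)) ?invr_gt0 // -expr_div_n.
apply: (le_trans low); apply: (le_trans up).
by rewrite mulr_sumr mulr_suml; apply: ler_sum => i _.
Qed.

(** Compactness of a square reduces to finitely many sets. In a square free of bodies, area bounds
    the sum of [e i ^+ 2] from below, and [e i <= 1] passes to the smaller exponent; otherwise
    [content_lower] applies to the body [j]. *)
Lemma residual_content (a : R) : 0 < a <= 1 -> exists n : nat, (0 < n)%N /\
  forall (D : nat -> set 'rV[R]_2) (l : nat -> R) (G : set 'rV[R]_2) x0,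
  (forall i, body a (l i) (D i)) -> (forall i j, i <> j -> D i `&` D j = set0) ->
  open G -> G x0 -> (forall i, ~ D i x0) ->
  exists2 c : R, 0 < c & forall (E : nat -> set 'rV[R]_2) (e : nat -> R),
    (forall i, open (E i)) -> (forall i, 0 < e i <= 1) ->
    (forall i x y, E i x -> E i y -> `|x - y| <= e i) ->
    (forall y, G y -> (exists i, D i y) \/ (exists i, E i y)) ->
    exists N, c <= \sum_(i < N) e i * e i `^ n%:R^-1.
Proof.
move=> a01; have [n [n0 [c c0 low]]] := content_lower a01.
exists n; split => // D l G x0 bD dis oG Gx Dx0.
have [q [r [r0 rG alt]]] := local_dichotomy a01 bD dis oG Gx Dx0.
have n1 : n%:R^-1 <= 1 :> R by rewrite invf_le1 ?ler1n // ltr0n.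
case: alt => [free|[j hj]].
  exists (r ^+ 2 / 4) => [|E e oE e01 Ed cov]; first by rewrite divr_gt0 // exprn_gt0.
  have e0 i : 0 < e i by have /andP[] := e01 i.
  have [|N hN] := compact_countable_cover (@compact_square q r) oE.
    by move=> y /= yr; have [[i /(free y i yr)]|] := cov y (rG y yr).
  exists N; have := square_content r0 e0 Ed (fun y yr => hN y (ltW yr)).
  suff : \sum_(i < N) e i ^+ 2 <= \sum_(i < N) e i * e i `^ n%:R^-1 by lra.
  by apply: ler_sum => i _; rewrite expr2 ler_pM2l // ger1_powR.
exists (c * (l j * l j `^ n%:R^-1)) => [|E e oE e01 Ed cov].
  by rewrite !mulr_gt0 ?powR_gt0 // (body_gt0 (bD j)).
have e0 i : 0 < e i by have /andP[] := e01 i.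
have [||N hN] := @compact_countable_cover _ (fun i => D i `|` E i) (@compact_square q r).
- by move=> i; apply: openU => //; exact: body_open (bD i).
- by move=> y /= yr; have [[i]|[i]] := cov y (rG y yr); exists i; [left|right].
pose M := maxn N j.+1; have jM : (j < M)%N by rewrite leq_maxr.
exists M.
apply: (low 'I_M 'I_M (fun i => D i) (fun i => l i) (fun i => E i) (fun i => e i)
  [set y | `|y - q| <= r] (Ordinal jM)) => //.
- by move=> i k ik; apply: dis => /val_inj/eqP; apply/negP.
- by move=> i x y; exact: Ed.
- move=> y /hN[i iN]; have iM : (i < M)%N by rewrite (leq_trans iN) // leq_maxl.
  by case; [left|right]; exists (Ordinal iM).
- exists (r + `|q|) => y /= yr; have := le_normB3 y q 0; rewrite !subr0; lra.
Qed.

End residual_content.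

(** * From covers to Hausdorff dimension *)

Section hausdorff.
Context {R : realType}.

Lemma nb_open (A : set 'rV[R]_2) r : open (nb A r).
Proof.
apply: openPn => z [x Ax xz]; exists (r - `|x - z|); first by rewrite subr_gt0.
by move=> w wz; exists x => //; have := le_normB3 x z w; rewrite (distrC z w); lra.
Qed.

Lemma diam_dist (E : set 'rV[R]_2) (delta : R) : (diam E <= delta%:E)%E ->
  forall x y, E x -> E y -> `|x - y| <= fine (diam E).
Proof.
move=> dE x y Ex Ey.
have : ((enorm (x - y))%:E <= diam E)%E.
  by apply: ereal_sup_ubound; exists x => //; exists y.
move: dE; case: (diam E) => [d _|//|//]; rewrite lee_fin => /=.
by apply: le_trans; exact: norm_le_enorm.
Qed.

Lemma fine_diam_ge0 (E : set 'rV[R]_2) (delta : R) : (diam E <= delta%:E)%E ->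
  0 <= fine (diam E).
Proof.
move=> dE; have [[x Ex]|nE] := pselect (E !=set0).
  by have := diam_dist dE Ex Ex; rewrite subrr normr0.
rewrite /diam (_ : [set _ | _ in _ & _ in _] = set0) ?ereal_sup0 //.
by rewrite -subset0 => z [x Ex _]; apply: nE; exists x.
Qed.

Lemma poweR_diam (E : set 'rV[R]_2) (delta t : R) : (diam E <= delta%:E)%E -> 0 < t ->
  poweR (diam E) t = (fine (diam E) `^ t)%:E.
Proof.
move=> + t0; case: (diam E) => [d _|//|_]; first by rewrite poweR_EFin.
by rewrite poweRNyr ?gt_eqF //= powR0 // gt_eqF.
Qed.

Lemma sum_half_pow N : \sum_(i < N) (2^-1 : R) ^+ i.+1 <= 1.
Proof.
suff -> : \sum_(i < N) (2^-1 : R) ^+ i.+1 = 1 - 2^-1 ^+ N.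
  by rewrite gerBl exprn_ge0 // invr_ge0.
elim: N => [|N IH]; first by rewrite big_ord0 expr0 subrr.
by rewrite big_ord_recr /= IH exprS; field.
Qed.

Lemma powRD_le (x y t : R) : 0 <= x -> 0 <= y -> 0 <= t <= 2 ->
  (x + y) `^ t <= 4 * (x `^ t + y `^ t).
Proof.
move=> x0 y0 /andP[t0 t2].
have two : (2 : R) `^ t <= 4.
  apply: (@le_trans _ _ (2 `^ 2)); first by apply: ler_powR => //; rewrite ler1n.
  by rewrite powR_mulrn //; lra.
wlog xy : x y x0 y0 / x <= y => [H|].
  have [h|/ltW h] := leP x y; first exact: H.
  by rewrite addrC (addrC (x `^ t)); apply: H.
apply: (@le_trans _ _ ((2 * y) `^ t)).
  by apply: ge0_ler_powR => //; rewrite ?nnegrE ?addr_ge0 ?mulr_ge0 //; lra.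
rewrite powRM //; have := powR_ge0 x t; have := powR_ge0 y t; nra.
Qed.

(** If the [t]-dimensional measure vanished for some [t < 1 + p], some cover would have a tiny sum
    of powers [t] of its diameters. Thickening makes the sets open with positive sizes at most 1,
    and for such sizes the exponent [1 + p] gives a sum no larger than [t] does. *)
Lemma hausdorff_dim_ge (A : set 'rV[R]_2) (p c : R) : 0 < p <= 1 -> 0 < c ->
  (forall (E : nat -> set 'rV[R]_2) (e : nat -> R),
    (forall i, open (E i)) -> (forall i, 0 < e i <= 1) ->
    (forall i x y, E i x -> E i y -> `|x - y| <= e i) ->
    (forall y, A y -> exists i, E i y) ->
    exists N, c <= \sum_(i < N) e i * e i `^ p) ->
  ((1 + p)%:E <= hausdorff_dim A)%E.
Proof.
move=> /andP[p0 p1] c0 low; apply: le_ereal_inf_tmp => _ [t [t0 Ht] <-].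
rewrite lee_fin leNgt; apply/negP => tp.
(* The final bound is [4 * (eta + eta) = c / 2 < c], the 4 coming from [powRD_le]. *)
pose eta := c / 16; have eta0 : 0 < eta by rewrite divr_gt0.
have : (hausdorff_premeasure t (1 / 4) A < eta%:E)%E.
  apply: (@le_lt_trans _ _ 0%E); last by rewrite lte_fin.
  by rewrite -Ht; apply: ereal_sup_ubound; exists (1 / 4) => //=; rewrite divr_gt0.
move=> /ereal_inf_lt[_ [E [cov Ed] <-] lt_eta].
pose d i := fine (diam (E i)).
have d0 i : 0 <= d i by exact: fine_diam_ge0 (Ed i).
have d4 i : d i <= 1 / 4.
  by have := Ed i; rewrite /d; case: (diam (E i)) => [x|//|_] /=; [rewrite lee_fin|lra].
have sumd N : \sum_(i < N) d i `^ t <= eta.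
  rewrite -lee_fin; apply: le_trans (ltW lt_eta).
  have := @nneseries_lim_ge R (fun i => poweR (diam (E i)) t) xpredT 0%N N
    (fun i _ _ => poweR_ge0 _ _).
  apply: le_trans; rewrite big_mkord -sumEFin; apply: lee_sum => i _.
  by rewrite (poweR_diam (Ed i)).
pose beta i : R := eta * 2^-1 ^+ i.+1.
have beta0 i : 0 < beta i by rewrite mulr_gt0 // exprn_gt0 // invr_gt0.
(* The second entry makes the powers [t] of the [b i] sum to at most [eta]. The cap [1 / 2], with
   diameters at most [1 / 4], keeps the sizes [d i + b i] below 1. *)
pose b i := Num.min (1 / 2) (beta i `^ t^-1).
have b0 i : 0 < b i by rewrite lt_min divr_gt0 // powR_gt0.
have b2 i : b i <= 1 / 2 by rewrite ge_min lexx.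
have bt i : b i `^ t <= beta i.
  apply: (@le_trans _ _ ((beta i `^ t^-1) `^ t)); last first.
    by rewrite -powRrM mulVf ?gt_eqF // powRr1 // ltW.
  apply: ge0_ler_powR; rewrite ?nnegrE ?powR_ge0 ?(ltW (b0 _)) ?(ltW t0) //.
  by rewrite ge_min lexx orbT.
have [||||N] := low (fun i => nb (E i) (b i / 2)) (fun i => d i + b i).
- by move=> i; exact: nb_open.
- by move=> i; have := d0 i; have := b0 i; have := b2 i; have := d4 i; lra.
- move=> i x y [u Eu ux] [v Ev vy]; have := diam_dist (Ed i) Eu Ev; rewrite -/(d i).
  by have := le_normB3 x u y; have := le_normB3 u v y; rewrite (distrC x u); lra.
- move=> y /cov[i _ Ei]; exists i, y => //.
  by rewrite subrr normr0 divr_gt0.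
apply/negP; rewrite -ltNge.
apply: (@le_lt_trans _ _ (\sum_(i < N) 4 * (d i `^ t + beta i))).
  apply: ler_sum => i _; set x := d i + b i.
  have x0 : 0 < x by rewrite ltr_wpDl.
  have x1 : x <= 1 by have := b2 i; have := d4 i; rewrite /x; lra.
  rewrite -{1}(powRr1 (ltW x0)) -powRD; last by rewrite gt_eqF ?addr_gt0.
  apply: (@le_trans _ _ (x `^ t)); first by apply: ger_powR; rewrite ?x0 ?x1 // ltW.
  apply: le_trans (powRD_le (d0 i) (ltW (b0 i)) _) _; first by apply/andP; split; lra.
  by have := bt i; lra.
rewrite -mulr_sumr big_split /= /beta -mulr_sumr.
have := sumd N; have := ler_wpM2l (ltW eta0) (sum_half_pow N); rewrite /eta; lra.
Qed.

End hausdorff.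

Theorem theorem1p1 (R : realType) (k : R) (k_gt0 : 0 < k) :
  exists K : R, 1 < K /\
  forall (Omega : set 'rV[R]_2) (D : nat -> set 'rV[R]_2),
    open Omega ->
    is_packing Omega D ->
    (forall i, smooth_jordan_curve (boundary (D i)) /\
               curvature_ge_div_length (boundary (D i)) k) ->
    (forall U : set 'rV[R]_2, open U ->
       residual_set Omega D `&` U !=set0 ->
       (K%:E < hausdorff_dim (residual_set Omega D `&` U))%E) /\
    (residual_set Omega D !=set0 ->
       (K%:E < hausdorff_dim (residual_set Omega D))%E).
Proof.
pose a := Num.min (k / 64) (1 / 8) / 800.
have a01 : 0 < a <= 1.
  have m0 : 0 < Num.min (k / 64) (1 / 8) by rewrite lt_min !divr_gt0.
  have : Num.min (k / 64) (1 / 8) <= 1 / 8 by rewrite ge_min lexx orbT.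
  by rewrite /a; move: m0; set m := Num.min _ _; lra.
have [n [n0 low]] := residual_content a01.
pose p : R := n%:R^-1; have p0 : 0 < p by rewrite invr_gt0 ltr0n.
have p1 : p <= 1 by rewrite invf_le1 ?ler1n // ltr0n.
(* The dimension is shown to be at least [1 + p]; half of [p] is given up to make the inequality
   strict. *)
exists (1 + p / 2); split; first by rewrite ltrDl divr_gt0.
move=> Omega D oO [jD DO dis] hD.
have dimU (U : set 'rV[R]_2) : open U -> residual_set Omega D `&` U !=set0 ->
    ((1 + p / 2)%:E < hausdorff_dim (residual_set Omega D `&` U))%E.
  move=> oU [x0 [[Ox Dx] Ux]].
  have /choice[l bD] : forall i, exists l, body a l (D i).
    by move=> i; exact: packing_body k_gt0 (jD i) (hD i).2.
  have [|i Di|c c0 hc] := low D l (Omega `&` U) x0 bD dis (openI oO oU).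
  - by [].
  - by apply: Dx; exists i.
  apply: (@lt_le_trans _ _ (1 + p)%:E); first by rewrite lte_fin; lra.
  apply: (hausdorff_dim_ge _ c0) => [|E e oE e01 Ed cov]; first by rewrite p0 p1.
  apply: hc => // y [Oy Uy]; have [iD|nD] := pselect (exists i, D i y); first by left.
  by right; apply: cov; split => //; split => // -[i _ Di]; apply: nD; exists i.
split=> // hne; rewrite -[residual_set Omega D]setIT; apply: dimU; first exact: openT.
by rewrite setIT.
Qed.
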